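(* Let $\Omega$ be a stable differential on the stable nodal curve $C$ and let $v$ be a given vertex of $\Gamma_C$. For a path $l^k=(e_1,\dots,e_k)\in L_v^k$ of length $k\ge1$ in $\Gamma_C$ starting from $v=v(e_1)$, denote $s(l^k)=\prod_{i=1}^k s_{e_i}$ and $\beta(l^k)=\prod_{j=1}^{k-1}\beta_{-e_j,e_{j+1}}$. Then the expansion of $\eta_v^{(k)}$ is given by $$\eta_v^{(k)}(z)=(-1)^k\sum_{l^k\in L_v^k}s(l^k)\cdot\omega_v(z,q_{e_1})\,\beta(l^k)\,\tilde\xi_{-e_k}+O(|\underline{s}|^{k+1}),$$ where $z\in\widehat C_v$.
   Context: Setting. $C$ is a stable nodal curve over $\mathbb C$ of arithmetic genus $g$. Its dual graph $\Gamma_C$ has one vertex $v$ for each irreducible component, and $C_v$ denotes the (normalized) component, a compact Riemann surface; it has one unoriented edge $|e|$ for each node $q_{|e|}$. $E_C$ is the set of oriented edges, $-e$ is $e$ with opposite orientation, $v(e)$ is the source of $e$, and $E_v=\{e: v(e)=v\}$. The preimages of the node $q_{|e|}$ in the normalization are $q_e\in C_{v(e)}$ and $q_{-e}\in C_{v(-e)}$. A path of length $k$ starting at $v$ is a sequence $(e_1,\dots,e_k)$ of oriented edges with $v(e_1)=v$ and $v(e_{j+1})=v(-e_j)$; $L_v^k$ is the set of all of them. A stable differential $\Omega$ on $C$ is a collection of meromorphic differentials $\Omega_v$ on $C_v$ whose only singularities are at most simple poles at the $q_e$, $e\in E_v$, with residues $r_e$ satisfying $r_e=-r_{-e}$. Plumbing.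 Fix local coordinates $z_e$ (also written $w_e$ when a second point is needed) centered at $q_e$, on neighborhoods $V_e=\{|z_e|<1\}$. Plumbing parameters are $\underline{s}=(s_e)$ with $s_e=s_{-e}\in\mathbb C$ small, $|\underline{s}|:=\max_e|s_e|$. $U_e=\{|z_e|<\sqrt{|s_e|}\}$; the seam $\gamma_e=\partial U_e$ is oriented counter-clockwise with respect to $U_e$; $\widehat C_v:=C_v\setminus\bigsqcup_{e\in E_v}U_e$, with interior $\widetilde C_v$; $I_e$ sends $z_e$ to $z_{-e}=s_e/z_e$. Kernels. On each $C_v$ fix a Lagrangian subspace of $H_1(C_v,\mathbb Z)$ with basis of ''$A$-cycles''. The Cauchy kernel $K_v(p,q)$ is the meromorphic differential in $p$ with only simple poles, at $p=q$ with residue $\frac1{2\pi i}$ and at a base point $p=q_0$ with residue $-\frac1{2\pi i}$, and with vanishing $A$-periods in $p$; it is a multivalued meromorphic function of $q$ (additive periods along $B$-cycles). $\omega_v(p,q):=2\pi i\,d_qK_v(p,q)$ is the fundamental normalized bidifferential of the second kind. Regular parts near the nodes: for $e,e'\in E_v$, $\mathbf K_v(z_e,w_{e'})=K_v(z_e,w_{e'})$ if $e\ne e'$ and $\mathbf K_v(z_e,w_e)=K_v(z_e,w_e)-\frac{dz_e}{2\pi i(z_e-w_e)}$; $\boldsymbol\omega_v(z_e,w_{e'})=2\pi i\,d_{w_{e'}}\mathbf K_v(z_e,w_{e'})$. The constant $\beta_{e,e'}$ is the constant term in $\boldsymbol\omega_v(z_e,w_{e'})=dw_{e'}dz_e\big(\beta_{e,e'}+\text{higher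 order terms in } z_e,w_{e'}\big)$, $e,e'\in E_v$. $\omega_v(z,q_e)$ denotes the differential in $z$ obtained by dividing $\omega_v(z,z_e)$ by $dz_e$ and setting $z_e=0$. Recursive construction. On $V_e$ with $v=v(e)$, set $\xi_e^{(0)}(z_e):=\Omega_v(z_e)-\frac{r_e\,dz_e}{z_e}$ and, for $k>0$, $\xi_e^{(k)}(z_e):=\sum_{e'\in E_v}\int_{w_{e'}\in\gamma_{e'}}\mathbf K_v(z_e,w_{e'})\,I_{e'}^*\xi_{-e'}^{(k-1)}(w_{e'})$. For $k\ge1$ and $z\in\widetilde C_v$ (extended continuously to $\widehat C_v$), $\eta_v^{(k)}(z):=\sum_{e\in E_v}\int_{z_e\in\gamma_e}K_v(z,z_e)\,I_e^*\xi_{-e}^{(k-1)}(z_e)$. Write $\xi_e^{(k)}(z_e)=\tilde\xi_e^{(k)}(z_e)\,dz_e$ and $\tilde\xi_e:=\tilde\xi_e^{(0)}(q_e)$ (value at $z_e=0$). *)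

(* Defs.v *)
From HB Require Import structures.
From mathcomp Require Import all_boot all_order all_algebra.
From mathcomp Require Import complex.
From mathcomp Require Import all_classical all_reals all_analysis.

Set Implicit Arguments.
Unset Strict Implicit.
Unset Printing Implicit Defensive.

Import Order.TTheory GRing.Theory Num.Theory numFieldNormedType.Exports.

Local Open Scope classical_set_scope.
Local Open Scope ring_scope.

(** * Complex numbers *)

(* [R[i]] seen as a normed module over itself: [derivable f x 1] and
   [derive1 f x], for [f : Cx R -> Cx R], are complex differentiability and the
   complex derivative. *)
Notation Cx R := ((complex R)^o).

(* the modulus, as an element of [R] *)
Notation cabs := Normc.normc.

Definition two_pi_i {R : realType} : Cx R := Complex 0 (2 * pi).

Definition cintegral {R : realType} (a b : R) (f : R -> Cx R) : Cx R :=
  Complex (\int[lebesgue_measure]_(t in `[a, b]) complex.Re (f t))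
          (\int[lebesgue_measure]_(t in `[a, b]) complex.Im (f t)).

(* counter-clockwise circle of radius [r] centered at 0 *)
Definition circle {R : realType} (r t : R) : Cx R :=
  Complex (r * cos t) (r * sin t).

(* The contour integral of [f(w) dw] over [circle r]; the factor
   ['i * circle r t] is the derivative of [circle r] at [t]. *)
Definition circle_integral {R : realType} (r : R) (f : Cx R -> Cx R) : Cx R :=
  cintegral 0 (2 * pi)
    (fun t => f (circle r t) * (Complex 0 1 * circle r t)).

(* the value at [x] obtained by removing a removable singularity *)
Definition regularize {R : realType} {X : topologicalType}
  (f : X -> Cx R) (x : X) : Cx R := lim (f y @[y --> x^']).

Definition holomorphic_on {R : realType} (D : set (Cx R)) (f : Cx R -> Cx R) :=
  forall x, D x -> derivable f x 1.

(* holomorphic in two variables: continuous and separately holomorphic *)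
Definition holomorphic2_on {R : realType} (D : set (Cx R * Cx R))
    (f : Cx R * Cx R -> Cx R) :=
  forall p, D p -> [/\ {for p, continuous f},
    derivable (fun x : Cx R => f (x, p.2)) p.1 1
    & derivable (fun y : Cx R => f (p.1, y)) p.2 1].

(** * Riemann surfaces *)

Record prechart (R : realType) (X : topologicalType) := Prechart {
  chart_dom : set X;
  chart_map : X -> Cx R;
  chart_inv : Cx R -> X;
  chart_dom_open : open chart_dom;
  chart_img_open : open (chart_map @` chart_dom);
  chart_mapK : forall x, chart_dom x -> chart_inv (chart_map x) = x;
  chart_map_cont : forall x, chart_dom x -> {for x, continuous chart_map};
  chart_inv_cont : forall x, chart_dom x ->
    {for chart_map x, continuous chart_inv} }.

Definition transition {R : realType} {X : topologicalType}
  (phi psi : prechart R X) : Cx R -> Cx R := chart_map psi \o chart_inv phi.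

Definition compatible {R : realType} {X : topologicalType}
    (phi psi : prechart R X) :=
  holomorphic_on (chart_map phi @` (chart_dom phi `&` chart_dom psi))
    (transition phi psi).

Record riemannSurface (R : realType) := RiemannSurface {
  rs_carrier :> topologicalType;
  rs_hausdorff : hausdorff_space rs_carrier;
  rs_connected : connected [set: rs_carrier];
  rs_atlas : rs_carrier -> prechart R rs_carrier;
  rs_atlas_cover : forall x, chart_dom (rs_atlas x) x;
  rs_atlas_compat : forall x y, compatible (rs_atlas x) (rs_atlas y) }.

(* holomorphic charts: the elements of the maximal atlas *)
Record chart (R : realType) (X : riemannSurface R) := Chart {
  chart_pre :> prechart R X;
  chart_compat_to : forall x, compatible chart_pre (rs_atlas x);
  chart_compat_from : forall x, compatible (rs_atlas x) chart_pre }.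

Definition chart_at {R : realType} {X : riemannSurface R} (x : X) : chart X :=
  Chart (@rs_atlas_compat R X x) (fun y => @rs_atlas_compat R X y x).

(** * Differentials *)

(* A (1,0)-form, given by its coefficients: [coef w phi x] is the number [a]
   such that [w = a dphi] at [x].  Only the values for [x] in the domain of
   [phi] matter, and those at a pole are junk. *)
Record differential (R : realType) (X : riemannSurface R) := Differential {
  coef : chart X -> X -> Cx R;
  coef_change : forall (phi psi : chart X) x,
    chart_dom phi x -> chart_dom psi x ->
    coef phi x = coef psi x * derive1 (transition phi psi) (chart_map phi x) }.

Definition holomorphic_at {R : realType} {X : riemannSurface R}
    (w : differential X) (x : X) :=
  forall phi : chart X, chart_dom phi x ->
    \forall y \near chart_map phi x,
      derivable (coef w phi \o chart_inv phi) y 1.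

(* at most a simple pole at [x], with residue [r] *)
Definition simple_pole {R : realType} {X : riemannSurface R}
    (w : differential X) (x : X) (r : Cx R) :=
  forall phi : chart X, chart_dom phi x ->
    exists h : Cx R -> Cx R,
      (\forall y \near chart_map phi x, derivable h y 1) /\
      (\forall y \near (chart_map phi x)^',
         coef w phi (chart_inv phi y) = r / (y - chart_map phi x) + h y).

(** * Loops, homology, intersection numbers *)

(* the derivative at [t] of the path [c] read in the chart [phi] *)
Definition velocity {R : realType} {X : riemannSurface R}
    (phi : chart X) (c : R -> X) (t : R) : Cx R :=
  Complex (derive1 (fun u : R => complex.Re (chart_map phi (c u)) : R) t)
          (derive1 (fun u : R => complex.Im (chart_map phi (c u)) : R) t).

(* closed curves of class C^1, parametrized by R/Z *)
Record loop (R : realType) (X : riemannSurface R) := Loop {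
  loop_fun :> R -> X;
  loop_periodic : forall t, loop_fun (t + 1) = loop_fun t;
  loop_cont : continuous loop_fun;
  loop_derivable : forall t (phi : chart X), chart_dom phi (loop_fun t) ->
    derivable (fun u : R => complex.Re (chart_map phi (loop_fun u)) : R) t 1 /\
    derivable (fun u : R => complex.Im (chart_map phi (loop_fun u)) : R) t 1;
  loop_C1 : forall t (phi : chart X), chart_dom phi (loop_fun t) ->
    {for t, continuous (velocity phi loop_fun)} }.

Definition loop_integral {R : realType} {X : riemannSurface R}
    (w : differential X) (c : loop X) : Cx R :=
  cintegral 0 1 (fun t => coef w (chart_at (c t)) (c t) *
                          velocity (chart_at (c t)) c t).

(* Singular chains are lists of simplices with integer multiplicities.  A
   singular 1-simplex is a path on [0, 1], a singular 2-simplex a map on the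
   triangle with vertices (0,0), (1,0), (0,1); the functions are total and
   their values outside the simplex are irrelevant. *)
Notation chain1 R X := (seq (int * (R -> X))).
Notation chain2 R X := (seq (int * (R * R -> X))).

Definition triangle {R : realType} : set (R * R) :=
  [set p | [/\ 0 <= p.1, 0 <= p.2 & p.1 + p.2 <= 1]].

Definition multiplicity {R : realType} {X : Type}
    (c : chain1 R X) (sigma : R -> X) : int :=
  \sum_(x <- c | `[< forall t, 0 <= t <= 1 -> x.2 t = sigma t >]) x.1.

Definition boundary {R : realType} {X : Type} (d : chain2 R X) : chain1 R X :=
  flatten [seq [:: (  x.1, fun t : R => x.2 (1 - t, t));
                   (- x.1, fun t : R => x.2 (0, t));
                   (  x.1, fun t : R => x.2 (t, 0))] | x <- d].

Definition null_homologous {R : realType} {X : topologicalType}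
    (c : chain1 R X) :=
  exists d : chain2 R X,
    (forall i, (i < size d)%N ->
       forall x0, {within triangle, continuous (nth x0 d i).2}) /\
    (forall sigma, multiplicity c sigma = multiplicity (boundary d) sigma).

Definition homologous {R : realType} {X : topologicalType}
    (c d : chain1 R X) :=
  null_homologous (c ++ [seq (- x.1, x.2) | x <- d]).

Definition chain_of {R : realType} {X : riemannSurface R} (c : loop X) :
  chain1 R X := [:: (1, loop_fun c)].

Definition chain_comb {R : realType} {X : riemannSurface R} {n : nat}
    (m : 'I_n -> int) (a : 'I_n -> loop X) : chain1 R X :=
  [seq (m i, loop_fun (a i)) | i <- enum 'I_n].

(* X being connected, every class in H_1(X, Z) is the class of a loop. *)
Definition independent_classes {R : realType} {X : riemannSurface R} {n : nat}
    (a : 'I_n -> loop X) :=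
  forall m : 'I_n -> int, null_homologous (chain_comb m a) ->
    forall i, m i = 0.

Definition in_span {R : realType} {X : riemannSurface R} {n : nat}
    (a : 'I_n -> loop X) (c : loop X) :=
  exists m : 'I_n -> int, homologous (chain_of c) (chain_comb m a).

Definition has_genus {R : realType} (X : riemannSurface R) (g : nat) :=
  exists b : 'I_(2 * g) -> loop X,
    independent_classes b /\ (forall c, in_span b c).

(* [Im (conj u * v)] for the velocities [u] and [v] of [c] and [d] at a common
   point: its sign is that of the basis [(u, v)] of the tangent plane. *)
Definition crossing {R : realType} {X : riemannSurface R}
    (c d : loop X) (p : R * R) : R :=
  let phi := chart_at (c p.1) in
  complex.Im (conjc (velocity phi c p.1) * velocity phi d p.2).

(* [c] and [d] meet transversally, with [m] the signed number of crossings *)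
Definition signed_count {R : realType} {X : riemannSurface R}
    (c d : loop X) (m : int) :=
  exists P : seq (R * R),
    [/\ uniq P,
        (forall p, p \in P <->
           [/\ 0 <= p.1 < 1, 0 <= p.2 < 1 & c p.1 = d p.2]),
        (forall p, p \in P -> crossing c d p != 0)
      & m = \sum_(p <- P) sgz (crossing c d p)].

Definition intersection_number {R : realType} {X : riemannSurface R}
    (c d : loop X) (m : int) :=
  exists c' d' : loop X,
    [/\ homologous (chain_of c') (chain_of c),
        homologous (chain_of d') (chain_of d) & signed_count c' d' m].

(* The classes of the [a i] form a basis of a subgroup of H_1(X, Z) that is its
   own orthogonal for the intersection pairing. *)
Definition lagrangian_basis {R : realType} {X : riemannSurface R} {n : nat}
    (a : 'I_n -> loop X) :=
  independent_classes a /\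
  (forall c, in_span a c <-> forall i, intersection_number c (a i) 0).

(** * The Cauchy kernel *)

(* [K q] is the differential [p |-> K(p, q)].  The kernel is multivalued in [q]:
   the A-periods of [K q] depend, up to integers, on the loops avoiding the
   poles [q] and [q0] that are chosen to represent the A-cycles.  A (single
   valued, jointly holomorphic) branch over an open set [U] is one for which at
   each [q] in [U] the periods vanish for some such choice. *)
Definition cauchy_kernel_branch {R : realType} {X : riemannSurface R} {n : nat}
    (a : 'I_n -> loop X) (q0 : X) (U : set X) (K : X -> differential X) :=
  (forall q, U q -> q <> q0 ->
     [/\ forall p, p <> q -> p <> q0 -> holomorphic_at (K q) p,
         simple_pole (K q) q (two_pi_i^-1),
         simple_pole (K q) q0 (- two_pi_i^-1)
       & forall i, exists c : loop X,
           [/\ homologous (chain_of c) (chain_of (a i)),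
               forall t, c t <> q /\ c t <> q0
             & loop_integral (K q) c = 0]]) /\
  (forall phi psi : chart X,
     holomorphic2_on
       [set u : Cx R * Cx R | exists p q : X,
          [/\ chart_dom phi p, chart_dom psi q, U q,
              [/\ p <> q, p <> q0 & q <> q0]
            & u = (chart_map phi p, chart_map psi q)]]
       (fun u => coef (K (chart_inv psi u.2)) phi (chart_inv phi u.1))).

(** * Stable nodal curves *)

(* A nodal curve, given by its normalization.  [nc_node v e] is the point
   [q_e]; it is meaningful only for [nc_src e = v].  The same convention is used
   below for all data indexed by a vertex [v] and an edge [e] in [E_v]. *)
Record nodal_curve (R : realType) := NodalCurve {
  nc_vert : finType;
  nc_edge : finType;
  nc_opp : nc_edge -> nc_edge;
  nc_src : nc_edge -> nc_vert;
  nc_comp : nc_vert -> riemannSurface R;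
  nc_genus : nc_vert -> nat;
  nc_node : forall v, nc_edge -> nc_comp v;
  nc_oppK : involutive nc_opp;
  nc_opp_neq : forall e, nc_opp e != e;
  nc_compact : forall v, compact [set: nc_comp v];
  nc_genusP : forall v, has_genus (nc_comp v) (nc_genus v);
  nc_node_inj : forall v e e', nc_src e = v -> nc_src e' = v ->
    nc_node v e = nc_node v e' -> e = e' }.

Arguments nc_opp {R n} : rename.
Arguments nc_src {R n} : rename.
Arguments nc_comp {R n} : rename.
Arguments nc_genus {R n} : rename.
Arguments nc_node {R n} : rename.

Definition adjacent {R : realType} (X : nodal_curve R) : rel (nc_vert X) :=
  fun u v => [exists e, (nc_src e == u) && (nc_src (nc_opp e) == v)].

Definition stable {R : realType} (X : nodal_curve R) :=
  (forall u v, connect (@adjacent R X) u v) /\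
  (forall v, (2 < 2 * nc_genus v + #|[pred e : nc_edge X | nc_src e == v]|)%N).

Definition arithmetic_genus {R : realType} (X : nodal_curve R) : int :=
  (\sum_(v : nc_vert X) nc_genus v)%N%:Z + (#|nc_edge X| %/ 2)%N%:Z
  - #|nc_vert X|%:Z + 1.

Definition stable_differential {R : realType} (X : nodal_curve R)
    (Omega : forall v : nc_vert X, differential (nc_comp v))
    (r : nc_edge X -> Cx R) :=
  [/\ (forall v p, (forall e, nc_src e = v -> p <> nc_node v e) ->
         holomorphic_at (Omega v) p),
      (forall v e, nc_src e = v -> simple_pole (Omega v) (nc_node v e) (r e))
    & (forall e, r e = - r (nc_opp e))].

(** * Plumbing *)

(* [V_e] *)
Definition coord_disc {R : realType} {X : riemannSurface R} (z : chart X) :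
  set X := [set p | chart_dom z p /\ cabs (chart_map z p) < 1].

Definition local_coordinates {R : realType} (X : nodal_curve R)
    (z : forall v : nc_vert X, nc_edge X -> chart (nc_comp v)) :=
  (forall v e, nc_src e = v ->
     [/\ chart_dom (z v e) (nc_node v e),
         chart_map (z v e) (nc_node v e) = 0
       & forall w, cabs w < 1 ->
           exists2 p, chart_dom (z v e) p & chart_map (z v e) p = w]) /\
  (forall v e e', nc_src e = v -> nc_src e' = v -> e <> e' ->
     coord_disc (z v e) `&` coord_disc (z v e') = set0).

Definition plumbing_norm {R : realType} {X : nodal_curve R}
  (s : nc_edge X -> Cx R) : R := \big[Num.max/0]_(e : nc_edge X) cabs (s e).

Section Plumbing.
Context {R : realType} {X : nodal_curve R}.
Context (z : forall v : nc_vert X, nc_edge X -> chart (nc_comp v)).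
Context (K : forall v : nc_vert X, nc_edge X ->
             nc_comp v -> differential (nc_comp v)).
Context (Omega : forall v : nc_vert X, differential (nc_comp v)).
Context (r : nc_edge X -> Cx R).
Context (s : nc_edge X -> Cx R).

Implicit Types (v : nc_vert X) (e : nc_edge X).

(* [K(p, w_e)]; [K v e] is a branch over [V_e] of the Cauchy kernel of [C_v] *)
Definition kernel_at v e (phi : chart (nc_comp v)) (p : nc_comp v)
  (w : Cx R) : Cx R := coef (@K v e (chart_inv (z v e) w)) phi p.

(* the differential [omega_v(_, q_e)], without singularity at the base point *)
Definition omega_node v e (phi : chart (nc_comp v)) (p : nc_comp v) : Cx R :=
  regularize (fun x => two_pi_i * derive1 (kernel_at e phi x) 0) p.

(* bold K_v(z_e, w_e') *)
Definition reg_kernel v e e' (x w : Cx R) : Cx R :=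
  regularize (fun y : Cx R =>
      kernel_at e' (z v e) (chart_inv (z v e) y) w
      - (if e == e' then (two_pi_i * (y - w))^-1 else 0)) x.

(* bold omega_v(z_e, w_e') *)
Definition reg_omega v e e' (x w : Cx R) : Cx R :=
  two_pi_i * derive1 (reg_kernel v e e' x) w.

Definition beta_const e e' : Cx R := reg_omega (nc_src e) e e' 0 0.

(* The radius of the seam [gamma_e] *)
Definition seam_radius e : R := Num.sqrt (cabs (s e)).

(* the coefficient of [I_e^* (f dz_{-e})], where [z_{-e} = s_e / z_e] *)
Definition pullback e (f : Cx R -> Cx R) (w : Cx R) : Cx R :=
  f (s e / w) * (- s e / w ^+ 2).

Fixpoint xi_form (k : nat) e (x : Cx R) {struct k} : Cx R :=
  let v := nc_src e in
  if k is k'.+1 then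
    \sum_(e' | nc_src e' == v)
      circle_integral (seam_radius e')
        (fun w => reg_kernel v e e' x w * pullback e' (xi_form k' (nc_opp e')) w)
  else
    regularize (fun y : Cx R =>
      coef (Omega v) (z v e) (chart_inv (z v e) y) - r e / y) x.

Definition xi_node e : Cx R := xi_form 0 e 0.

Definition Chat v : set (nc_comp v) :=
  [set p | forall e, nc_src e = v ->
     ~ (chart_dom (z v e) p /\ cabs (chart_map (z v e) p) < seam_radius e)].

(* The coefficient of [eta_v^(k)], [0 < k], in the chart [phi]: the integral
   formula on the interior of [Chat v], extended by continuity to [Chat v] (and
   over the base point of the kernel). *)
Definition eta_form (k : nat) v (phi : chart (nc_comp v)) (p : nc_comp v) : Cx R :=
  lim ((\sum_(e | nc_src e == v)
          circle_integral (seam_radius e)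
            (fun w => kernel_at e phi x w *
                      pullback e (xi_form k.-1 (nc_opp e)) w))
       @[x --> within (interior (@Chat v)) p^']).

(* the set [L_v^k] of paths of length [k] starting at [v] *)
Definition is_path_from v (k : nat) (l : k.-tuple (nc_edge X)) : bool :=
  if tval l is e :: l' then
    (nc_src e == v) &&
    path (fun e e' => nc_src e' == nc_src (nc_opp e)) e l'
  else true.

Definition path_s (l : seq (nc_edge X)) : Cx R := \prod_(e <- l) s e.

Definition path_beta (l : seq (nc_edge X)) : Cx R :=
  \prod_(p <- zip l (behead l)) beta_const (nc_opp p.1) p.2.

(* the coefficient in [phi] of the leading term of [eta_v^(k)], [0 < k] *)
Definition eta_leading (k : nat) v (phi : chart (nc_comp v)) (p : nc_comp v) :
    Cx R :=
  (-1) ^+ k *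
  \sum_(l : k.-tuple (nc_edge X) | is_path_from v l)
     (if tval l is e1 :: l' then
        path_s l * omega_node e1 phi p * path_beta l *
        xi_node (nc_opp (last e1 l'))
      else 0).

End Plumbing.

Arguments Chat {R X} z s v _.
Arguments eta_form {R X} z K Omega r s k {v} phi p.
Arguments eta_leading {R X} z K Omega r s k {v} phi p.

(* Main.v *)
Require Import Defs.
From HB Require Import structures.
From mathcomp Require Import all_boot all_order all_algebra.
From mathcomp Require Import complex.
From mathcomp Require Import all_classical all_reals all_analysis.
From mathcomp Require Import ring lra.
Import Order.TTheory GRing.Theory Num.Theory numFieldNormedType.Exports.
Set Implicit Arguments.
Unset Strict Implicit.
Unset Printing Implicit Defensive.
Local Open Scope classical_set_scope.
Local Open Scope ring_scope.

(** The pullback of a holomorphic differential [f(u) du] by [u = s / w] has the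
    coefficient [f(s / w) (-s / w^2)], which is holomorphic for all [w] with
    [|w| > |s|], not only on the seam [|w| = sqrt |s|].  So the seam, which
    shrinks with [s], can be replaced by a circle of fixed radius
    ([seam_deform]).  There [s / w = O(s)] and [f(s / w) = f(0) + O(s)], hence
    for a holomorphic [a]
    [[
       \oint a(w) f(s / w) (-s / w^2) dw = - s f(0) \oint a(w) / w^2 dw + O(s^2)
                                         = - 2 pi i s f(0) a'(0) + O(s^2)
    ]]
    ([seam_leading]).  When [a] is the regular part of the Cauchy kernel,
    [2 pi i a'(0)] is one of the constants [beta] and this is one step of the
    recursion for [xi]: each step costs a factor [-s beta] and moves to the
    opposite end of an edge ([xi_leading_approx]).  When [a] is the kernel at a
    point of the component, [2 pi i a'(0)] is [omega_v(_, q_e)] and this is the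
    last step, from [xi] to [eta] ([edge_local]).  Unfolding the recursion gives
    the sum over paths ([xi_leading_paths], [eta_leading_edges]).  The error
    terms are uniform near each point that is not a node ([eta_near]), hence on
    compact sets without nodes.

    Two singularities have to be removed.  On the diagonal, the regular part of
    the kernel is defined by a limit in the first variable only; Cauchy's formula
    in that variable, over a circle avoiding the diagonal, shows that it is
    nevertheless jointly continuous ([joint_continuity], [reg_part_joint]).  At
    the base point, the pole of the kernel has a residue that does not depend on
    the second variable: [K(p, w) - K(p, 0)] is regular there, and subtracting
    [K(p, 0)] does not change the integrals since the pullback has integral zero
    ([seam_pullback_integral0], [pole_free_joint]).

    Holomorphy means pointwise differentiability here, so that the independence
    of circle integrals of their radius ([circle_integral_const]) is proved by
    Goursat's bisection, in polar coordinates.  The rest of the function theory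
    ([cauchy_formula], [cauchy_derive0], [derivable_circle_integral]) uses only
    circles centered at 0: a singularity at another point [x] is dealt with by
    letting the radius pass through [|x|], the integral being a continuous
    function of the radius ([circle_integral_deform]). *)

(** * The modulus and the topology of the complex numbers *)

Section Modulus.
Context {R : realType}.
Implicit Types (x y z w : Cx R) (e r : R).

Lemma cabsM z w : cabs (z * w : Cx R) = cabs z * cabs w.
Proof. exact: Normc.normcM. Qed.

Lemma cabsV z : cabs (z^-1 : Cx R) = (cabs z)^-1.
Proof. exact: Normc.normcV. Qed.

Lemma cabsN z : cabs (- z : Cx R) = cabs z.
Proof. exact: normcN. Qed.

Lemma cabsD z w : cabs (z + w : Cx R) <= cabs z + cabs w.
Proof. exact: le_normcD. Qed.

Lemma cabs0 : cabs (0 : Cx R) = 0.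
Proof. exact: Normc.normc0. Qed.

Lemma cabs1 : cabs (1 : Cx R) = 1.
Proof. exact: Normc.normc1. Qed.

Lemma cabs_ge0 z : 0 <= cabs z.
Proof. by case: z => a b; exact: sqrtr_ge0. Qed.

Lemma cabs_eq0 z : (cabs z == 0) = (z == 0).
Proof.
by apply/eqP/eqP => [/Normc.eq0_normc//|->]; exact: cabs0.
Qed.

Lemma cabs_gt0 z : (0 < cabs z) = (z != 0).
Proof. by rewrite lt_neqAle cabs_ge0 andbT eq_sym cabs_eq0. Qed.

Lemma cabs_distC z w : cabs (z - w : Cx R) = cabs (w - z : Cx R).
Proof. by rewrite -cabsN opprB. Qed.

Lemma cabsX z n : cabs (z ^+ n : Cx R) = cabs z ^+ n.
Proof. by elim: n => [|n IH]; rewrite ?cabs1// !exprS cabsM IH. Qed.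

Lemma cabs_sum (I : Type) (s : seq I) (P : pred I) (f : I -> Cx R) :
  cabs (\sum_(i <- s | P i) f i) <= \sum_(i <- s | P i) cabs (f i).
Proof.
elim/big_rec2 : _ => [|i a b _ h]; first by rewrite cabs0.
by apply: le_trans (cabsD _ _) _; rewrite lerD2l.
Qed.

Lemma lerBcabs z w : cabs z - cabs w <= cabs (z - w : Cx R).
Proof. by rewrite lerBlDr; apply: le_trans (cabsD _ _); rewrite subrK. Qed.

Lemma Re_le_cabs z : `|complex.Re z| <= cabs z.
Proof.
case: z => a b /=; rewrite -sqrtr_sqr ler_wsqrtr//.
by rewrite lerDl sqr_ge0.
Qed.

Lemma Im_le_cabs z : `|complex.Im z| <= cabs z.
Proof.
case: z => a b /=; rewrite -sqrtr_sqr ler_wsqrtr//.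
by rewrite lerDr sqr_ge0.
Qed.

Lemma cabs_le_ReIm z : cabs z <= `|complex.Re z| + `|complex.Im z|.
Proof.
case: z => a b /=; rewrite -[leRHS]ger0_norm ?addr_ge0// -sqrtr_sqr.
rewrite ler_wsqrtr// sqrrD !real_normK ?num_real// addrAC lerDl.
by rewrite mulrn_wge0// mulr_ge0.
Qed.

Lemma normr_cabs z : `|z| = ((cabs z)%:C)%C.
Proof. by case: z. Qed.

Lemma cvgcP {T : Type} {F : set_system T} {FF : Filter F} (f : T -> Cx R) z :
  f @ F --> z <-> forall e, 0 < e -> \forall t \near F, cabs (f t - z : Cx R) < e.
Proof.
split=> [/cvgrPdist_lt h e e0|h].
  have /h : 0 < (e%:C)%C :> R[i] by rewrite ltcR.
  by apply: filterS => t; rewrite normr_cabs ltcR cabs_distC.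
apply/cvgrPdist_lt => -[e e'] /=; rewrite ltcE/= => /andP[/eqP -> /h].
by apply: filterS => t; rewrite normr_cabs ltcR cabs_distC.
Qed.

Lemma nbhscP z (P : set (Cx R)) :
  nbhs z P <-> exists2 e, 0 < e & forall w, cabs (w - z : Cx R) < e -> P w.
Proof.
split=> [/nbhs_ballP[[e e'] /=]|[e e0 h]].
  rewrite ltcE/= => /andP[/eqP -> e0] h.
  exists e => // w wz; apply: h; rewrite -ball_normE /ball_/=.
  by rewrite normr_cabs cabs_distC ltcR.
apply/nbhs_ballP; exists (e%:C)%C => /=; first by rewrite ltcR.
by move=> w; rewrite -ball_normE /ball_/= normr_cabs ltcR cabs_distC; apply: h.
Qed.

Lemma dnbhscP z (P : set (Cx R)) :
  z^' P <-> exists2 e, 0 < e &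
    forall w, w != z -> cabs (w - z : Cx R) < e -> P w.
Proof.
split=> [/nbhscP[e e0 h]|[e e0 h]].
  by exists e => // w wz ?; exact: h.
by apply/nbhscP; exists e => // w wz ?; exact: h.
Qed.

Lemma continuouscP (f : Cx R -> Cx R) z : {for z, continuous f} <->
  forall e, 0 < e -> exists2 d, 0 < d &
    forall w, cabs (w - z : Cx R) < d -> cabs (f w - f z : Cx R) < e.
Proof.
split=> [/cvgcP h e /h /nbhscP//|h].
by apply/(@cvgcP _ (nbhs z)) => e /h ?; apply/nbhscP.
Qed.

Lemma near_cball z e : 0 < e -> \forall w \near z, cabs (w - z : Cx R) < e.
Proof. by move=> e0; apply/nbhscP; exists e. Qed.

Lemma continuous_cabs : continuous (fun z : Cx R => cabs z).
Proof.
move=> z; apply/(@cvgrPdist_lt _ _ _ (nbhs z)) => e e0.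
apply: filterS (near_cball z e0) => w; apply: le_lt_trans.
by rewrite ler_norml lerNl opprB lerBcabs /= cabs_distC lerBcabs.
Qed.

Lemma continuous_Re : continuous (fun z : Cx R => complex.Re z).
Proof.
move=> z; apply/(@cvgrPdist_lt _ _ _ (nbhs z)) => e e0.
apply: filterS (near_cball z e0) => w; apply: le_lt_trans.
by rewrite cabs_distC -raddfB; exact: Re_le_cabs.
Qed.

Lemma continuous_Im : continuous (fun z : Cx R => complex.Im z).
Proof.
move=> z; apply/(@cvgrPdist_lt _ _ _ (nbhs z)) => e e0.
apply: filterS (near_cball z e0) => w; apply: le_lt_trans.
by rewrite cabs_distC -raddfB; exact: Im_le_cabs.
Qed.

Lemma cvg_Complex {T : Type} {F : set_system T} {FF : Filter F} (f g : T -> R) a b :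
  f @ F --> a -> g @ F --> b ->
  (fun t => Complex (f t) (g t) : Cx R) @ F --> (Complex a b : Cx R).
Proof.
move=> fa gb; apply/cvgcP => e e0.
have e2 : 0 < e / 2 by rewrite divr_gt0.
move/cvgrPdist_lt/(_ _ e2) : fa; move/cvgrPdist_lt/(_ _ e2) : gb.
apply: filterS2 => t h1 h2; apply: le_lt_trans (cabs_le_ReIm _) _ => /=.
by rewrite (splitr e) ltrD// distrC.
Qed.

End Modulus.

(** * Integrals of complex-valued functions of a real variable *)
Section Integral.
Context {R : realType}.
Implicit Types (f g F : R -> Cx R) (a b c M : R) (z w : Cx R).

(** Two-sided continuity also at the end points: it holds for the restriction of
    a function that is continuous near a circle, and it avoids the topology of
    subspaces. *)
Definition ccont a b f := forall t, a <= t <= b -> {for t, continuous f}.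

Lemma ccont_Re a b f : ccont a b f ->
  forall t, a <= t <= b -> {for t, continuous (fun t => complex.Re (f t))}.
Proof.
move=> cf t /cf h; apply: continuous_comp h _; exact: continuous_Re.
Qed.

Lemma ccont_Im a b f : ccont a b f ->
  forall t, a <= t <= b -> {for t, continuous (fun t => complex.Im (f t))}.
Proof.
move=> cf t /cf h; apply: continuous_comp h _; exact: continuous_Im.
Qed.

Lemma ccontD a b f g : ccont a b f -> ccont a b g ->
  ccont a b (fun t => f t + g t).
Proof. by move=> cf cg t tab; apply: cvgD; [exact: cf|exact: cg]. Qed.

Lemma ccontM a b f g : ccont a b f -> ccont a b g ->
  ccont a b (fun t => f t * g t).
Proof. by move=> cf cg t tab; apply: cvgM; [exact: cf|exact: cg]. Qed.

Lemma ccont_cst a b z : ccont a b (fun=> z).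
Proof. by move=> t _; exact: cvg_cst. Qed.

Lemma ccontN a b f : ccont a b f -> ccont a b (fun t => - f t).
Proof. by move=> cf t tab; apply: cvgN; exact: cf. Qed.

Lemma segment_within (h : R -> R) a b :
  (forall t, a <= t <= b -> {for t, continuous h}) ->
  {within `[a, b], continuous h}.
Proof.
move=> ch; apply/continuous_in_subspaceT => t.
by rewrite inE /= in_itv /=; exact: ch.
Qed.

Lemma cont_integrable (h : R -> R) a b :
  (forall t, a <= t <= b -> {for t, continuous h}) ->
  lebesgue_measure.-integrable `[a, b] (EFin \o h).
Proof.
move=> ch; apply: continuous_compact_integrable; first exact: segment_compact.
exact: segment_within.
Qed.

Lemma eq_cintegral a b f g : (forall t, a <= t <= b -> f t = g t) ->
  cintegral a b f = cintegral a b g.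
Proof.
move=> fg; rewrite /cintegral; congr Complex;
  by apply: eq_Rintegral => t; rewrite inE /= in_itv /= => /fg ->.
Qed.

Lemma cintegralD a b f g : ccont a b f -> ccont a b g ->
  cintegral a b (fun t => f t + g t) = cintegral a b f + cintegral a b g.
Proof.
move=> cf cg; rewrite /cintegral.
transitivity (Complex
  (\int[lebesgue_measure]_(t in `[a, b]) (complex.Re (f t) + complex.Re (g t)))
  (\int[lebesgue_measure]_(t in `[a, b]) (complex.Im (f t) + complex.Im (g t)))).
  by congr Complex; apply: eq_Rintegral => t _; rewrite raddfD.
rewrite !RintegralD//; apply: cont_integrable;
  by [exact: ccont_Re|exact: ccont_Im].
Qed.

Lemma cintegralZ a b z f : ccont a b f ->
  cintegral a b (fun t => z * f t) = z * cintegral a b f.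
Proof.
move=> cf; rewrite /cintegral; case: z => x y.
have iR := cont_integrable (ccont_Re cf).
have iI := cont_integrable (ccont_Im cf).
have iZ (k : R) (h : R -> R) : lebesgue_measure.-integrable `[a, b] (EFin \o h) ->
    lebesgue_measure.-integrable `[a, b] (EFin \o (fun t => k * h t)).
  move=> ih; have := @integrableZl _ _ _ lebesgue_measure `[a, b] _ k _ ih.
  exact.
transitivity (Complex
  (\int[lebesgue_measure]_(t in `[a, b])
     (x * complex.Re (f t) - y * complex.Im (f t)))
  (\int[lebesgue_measure]_(t in `[a, b])
     (x * complex.Im (f t) + y * complex.Re (f t)))).
  by congr Complex; apply: eq_Rintegral => t _; case: (f t) => u v.
by rewrite RintegralB ?RintegralD ?RintegralZl//; exact: iZ.
Qed.

Lemma cintegralN a b f : ccont a b f ->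
  cintegral a b (fun t => - f t) = - cintegral a b f.
Proof.
move=> cf; rewrite -mulN1r -cintegralZ//.
by apply: eq_cintegral => t _; rewrite mulN1r.
Qed.

Lemma cintegralB a b f g : ccont a b f -> ccont a b g ->
  cintegral a b (fun t => f t - g t) = cintegral a b f - cintegral a b g.
Proof.
by move=> cf cg; rewrite (cintegralD cf (ccontN cg)) (cintegralN cg).
Qed.

Lemma Rintegral_bound (h : R -> R) a b M : a <= b ->
  (forall t, a <= t <= b -> {for t, continuous h}) ->
  (forall t, a <= t <= b -> `|h t| <= M) ->
  `|\int[lebesgue_measure]_(t in `[a, b]) h t| <= M * (b - a).
Proof.
move=> ab ch hM.
have ih := cont_integrable ch.
apply: le_trans (le_normr_Rintegral _ ih) _ => //.
have -> : M * (b - a) = \int[lebesgue_measure]_(_ in `[a, b]) M.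
  have E : lebesgue_measure `[a, b] = (b - a)%:E.
    rewrite lebesgue_measure_itv/= lte_fin.
    case: ltP => [_|ba]; first by rewrite -EFinD.
    by have -> : a = b by [apply/le_anti/andP; split]; rewrite subrr.
  by rewrite Rintegral_cst//; congr (_ * _); rewrite [X in fine X]E.
apply: le_Rintegral => //.
- by apply: cont_integrable => t tab;
  apply: continuous_comp (ch t tab) _; exact: norm_continuous.
- by apply: cont_integrable => t tab; exact: cvg_cst.
Qed.

(** The factor 2 comes from bounding the two components separately. *)
Lemma cintegral_bound a b f M : a <= b -> ccont a b f ->
  (forall t, a <= t <= b -> cabs (f t) <= M) ->
  cabs (cintegral a b f) <= 2 * M * (b - a).
Proof.
move=> ab cf fM; apply: le_trans (cabs_le_ReIm _) _.
rewrite -mulrA mulr_natl mulr2n /cintegral /=.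
apply: lerD; apply: Rintegral_bound => //.
- exact: ccont_Re.
- by move=> t tab; apply: le_trans (Re_le_cabs _) (fM t tab).
- exact: ccont_Im.
- by move=> t tab; apply: le_trans (Im_le_cabs _) (fM t tab).
Qed.

Lemma Rintegral_split (h : R -> R) a b c : a <= b -> b <= c ->
  (forall t, a <= t <= c -> {for t, continuous h}) ->
  \int[lebesgue_measure]_(t in `[a, c]) h t =
  \int[lebesgue_measure]_(t in `[a, b]) h t +
  \int[lebesgue_measure]_(t in `[b, c]) h t.
Proof.
move=> ab bc ch; have ih := cont_integrable ch.
have := @Rintegral_itvB _ h (BLeft a) (BRight c) b ih.
rewrite !bnd_simp => /(_ ab bc) H.
rewrite -[RHS]addrC; apply/eqP; rewrite -subr_eq; apply/eqP; rewrite H.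
apply: Rintegral_itv_obnd_cbnd; apply: integrableS ih => //.
by apply: subset_itvr; rewrite bnd_simp.
Qed.

Lemma cintegral_split f a b c : a <= b -> b <= c -> ccont a c f ->
  cintegral a c f = cintegral a b f + cintegral b c f.
Proof.
move=> ab bc cf; rewrite /cintegral.
by rewrite (Rintegral_split ab bc (ccont_Re cf)) (Rintegral_split ab bc (ccont_Im cf)).
Qed.

(** Componentwise, as the integral is. *)
Definition cderiv F f (t : R) :=
  is_derive t 1 (fun u : R => complex.Re (F u) : R) (complex.Re (f t)) /\
  is_derive t 1 (fun u : R => complex.Im (F u) : R) (complex.Im (f t)).

Lemma Rintegral_FTC (H h : R -> R) a b : a <= b ->
  (forall t, a <= t <= b -> {for t, continuous h}) ->
  (forall t, a <= t <= b -> is_derive t 1 H (h t)) ->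
  \int[lebesgue_measure]_(t in `[a, b]) h t = H b - H a.
Proof.
rewrite le_eqVlt => /predU1P[<- _ _|ab ch dH].
  by rewrite set_itv1 Rintegral_set1 subrr.
have cH t : a <= t <= b -> {for t, continuous H}.
  by move=> /dH[d _]; apply/differentiable_continuous/derivable1_diffP.
rewrite /Rintegral (@continuous_FTC2 _ h H)//.
- exact: segment_within.
- split.
  + move=> t; rewrite in_itv/= => /andP[/ltW at_ /ltW tb].
    by have [] := dH t; rewrite ?at_.
  + by apply: cvg_at_right_filter; apply: cH; rewrite lexx ltW.
  + by apply: cvg_at_left_filter; apply: cH; rewrite lexx ltW.
- move=> t; rewrite in_itv/= => /andP[/ltW at_ /ltW tb].
  by rewrite derive1E; apply: derive_val; apply: dH; rewrite at_.
Qed.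

Lemma cintegral_FTC F f a b : a <= b -> ccont a b f ->
  (forall t, a <= t <= b -> cderiv F f t) ->
  cintegral a b f = F b - F a.
Proof.
move=> ab cf dF; rewrite /cintegral.
have dR t : a <= t <= b -> is_derive t 1
  (fun u : R => complex.Re (F u) : R) (complex.Re (f t)) by move=> /dF[].
have dI t : a <= t <= b -> is_derive t 1
  (fun u : R => complex.Im (F u) : R) (complex.Im (f t)) by move=> /dF[].
have := Rintegral_FTC ab (ccont_Re cf) dR.
have := Rintegral_FTC ab (ccont_Im cf) dI.
move=> /= -> ->.
by case: (F b) (F a) => [? ?] [? ?].
Qed.

End Integral.

(** * Additive functions of rectangles *)
Section Bisection.
Context {R : realType}.
Implicit Types (x y h e d : R).

Lemma nested_point (u : nat -> R) (l : nat -> R) :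
  (forall n, u n <= u n.+1) -> (forall n, u n.+1 + l n.+1 <= u n + l n) ->
  (forall n, 0 <= l n) ->
  exists x, forall n, u n <= x <= u n + l n.
Proof.
move=> uS ulS l0.
have uD n k : u n <= u (n + k)%N.
  by elim: k => [|k IH]; rewrite ?addn0// addnS (le_trans IH).
have ulD n k : u (n + k)%N + l (n + k)%N <= u n + l n.
  by elim: k => [|k IH]; rewrite ?addn0// addnS; apply: le_trans IH.
have H n m : u n <= u m + l m.
  have [nm|/ltnW mn] := leqP n m.
    apply: (@le_trans _ _ (u m)); last by rewrite lerDl.
    by have := uD n (m - n)%N; rewrite subnKC.
  have := ulD m (n - m)%N; rewrite subnKC//; apply: le_trans.
  by rewrite lerDl.
exists (sup (range u)) => n; apply/andP; split.
  apply: ub_le_sup; last by exists n.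
  by exists (u 0%N + l 0%N) => _ [m _ <-].
by apply: ge_sup; [exists (u 0%N), 0%N|move=> _ [m _ <-]].
Qed.

(** Goursat's argument, for a function [nu x y h] of the rectangles similar to
    [a] by [b], with corner [(x, y)] and scale [h].  One of the four quarters
    carries at least a fourth of the value; iterating, one gets rectangles of
    scale [h = 2^-n] and values at least [c h^2], which shrink to a point. *)
Lemma bisection (nu : R -> R -> R -> Cx R) (x0 y0 a b : R) :
  0 <= a -> 0 <= b ->
  (forall x y h, 0 < h -> x0 <= x -> x + h * a <= x0 + a ->
     y0 <= y -> y + h * b <= y0 + b ->
     let k := h / 2 in
     nu x y h = nu x y k + nu (x + k * a) y k +
       (nu x (y + k * b) k + nu (x + k * a) (y + k * b) k)) ->
  (forall x y, x0 <= x <= x0 + a -> y0 <= y <= y0 + b ->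
     forall e, 0 < e -> exists2 d, 0 < d &
       forall x1 y1 h, 0 < h < d -> x0 <= x1 <= x -> x <= x1 + h * a <= x0 + a ->
         y0 <= y1 <= y -> y <= y1 + h * b <= y0 + b ->
         cabs (nu x1 y1 h) <= e * h ^+ 2) ->
  nu x0 y0 1 = 0.
Proof.
move=> a0 b0 add loc.
apply/eqP; rewrite -cabs_eq0 eq_le cabs_ge0 andbT leNgt; apply/negP => c0.
set c := cabs _ in c0.
pose h n : R := 2^-1 ^+ n.
have h0 n : 0 < h n by rewrite exprn_gt0// invr_gt0.
have hS n : h n / 2 = h n.+1 by rewrite /h exprSr.
pose inv n (p : R * R) := [/\ x0 <= p.1, p.1 + h n * a <= x0 + a,
  y0 <= p.2 & p.2 + h n * b <= y0 + b].
pose good n (p q : R * R) :=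
  [/\ p.1 <= q.1, q.1 + h n.+1 * a <= p.1 + h n * a,
      p.2 <= q.2, q.2 + h n.+1 * b <= p.2 + h n * b &
      cabs (nu p.1 p.2 (h n)) / 4 <= cabs (nu q.1 q.2 (h n.+1))].
have step (np : nat * (R * R)) : exists q, inv np.1 np.2 -> good np.1 np.2 q.
  case: np => n [x y] /=.
  have [I|nI] := pselect (inv n (x, y)); last by exists (x, y).
  have [/= i1 i2 i3 i4] := I.
  have := add x y (h n) (h0 n) i1 i2 i3 i4; rewrite /= hS => E.
  have kE : h n = h n.+1 + h n.+1 by rewrite -hS -splitr.
  have k0 : 0 < h n.+1 by exact: h0.
  rewrite /good /= kE; rewrite kE in i2 i4 E.
  move: (h n.+1) (h n) => k hn in k0 kE i2 i4 E *.
  have ka : 0 <= k * a by rewrite mulr_ge0// ltW.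
  have kb : 0 <= k * b by rewrite mulr_ge0// ltW.
  have [H|H1] := lerP (cabs (nu x y (k + k)) / 4) (cabs (nu x y k)).
    by exists (x, y) => _; split => //=; lra.
  have [H|H2] := lerP (cabs (nu x y (k + k)) / 4) (cabs (nu (x + k * a) y k)).
    by exists (x + k * a, y) => _; split => //=; lra.
  have [H|H3] := lerP (cabs (nu x y (k + k)) / 4) (cabs (nu x (y + k * b) k)).
    by exists (x, y + k * b) => _; split => //=; lra.
  have [H|H4] := lerP (cabs (nu x y (k + k)) / 4) (cabs (nu (x + k * a) (y + k * b) k)).
    by exists (x + k * a, y + k * b) => _; split => //=; lra.
  exfalso; have := le_trans (cabsD _ _) (lerD (cabsD (nu x y k) (nu (x + k * a) y k))
     (cabsD (nu x (y + k * b) k) (nu (x + k * a) (y + k * b) k))).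
  by rewrite -E; lra.
have [f fP] := boolp.choice step.
pose p := fix p n := if n is m.+1 then f (m, p m) else (x0, y0).
have invp n : inv n (p n).
  elim: n => [|n IH]; first by rewrite /inv /h /= expr0 !mul1r.
  have [/= g1 g2 g3 g4 _] := fP (n, p n) IH; case: IH => i1 i2 i3 i4.
  by split; [exact: le_trans g1|exact: le_trans g2 _|exact: le_trans g3|exact: le_trans g4 _].
have goodp n : good n (p n) (p n.+1) by exact: (fP (n, p n)).
have [x xP] : exists x, forall n, (p n).1 <= x <= (p n).1 + h n * a.
  apply: nested_point => n; [by have [] := goodp n|by have [] := goodp n|].
  by rewrite mulr_ge0// ltW.
have [y yP] : exists y, forall n, (p n).2 <= y <= (p n).2 + h n * b.
  apply: nested_point => n; [by have [] := goodp n|by have [] := goodp n|].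
  by rewrite mulr_ge0// ltW.
have cP n : c * h n ^+ 2 <= cabs (nu (p n).1 (p n).2 (h n)).
  elim: n => [|n IH]; first by rewrite /h expr0 expr1n mulr1.
  have [_ _ _ _] := goodp n; apply: le_trans.
  rewrite ler_pdivlMr//; apply: le_trans IH.
  by rewrite -hS expr_div_n; lra.
have xx : x0 <= x <= x0 + a.
  have [i1 i2 _ _] := invp 0%N; have := xP 0%N => /andP[q1 q2].
  by rewrite (le_trans i1)// (le_trans q2).
have yy : y0 <= y <= y0 + b.
  have [_ _ i1 i2] := invp 0%N; have := yP 0%N => /andP[q1 q2].
  by rewrite (le_trans i1)// (le_trans q2).
have [d d0 dP] := loc x y xx yy (c / 2) (divr_gt0 c0 (ltr0n _ 2)).
have [n hn] : exists n, h n < d.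
  have : h n @[n --> \oo] --> 0.
    by apply: cvg_expr; rewrite ger0_norm ?invr_ge0// invf_lt1// ltr1n.
  move/cvgrPdist_lt/(_ _ d0) => [n _ /(_ n (leqnn _))] /=.
  by rewrite sub0r normrN gtr0_norm//; exists n.
have := dP (p n).1 (p n).2 (h n).
have [i1 i2 i3 i4] := invp n; have /andP[q1 q2] := xP n; have /andP[q3 q4] := yP n.
rewrite h0 hn i1 i2 i3 i4 q1 q2 q3 q4 => /(_ isT isT isT isT isT) H.
have := le_trans (cP n) H; rewrite ler_pM2r ?exprn_gt0//.
by rewrite leNgt gtr_pMr// invf_lt1// ltr1n.
Qed.

End Bisection.

(** * Circles, rays and differentiability *)
Section Circle.
Context {R : realType}.
Implicit Types (F f g : R -> Cx R) (r t : R) (z w : Cx R).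

Lemma cabs_circle r t : 0 <= r -> cabs (circle r t) = r.
Proof.
move=> r0; rewrite /circle /= !exprMn -mulrDr cos2Dsin2 mulr1.
by rewrite sqrtr_sqr ger0_norm.
Qed.

Lemma circleE r t : circle r t = (r%:C)%C * circle 1 t :> Cx R.
Proof.
rewrite /circle; apply/eqP; rewrite eq_complex /=.
by apply/andP; split; apply/eqP; ring.
Qed.

Lemma circle_neq0 r t : 0 < r -> circle r t != 0 :> Cx R.
Proof. by move=> r0; rewrite -cabs_gt0 cabs_circle ?ltW. Qed.

Lemma circle_2pi r : circle r (2 * pi) = circle r 0 :> Cx R.
Proof. by rewrite /circle mulr_natl cos2pi sin2pi cos0 sin0. Qed.

Lemma cabs_i : cabs (Complex 0 1 : Cx R) = 1.
Proof. by rewrite /= expr0n/= expr1n add0r sqrtr1. Qed.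

Lemma cabs_real r : cabs ((r%:C)%C : Cx R) = `|r|.
Proof. by rewrite /= expr0n/= addr0 sqrtr_sqr. Qed.

Lemma cderiv_cst z t : cderiv (fun=> z) (fun=> 0) t.
Proof. by split; exact: is_derive_cst. Qed.

Lemma cderivD F f G g t : cderiv F f t -> cderiv G g t ->
  cderiv (fun t => F t + G t) (fun t => f t + g t) t.
Proof.
move=> [F1 F2] [G1 G2]; split.
  rewrite [X in is_derive _ _ X](_ : _ =
      (fun t => complex.Re (F t) : R) + (fun t => complex.Re (G t) : R)).
    by rewrite raddfD; exact: is_deriveD.
  by apply/funext => u; rewrite raddfD.
rewrite [X in is_derive _ _ X](_ : _ =
    (fun t => complex.Im (F t) : R) + (fun t => complex.Im (G t) : R)).
  by rewrite raddfD; exact: is_deriveD.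
by apply/funext => u; rewrite raddfD.
Qed.

Lemma cderivM F f G g t : cderiv F f t -> cderiv G g t ->
  cderiv (fun t => F t * G t) (fun t => f t * G t + F t * g t) t.
Proof.
move=> [F1 F2] [G1 G2]; split.
  rewrite [X in is_derive _ _ X](_ : _ =
    (fun t => complex.Re (F t) : R) * (fun t => complex.Re (G t) : R) -
    (fun t => complex.Im (F t) : R) * (fun t => complex.Im (G t) : R)); last first.
    by apply/funext => u; rewrite !fctE /=; case: (F u) => ? ?; case: (G u) => ? ?.
  apply: is_derive_eq.
  by case: (F t) (f t) (G t) (g t) => [? ?] [? ?] [? ?] [? ?] /=; rewrite /GRing.scale/=; ring.
rewrite [X in is_derive _ _ X](_ : _ =
    (fun t => complex.Re (F t) : R) * (fun t => complex.Im (G t) : R) +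
    (fun t => complex.Im (F t) : R) * (fun t => complex.Re (G t) : R)); last first.
  by apply/funext => u; rewrite !fctE /=; case: (F u) => ? ?; case: (G u) => ? ?.
apply: is_derive_eq.
by case: (F t) (f t) (G t) (g t) => [? ?] [? ?] [? ?] [? ?] /=; rewrite /GRing.scale/=; ring.
Qed.

Lemma cderiv_circle r t : cderiv (circle r) (fun t => Complex 0 1 * circle r t) t.
Proof.
split; rewrite /circle /=.
  by apply: is_derive_eq; rewrite /GRing.scale/=; ring.
by apply: is_derive_eq; rewrite /GRing.scale/=; ring.
Qed.

Lemma cderiv_ray u t : cderiv (fun r => circle r u) (fun=> circle 1 u) t.
Proof.
split; rewrite /circle /=.
  by apply: is_derive_eq; rewrite /GRing.scale/=; ring.
by apply: is_derive_eq; rewrite /GRing.scale/=; ring.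
Qed.

Lemma cderiv_cont F f t : cderiv F f t -> {for t, continuous F}.
Proof.
move=> [[d1 _] [d2 _]].
have c1 : {for t, continuous (fun u : R => complex.Re (F u) : R)}.
  exact/differentiable_continuous/derivable1_diffP.
have c2 : {for t, continuous (fun u : R => complex.Im (F u) : R)}.
  exact/differentiable_continuous/derivable1_diffP.
have E z : Complex (complex.Re z) (complex.Im z) = z by case: z.
have EF : (fun u => Complex (complex.Re (F u)) (complex.Im (F u)) : Cx R) = F.
  by apply/funext => u; exact: E.
have : (fun u => Complex (complex.Re (F u)) (complex.Im (F u)) : Cx R) @ t -->
    (Complex (complex.Re (F t)) (complex.Im (F t)) : Cx R).
  exact: (@cvg_Complex R R (nbhs t) _ _ _ (complex.Re (F t)) (complex.Im (F t)) c1 c2).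
by rewrite EF E.
Qed.

Lemma circle_cont r : continuous (circle r : R -> Cx R).
Proof. move=> t; exact: cderiv_cont (cderiv_circle r t). Qed.

Lemma ray_cont t : continuous (fun r => circle r t : Cx R).
Proof. move=> r; exact: cderiv_cont (cderiv_ray t r). Qed.

Lemma circle_lip t u : cabs (circle 1 t - circle 1 u : Cx R) <= 2 * `|t - u|.
Proof.
wlog tu : t u / u <= t => [H|].
  have [/H//|/ltW /H] := leP u t; by rewrite cabs_distC distrC.
rewrite -(@cintegral_FTC _ (circle 1) (fun t => Complex 0 1 * circle 1 t) u t)//.
- have := @cintegral_bound _ u t (fun t => Complex 0 1 * circle 1 t) 1 tu.
  rewrite mulr1 ger0_norm ?subr_ge0//; apply.
    by apply: ccontM; [exact: ccont_cst|move=> ? _; exact: circle_cont].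
  by move=> s _; rewrite cabsM cabs_i cabs_circle// mulr1.
- by apply: ccontM; [exact: ccont_cst|move=> ? _; exact: circle_cont].
- by move=> s _; exact: cderiv_circle.
Qed.

(** The first-order expansion of [F] at [z]: as opposed to a limit of difference
    quotients, it makes sense at [w = z]. *)
Definition cdiff (F : Cx R -> Cx R) z (B : Cx R) := forall e : R, 0 < e ->
  exists2 d : R, 0 < d & forall w, cabs (w - z : Cx R) < d ->
    cabs (F w - F z - B * (w - z) : Cx R) <= e * cabs (w - z : Cx R).

Lemma cdiffP (F : Cx R -> Cx R) z B : is_derive z 1 F B <-> cdiff F z B.
Proof.
have E : (fun h : Cx R => h^-1 *: ((F \o shift z) (h *: 1) - F z)) @ 0^' --> B <->
    cdiff F z B.
  split=> [/(@cvgcP _ _ (0^')) H e e0|H].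
    have /H/dnbhscP[d d0 dP] := e0; exists d => // w wz.
    have [->|wnz] := eqVneq w z; first by rewrite !subrr mulr0 subrr cabs0 mulr0.
    have w0 : w - z != 0 by rewrite subr_eq0.
    have := dP (w - z) w0; rewrite subr0 => /(_ wz)/ltW; rewrite /= [_%:A]mulr1 subrK => h.
    have -> : F w - F z - B * (w - z) = ((w - z)^-1 *: (F w - F z) - B) * (w - z).
      by rewrite mulrBl /GRing.scale /= mulrAC mulVf// mul1r.
    by rewrite cabsM ler_wpM2r// cabs_ge0.
  apply/(@cvgcP _ _ (0^')) => e e0; apply/dnbhscP.
  have e2 : 0 < e / 2 by rewrite divr_gt0.
  have [d d0 dP] := H _ e2; exists d => // h h0; rewrite subr0 => hd.
  rewrite /= [_%:A]mulr1.
  have := dP (h + z); rewrite addrK => /(_ hd) H'.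
  have -> : h^-1 *: (F (h + z) - F z) - B = (F (h + z) - F z - B * h) / h.
    by rewrite mulrBl mulfK// /GRing.scale /= mulrC.
  rewrite cabsM cabsV ltr_pdivrMr ?cabs_gt0//; apply: le_lt_trans H' _.
  by rewrite ltr_pM2r ?cabs_gt0// ltr_pdivrMr// ltr_pMr// ltr1n.
split=> [[d dE]|H].
  by apply/E; rewrite -dE.
have /E H' := H; split; first by apply/cvg_ex; exists B.
exact: cvg_lim H'.
Qed.

Lemma derivable_cdiff (F : Cx R -> Cx R) z : derivable F z 1 -> cdiff F z (derive1 F z).
Proof.
move=> dF; apply: (proj1 (cdiffP F z _)); apply: DeriveDef; first exact: dF.
by rewrite derive1E.
Qed.

Lemma cdiff_derivable (F : Cx R -> Cx R) z B : cdiff F z B -> derivable F z 1.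
Proof. by move=> /cdiffP[]. Qed.

Lemma cdiff_derive1 (F : Cx R -> Cx R) z B : cdiff F z B -> derive1 F z = B.
Proof. by move=> /cdiffP[d dE]; rewrite derive1E. Qed.

Lemma derivable_cont (F : Cx R -> Cx R) z : derivable F z 1 -> {for z, continuous F}.
Proof. by move=> dF; apply/differentiable_continuous/derivable1_diffP. Qed.

End Circle.

(* The pointwise forms, for functions written as abstractions, of the rules on
   sums and products of functions. *)
Section Continuity.
Context {R : realType} {T : topologicalType}.
Implicit Types (f g : T -> Cx R) (x : T).

Lemma cont_cst (z : Cx R) x : {for x, continuous (fun _ : T => z)}.
Proof. exact: cst_continuous. Qed.

Lemma contD f g x : {for x, continuous f} -> {for x, continuous g} ->
  {for x, continuous (fun y => f y + g y)}.
Proof. by move=> cf cg; exact: (continuousD cf cg). Qed.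

Lemma contB f g x : {for x, continuous f} -> {for x, continuous g} ->
  {for x, continuous (fun y => f y - g y)}.
Proof. by move=> cf cg; exact: (continuousB cf cg). Qed.

Lemma contM f g x : {for x, continuous f} -> {for x, continuous g} ->
  {for x, continuous (fun y => f y * g y)}.
Proof. by move=> cf cg; exact: (continuousM cf cg). Qed.

Lemma contV f x : f x != 0 -> {for x, continuous f} ->
  {for x, continuous (fun y => (f y)^-1)}.
Proof. by move=> f0 cf; exact: cvgV. Qed.

End Continuity.

(** * Cauchy's theorem for annuli *)
Section Polar.
Context {R : realType}.
Implicit Types (F f g : Cx R -> Cx R) (r t x y h : R) (z w A B : Cx R).

Lemma cont_affine A B w : {for w, continuous (fun w => A + B * w)}.
Proof.
by apply: contD; [exact: cont_cst|apply: contM; [exact: cont_cst|exact: cvg_id]].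
Qed.

(** The integral of [F(w) dw] along the boundary of the polar rectangle
    [r1 <= |w| <= r2], [t1 <= arg w <= t2]; a common factor [dr] or [dt] makes
    [circle 1 t] and [i circle r t] the velocities. *)
Definition polar_boundary F r1 r2 t1 t2 : Cx R :=
  cintegral t1 t2 (fun t => F (circle r2 t) * (Complex 0 1 * circle r2 t))
  - cintegral t1 t2 (fun t => F (circle r1 t) * (Complex 0 1 * circle r1 t))
  - cintegral r1 r2 (fun r => F (circle r t2) * circle 1 t2)
  + cintegral r1 r2 (fun r => F (circle r t1) * circle 1 t1).

Definition cont_annulus F r1 r2 := forall w, r1 <= cabs w <= r2 -> {for w, continuous F}.

Lemma ccont_arc F r t1 t2 : 0 <= r -> (forall w, cabs w = r -> {for w, continuous F}) ->
  ccont t1 t2 (fun t => F (circle r t) * (Complex 0 1 * circle r t)).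
Proof.
move=> r0 cF; apply: ccontM; last first.
  by apply: ccontM; [exact: ccont_cst|move=> t _; exact: circle_cont].
move=> t _; apply: continuous_comp; first exact: circle_cont.
by apply: cF; rewrite cabs_circle.
Qed.

Lemma ccont_ray F r1 r2 t : 0 <= r1 -> cont_annulus F r1 r2 ->
  ccont r1 r2 (fun r => F (circle r t) * circle 1 t).
Proof.
move=> r0 cF; apply: ccontM; last exact: ccont_cst.
move=> r /andP[r1r rr2]; apply: (@continuous_comp _ _ _ (fun r => circle r t : Cx R)).
  exact: ray_cont.
by apply: cF; rewrite cabs_circle ?r1r// (le_trans r0).
Qed.

Lemma cont_annulus_arc F r1 r2 r t1 t2 : 0 <= r1 -> cont_annulus F r1 r2 ->
  r1 <= r <= r2 -> ccont t1 t2 (fun t => F (circle r t) * (Complex 0 1 * circle r t)).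
Proof.
move=> r0 cF /andP[rr1 rr2]; apply: ccont_arc; first exact: le_trans rr1.
by move=> w wr; apply: cF; rewrite wr rr1.
Qed.

Lemma cont_annulusW F r1 r2 r3 r4 : r1 <= r3 -> r4 <= r2 ->
  cont_annulus F r1 r2 -> cont_annulus F r3 r4.
Proof.
by move=> h1 h2 cF w /andP[h3 h4]; apply: cF; rewrite (le_trans h1)// (le_trans h4).
Qed.

Lemma polar_boundary_split_r F r1 r2 r3 t1 t2 : 0 <= r1 -> r1 <= r2 -> r2 <= r3 ->
  cont_annulus F r1 r3 ->
  polar_boundary F r1 r3 t1 t2 =
  polar_boundary F r1 r2 t1 t2 + polar_boundary F r2 r3 t1 t2.
Proof.
move=> r0 r12 r23 cF; rewrite /polar_boundary.
rewrite (cintegral_split r12 r23 (@ccont_ray F _ _ t1 r0 cF)).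
by rewrite (cintegral_split r12 r23 (@ccont_ray F _ _ t2 r0 cF)); ring.
Qed.

Lemma polar_boundary_split_t F r1 r2 t1 t2 t3 : 0 <= r1 -> r1 <= r2 ->
  t1 <= t2 -> t2 <= t3 -> cont_annulus F r1 r2 ->
  polar_boundary F r1 r2 t1 t3 =
  polar_boundary F r1 r2 t1 t2 + polar_boundary F r1 r2 t2 t3.
Proof.
move=> r0 r12 t12 t23 cF; rewrite /polar_boundary.
rewrite (cintegral_split t12 t23 (@cont_annulus_arc F _ _ _ t1 t3 r0 cF _)) ?r12 ?lexx//.
rewrite (cintegral_split t12 t23 (@cont_annulus_arc F _ _ _ t1 t3 r0 cF _)) ?r12 ?lexx//.
by ring.
Qed.

Lemma polar_boundaryB F G r1 r2 t1 t2 : 0 <= r1 -> r1 <= r2 ->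
  cont_annulus F r1 r2 -> cont_annulus G r1 r2 ->
  polar_boundary (fun w => F w - G w) r1 r2 t1 t2 =
  polar_boundary F r1 r2 t1 t2 - polar_boundary G r1 r2 t1 t2.
Proof.
move=> r0 r12 cF cG; rewrite /polar_boundary.
have arc r : r1 <= r <= r2 ->
    cintegral t1 t2 (fun t => (F (circle r t) - G (circle r t)) * (Complex 0 1 * circle r t)) =
    cintegral t1 t2 (fun t => F (circle r t) * (Complex 0 1 * circle r t)) -
    cintegral t1 t2 (fun t => G (circle r t) * (Complex 0 1 * circle r t)).
  move=> rr; rewrite -(cintegralB (@cont_annulus_arc F _ _ _ t1 t2 r0 cF rr)
    (@cont_annulus_arc G _ _ _ t1 t2 r0 cG rr)).
  by apply: eq_cintegral => t _; rewrite mulrBl.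
have ray t :
    cintegral r1 r2 (fun r => (F (circle r t) - G (circle r t)) * circle 1 t) =
    cintegral r1 r2 (fun r => F (circle r t) * circle 1 t) -
    cintegral r1 r2 (fun r => G (circle r t) * circle 1 t).
  rewrite -(cintegralB (@ccont_ray F _ _ t r0 cF) (@ccont_ray G _ _ t r0 cG)).
  by apply: eq_cintegral => r _; rewrite mulrBl.
rewrite (arc r2) ?r12 ?lexx// (arc r1) ?r12 ?lexx// (ray t1) (ray t2).
by ring.
Qed.

Lemma eq_cderiv (F f g : R -> Cx R) t : f t = g t -> cderiv F f t -> cderiv F g t.
Proof. by rewrite /cderiv => ->. Qed.

(** An affine function has a primitive. *)
Lemma polar_boundary_affine A B r1 r2 t1 t2 : 0 <= r1 -> r1 <= r2 -> t1 <= t2 ->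
  polar_boundary (fun w => A + B * w) r1 r2 t1 t2 = 0.
Proof.
move=> r0 r12 t12.
pose P w : Cx R := A * w + 2^-1 * B * (w * w).
have cA : cont_annulus (fun w => A + B * w) r1 r2.
  move=> w _; exact: cont_affine.
have dP (c c' : R -> Cx R) t : cderiv c c' t ->
    cderiv (fun t => P (c t)) (fun t => (A + B * c t) * c' t) t.
  move=> dc.
  have := cderivD (cderivM (cderiv_cst A t) dc)
    (cderivM (cderiv_cst (2^-1 * B) t) (cderivM dc dc)).
  apply: eq_cderiv => /=.
  have two : (2 : Cx R) != 0 by rewrite pnatr_eq0.
  by field.
have arc r : r1 <= r <= r2 -> cintegral t1 t2
    (fun t => (A + B * circle r t) * (Complex 0 1 * circle r t)) =
    P (circle r t2) - P (circle r t1).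
  move=> rr; apply: (@cintegral_FTC _ (fun t => P (circle r t))) => //.
    exact: (cont_annulus_arc r0 cA rr).
  by move=> t _; apply: dP; exact: cderiv_circle.
have ray t : cintegral r1 r2 (fun r => (A + B * circle r t) * circle 1 t) =
    P (circle r2 t) - P (circle r1 t).
  apply: (@cintegral_FTC _ (fun r => P (circle r t))) => //.
    exact: (ccont_ray r0 cA).
  by move=> r _; apply: (dP (fun r => circle r t) (fun=> circle 1 t)); exact: cderiv_ray.
rewrite /polar_boundary (arc r2) ?r12 ?lexx// (arc r1) ?r12 ?lexx// (ray t1) (ray t2).
by ring.
Qed.

Lemma polar_boundary_bound F r1 r2 t1 t2 M : 0 <= r1 -> r1 <= r2 -> t1 <= t2 ->
  cont_annulus F r1 r2 ->
  (forall r t, r1 <= r <= r2 -> t1 <= t <= t2 -> cabs (F (circle r t)) <= M) ->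
  cabs (polar_boundary F r1 r2 t1 t2) <= 4 * M * (r2 * (t2 - t1) + (r2 - r1)).
Proof.
move=> r0 r12 t12 cF FM.
have M0 : 0 <= M by apply: le_trans (cabs_ge0 _) (FM r1 t1 _ _); rewrite lexx.
have arc r : r1 <= r <= r2 -> cabs (cintegral t1 t2
    (fun t => F (circle r t) * (Complex 0 1 * circle r t))) <= 2 * (M * r2) * (t2 - t1).
  move=> /andP[rr rr2]; apply: cintegral_bound => //.
    by apply: (cont_annulus_arc r0 cF); rewrite rr.
  move=> t tt; rewrite !cabsM cabs_i mul1r cabs_circle ?(le_trans r0)//.
  by apply: ler_pM; rewrite ?cabs_ge0 ?(le_trans r0)// FM// rr.
have ray t : t1 <= t <= t2 -> cabs (cintegral r1 r2
    (fun r => F (circle r t) * circle 1 t)) <= 2 * M * (r2 - r1).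
  move=> tt; apply: cintegral_bound => //; first exact: (@ccont_ray F _ _ t r0 cF).
  by move=> r rr; rewrite cabsM cabs_circle// mulr1 FM.
rewrite /polar_boundary.
apply: (@le_trans _ _ ((2 * (M * r2) * (t2 - t1) + 2 * (M * r2) * (t2 - t1)) +
    2 * M * (r2 - r1) + 2 * M * (r2 - r1))); last first.
  by rewrite le_eqVlt; apply/orP; left; apply/eqP; ring.
apply: le_trans (cabsD _ _) _; apply: lerD; last by apply: ray; rewrite lexx.
apply: le_trans (cabsD _ _) _; rewrite cabsN; apply: lerD; last by apply: ray; rewrite lexx t12.
apply: le_trans (cabsD _ _) _; rewrite cabsN; apply: lerD; apply: arc; by rewrite lexx r12.
Qed.

Lemma circle_dist r x t y : 0 <= x ->
  cabs (circle r t - circle x y : Cx R) <= `|r - x| + x * (2 * `|t - y|).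
Proof.
move=> x0; rewrite (circleE r t) (circleE x y).
have -> : (r%:C)%C * circle 1 t - (x%:C)%C * circle 1 y =
    ((r - x)%:C)%C * circle 1 t + (x%:C)%C * (circle 1 t - circle 1 y) :> Cx R.
  by rewrite raddfB /=; ring.
apply: le_trans (cabsD _ _) _; rewrite !cabsM !cabs_real cabs_circle// mulr1.
by rewrite (ger0_norm x0) lerD2l ler_wpM2l// circle_lip.
Qed.

(** Near a point [z] of a rectangle of scale [h], [F] differs from an affine
    function by [o(|w - z|) = o(h)], and the boundary has length [O(h)]. *)
Lemma polar_goursat F r1 r2 : 0 <= r1 -> r1 < r2 ->
  (forall w, r1 <= cabs w <= r2 -> derivable F w 1) ->
  polar_boundary F r1 r2 0 (2 * pi) = 0.
Proof.
move=> r0 r12 dF.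
have cF : cont_annulus F r1 r2 by move=> w /dF; exact: derivable_cont.
pose a := r2 - r1; pose b : R := 2 * pi.
have a0 : 0 < a by rewrite subr_gt0.
have b0 : 0 < b by rewrite mulr_gt0// pi_gt0.
have r20 : 0 < r2 by exact: le_lt_trans r12.
pose nu x y h := polar_boundary F x (x + h * a) y (y + h * b).
suff : nu r1 0 1 = 0.
  by rewrite /nu !mul1r add0r /a addrC subrK.
apply: (@bisection _ nu r1 0 a b); [exact: ltW|exact: ltW| |].
  move=> x y h h0 x0 xa y0 yb k.
  have k0 : 0 < k by rewrite divr_gt0.
  have hk : h = k + k by rewrite -splitr.
  have ka : 0 <= k * a by rewrite mulr_ge0// ltW.
  have kb : 0 <= k * b by rewrite mulr_ge0// ltW.
  have r2E : r1 + a = r2 by rewrite /a addrC subrK.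
  rewrite r2E in xa.
  rewrite /nu hk !mulrDl !addrA.
  rewrite hk mulrDl addrA in xa.
  have x0' : 0 <= x by exact: le_trans x0.
  have x1 : x <= x + k * a by rewrite lerDl.
  have x2 : x + k * a <= x + k * a + k * a by rewrite lerDl.
  have y1 : y <= y + k * b by rewrite lerDl.
  have y2 : y + k * b <= y + k * b + k * b by rewrite lerDl.
  have cF' : cont_annulus F x (x + k * a + k * a) by exact: cont_annulusW cF.
  rewrite (polar_boundary_split_t x0' (le_trans x1 x2) y1 y2 cF').
  rewrite (polar_boundary_split_r y (y + k * b) x0' x1 x2 cF').
  by rewrite (polar_boundary_split_r (y + k * b) (y + k * b + k * b) x0' x1 x2 cF') !addrA.
move=> x y xx yy e e0.
have r2E : r1 + a = r2 by rewrite /a addrC subrK.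
rewrite r2E in xx *.
have x0 : 0 <= x by case/andP: xx => /(le_trans r0).
have [r1x xr2] := andP xx.
pose z : Cx R := circle x y.
have /derivable_cdiff dFz : derivable F z 1 by apply: dF; rewrite cabs_circle.
set B := derive1 F z in dFz.
pose L := a + 2 * r2 * b.
have L0 : 0 < L by apply: addr_gt0 => //; apply: mulr_gt0 => //; apply: mulr_gt0.
pose C := 4 * L * (r2 * b + a).
have C0 : 0 < C.
  by do 2?apply: mulr_gt0 => //; apply: addr_gt0 => //; apply: mulr_gt0.
have [d d0 dP] := dFz (e / C) (divr_gt0 e0 C0).
exists (d / L); first by rewrite divr_gt0.
move=> x1 y1 h /andP[h0]; rewrite ltr_pdivlMr// => hL.
move=> /andP[r1x1 x1x] /andP[xx1 x1r2] /andP[_ y1y] /andP[yy1 _].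
pose G w := (F z - B * z) + B * w.
have cG s1 s2 : cont_annulus G s1 s2.
  move=> w _; exact: cont_affine.
have x10 : 0 <= x1 by exact: le_trans r1x1.
have ha : x1 <= x1 + h * a by rewrite lerDl mulr_ge0// ltW.
have hb : y1 <= y1 + h * b by rewrite lerDl mulr_ge0// ltW.
have cF1 : cont_annulus F x1 (x1 + h * a) by exact: cont_annulusW cF.
have -> : nu x1 y1 h = polar_boundary (fun w => F w - G w) x1 (x1 + h * a) y1 (y1 + h * b).
  have GE := polar_boundary_affine (F z - B * z) B x10 ha hb.
  rewrite (polar_boundaryB y1 (y1 + h * b) x10 ha cF1 (cG _ _)).
  by rewrite [X in _ - X]GE subr0.
have cFG : cont_annulus (fun w => F w - G w) x1 (x1 + h * a).
  by move=> w ww; exact: (contB (cF1 w ww) (cG x1 (x1 + h * a) w ww)).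
have FGM r t : x1 <= r <= x1 + h * a -> y1 <= t <= y1 + h * b ->
    cabs (F (circle r t) - G (circle r t)) <= (e / C) * (h * L).
  move=> /andP[rr1 rr2] /andP[tt1 tt2].
  have dist : cabs (circle r t - z : Cx R) <= h * L.
    apply: le_trans (circle_dist _ _ _ x0) _.
    have -> : h * L = h * a + r2 * (2 * (h * b)) by rewrite /L; ring.
    apply: lerD; first by rewrite ler_norml; apply/andP; split; lra.
    apply: ler_pM => //; rewrite ?mulr_ge0//; rewrite ler_pM2l//.
    by rewrite ler_norml; apply/andP; split; lra.
  have := dP (circle r t) (le_lt_trans dist hL).
  have -> : F (circle r t) - G (circle r t) = F (circle r t) - F z - B * (circle r t - z).
    by rewrite /G; ring.
  move/le_trans; apply; apply: ler_wpM2l => //.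
  by apply: divr_ge0; exact: ltW.
apply: le_trans (polar_boundary_bound x10 ha hb cFG FGM) _.
have C1 : C != 0 by rewrite gt_eqF.
have h2 : x1 + h * a <= r2 by lra.
have hhb : 0 <= h * b by apply: mulr_ge0; exact: ltW.
have hha : 0 <= h * a by apply: mulr_ge0; exact: ltW.
have eC : 0 <= e / C by apply: divr_ge0; exact: ltW.
have hL0 : 0 <= h * L by apply: mulr_ge0; exact: ltW.
apply: (@le_trans _ _ (4 * (e / C * (h * L)) * (r2 * (h * b) + h * a))).
  apply: ler_wpM2l; first by apply: mulr_ge0 => //; apply: mulr_ge0.
  have -> : y1 + h * b - y1 = h * b by ring.
  have -> : x1 + h * a - x1 = h * a by ring.
  by rewrite lerD2r; apply: ler_wpM2r.
have -> : 4 * (e / C * (h * L)) * (r2 * (h * b) + h * a) =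
    (e * h ^+ 2) * (C / C) by rewrite /C; ring.
by rewrite divff// mulr1.
Qed.

(** For a full turn the two radial sides cancel. *)
Theorem circle_integral_const F r1 r2 : 0 <= r1 -> r1 <= r2 ->
  (forall w, r1 <= cabs w <= r2 -> derivable F w 1) ->
  circle_integral r1 F = circle_integral r2 F.
Proof.
move=> r0; rewrite le_eqVlt => /predU1P[->//|r12] dF.
have := polar_goursat r0 r12 dF; rewrite /polar_boundary /circle_integral.
rewrite (circle_2pi 1).
rewrite (@eq_cintegral _ r1 r2 (fun r => F (circle r (2 * pi)) * _)
   (fun r => F (circle r 0) * circle 1 0)); last by move=> r _; rewrite circle_2pi.
by rewrite subrK => /eqP; rewrite subr_eq0 => /eqP ->.
Qed.

End Polar.

(** * Circle integrals as functions of parameters and of the radius *)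
Section Param.
Context {R : realType} {T : topologicalType}.
Implicit Types (r : R) (w : Cx R) (u : T).

(** Compactness of the segment makes the continuity in the parameter uniform. *)
Lemma cintegral_param (a b : R) (I : R -> T -> Cx R) (u0 : T) : a <= b ->
  (forall t, a <= t <= b -> {for (t, u0), continuous (fun p : R * T => I p.1 p.2)}) ->
  (\forall u \near u0, ccont a b (I ^~ u)) ->
  {for u0, continuous (fun u => cintegral a b (I ^~ u))}.
Proof.
move=> ab cI nI; apply/(@cvgcP _ T (nbhs u0)) => e e0.
have cI0 : ccont a b (I ^~ u0) := nbhs_singleton nI.
have C0 : 0 < 2 * (b - a) + 1 by rewrite ltr_wpDl// mulr_ge0// subr_ge0.
pose e' := e / (2 * (b - a) + 1).
have e'0 : 0 < e' by rewrite divr_gt0.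
have H : \forall u \near u0, `[a, b] `<=` (fun t => cabs (I t u - I t u0) <= e').
  have /compact_near_coveringP := @segment_compact R a b.
  move=> /(_ T (nbhs u0) (fun u t => cabs (I t u - I t u0) <= e')); apply.
  move=> t; rewrite /= in_itv /= => /cI /(@cvgcP _ _ (nbhs (t, u0))) ct.
  have e2 : 0 < e' / 2 by rewrite divr_gt0.
  have [[A B] /= [At Bu] AB] := ct _ e2.
  exists (A, B) => //= -[t' u'] [/= At' Bu'].
  have h1 := AB (t', u') (conj At' Bu').
  have h2 := AB (t', u0) (conj At' (nbhs_singleton Bu)).
  have -> : I t' u' - I t' u0 = (I t' u' - I t u0) - (I t' u0 - I t u0) by ring.
  apply: le_trans (cabsD _ _) _; rewrite cabsN (splitr e').
  by apply: lerD; exact: ltW.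
apply: filterS2 H nI => u Hu cIu.
rewrite -(cintegralB cIu cI0).
apply: le_lt_trans (cintegral_bound (M := e') ab _ _) _.
- exact: (ccontD cIu (ccontN cI0)).
- by move=> t tab; apply: Hu; rewrite /= in_itv.
rewrite mulrAC /e' mulrCA gtr_pMr// ltr_pdivrMr// mul1r.
by rewrite ltrDl.
Qed.

Definition ccirc r (F : Cx R -> Cx R) := forall w, cabs w = r -> {for w, continuous F}.

Lemma circle_integral_param r (G : T -> Cx R -> Cx R) (u0 : T) : 0 <= r ->
  (forall w, cabs w = r -> {for (u0, w), continuous (fun p : T * Cx R => G p.1 p.2)}) ->
  (\forall u \near u0, ccirc r (G u)) ->
  {for u0, continuous (fun u => circle_integral r (G u))}.
Proof.
move=> r0 cG nG.
apply: (@cintegral_param 0 (2 * pi)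
  (fun t u => G u (circle r t) * (Complex 0 1 * circle r t))).
- by rewrite mulr_ge0// pi_ge0.
- move=> t _.
  have cc : {for (t, u0), continuous (fun p : R * T => circle r p.1 : Cx R)}.
    apply: (@continuous_comp _ _ _ (fun p : R * T => p.1) (circle r)).
      exact: cvg_fst.
    exact: circle_cont.
  have c1 : {for (t, u0), continuous (fun p : R * T => G p.2 (circle r p.1))}.
    apply: (@continuous_comp _ _ _ (fun p : R * T => (p.2, circle r p.1 : Cx R))
      (fun p : T * Cx R => G p.1 p.2)); last by apply: cG; rewrite cabs_circle.
    have c2 : {for (t, u0), continuous (fun p : R * T => p.2)} by exact: cvg_snd.
    exact: (cvg_pair c2 cc).
  exact: (contM c1 (contM (@cont_cst R _ (Complex 0 1) _) cc)).
- by apply: filterS nG => u cGu; exact: ccont_arc.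
Qed.

End Param.

Section CircleIntegral.
Context {R : realType}.
Implicit Types (F G f g : Cx R -> Cx R) (r e M : R) (x y z w u : Cx R).

Lemma cabs_small z : (forall e, 0 < e -> cabs z <= e) -> z = 0.
Proof.
move=> H; apply/eqP; rewrite -cabs_eq0 eq_le cabs_ge0 andbT.
by apply/ler_addgt0Pr => e e0; rewrite add0r; exact: H.
Qed.

Lemma eq_circle_integral r F G : 0 <= r -> (forall w, cabs w = r -> F w = G w) ->
  circle_integral r F = circle_integral r G.
Proof. by move=> r0 FG; apply: eq_cintegral => t _; rewrite FG// cabs_circle. Qed.

Lemma circle_integralD r F G : 0 <= r -> ccirc r F -> ccirc r G ->
  circle_integral r (fun w => F w + G w) = circle_integral r F + circle_integral r G.
Proof.
move=> r0 cF cG; rewrite /circle_integral.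
rewrite -(cintegralD (@ccont_arc _ F r _ _ r0 cF) (@ccont_arc _ G r _ _ r0 cG)).
by apply: eq_cintegral => t _; rewrite mulrDl.
Qed.

Lemma circle_integralZ r z F : 0 <= r -> ccirc r F ->
  circle_integral r (fun w => z * F w) = z * circle_integral r F.
Proof.
move=> r0 cF; rewrite /circle_integral -(cintegralZ z (@ccont_arc _ F r _ _ r0 cF)).
by apply: eq_cintegral => t _; rewrite mulrA.
Qed.

Lemma circle_integralB r F G : 0 <= r -> ccirc r F -> ccirc r G ->
  circle_integral r (fun w => F w - G w) = circle_integral r F - circle_integral r G.
Proof.
move=> r0 cF cG; rewrite /circle_integral.
rewrite -(cintegralB (@ccont_arc _ F r _ _ r0 cF) (@ccont_arc _ G r _ _ r0 cG)).
by apply: eq_cintegral => t _; rewrite mulrBl.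
Qed.

(** Twice the length of the circle, because of [cintegral_bound]. *)
Lemma circle_integral_bound r F M : 0 <= r -> ccirc r F ->
  (forall w, cabs w = r -> cabs (F w) <= M) ->
  cabs (circle_integral r F) <= 4 * pi * r * M.
Proof.
move=> r0 cF FM.
apply: le_trans (cintegral_bound (M := M * r) _ (ccont_arc r0 cF) _) _.
- by rewrite mulr_ge0// pi_ge0.
- move=> t _; rewrite !cabsM cabs_i mul1r cabs_circle//.
  by rewrite ler_wpM2r// FM// cabs_circle.
by rewrite subr0 le_eqVlt; apply/orP; left; apply/eqP; ring.
Qed.

Lemma circle_integral_inv r : 0 < r -> circle_integral r (fun w => w^-1) = two_pi_i.
Proof.
move=> r0; rewrite /circle_integral.
transitivity (cintegral 0 (2 * pi) (fun _ : R => Complex 0 1 : Cx R)).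
  by apply: eq_cintegral => t _; rewrite mulrCA mulVf ?mulr1// circle_neq0.
rewrite (@cintegral_FTC _ (fun t => Complex 0 t)) ?mulr_ge0 ?pi_ge0//.
- by rewrite /two_pi_i; apply/eqP; rewrite eq_complex /= !subr0 !eqxx.
- exact: ccont_cst.
- by move=> t _; split => /=; [exact: is_derive_cst|exact: is_derive_id].
Qed.

Lemma circle_joint (p : R * R) : {for p, continuous (fun p : R * R => circle p.2 p.1 : Cx R)}.
Proof.
have c1 : {for p, continuous (fun p : R * R => p.1)} by exact: cvg_fst.
have c2 : {for p, continuous (fun p : R * R => p.2)} by exact: cvg_snd.
have cc : {for p, continuous (fun p : R * R => cos p.1)}.
  by apply: (continuous_comp c1); exact: continuous_cos.
have cs : {for p, continuous (fun p : R * R => sin p.1)}.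
  by apply: (continuous_comp c1); exact: continuous_sin.
have m1 : {for p, continuous (fun p : R * R => p.2 * cos p.1)} by exact: (continuousM c2 cc).
have m2 : {for p, continuous (fun p : R * R => p.2 * sin p.1)} by exact: (continuousM c2 cs).
exact: (@cvg_Complex R _ (nbhs p) _ _ _ _ _ m1 m2).
Qed.

Lemma circle_integral_radius F r0 : 0 < r0 ->
  (\forall r \near r0, ccirc r F) ->
  {for r0, continuous (fun r => circle_integral r F)}.
Proof.
move=> r00 nF.
apply: (@cintegral_param R R 0 (2 * pi)
  (fun t r => F (circle r t) * (Complex 0 1 * circle r t))).
- by rewrite mulr_ge0// pi_ge0.
- move=> t _; have cc := @circle_joint (t, r0).
  have c1 : {for (t, r0), continuous (fun p : R * R => F (circle p.2 p.1))}.
    apply: (continuous_comp cc).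
    by apply: (nbhs_singleton nF); rewrite cabs_circle// ltW.
  have c2 := contM c1 (contM (@cont_cst R _ (Complex 0 1) _) cc).
  exact: c2.
- have : \forall r \near r0, 0 < r by exact: lt_nbhsr.
  by apply: filterS2 nF => r cFr /ltW r0'; exact: ccont_arc.
Qed.

Lemma continuous_limit_value (phi : R -> Cx R) c k :
  {for c, continuous phi} ->
  (forall d : R, 0 < d -> exists2 q, `|q - c| < d & phi q = k) -> phi c = k.
Proof.
move=> cphi H; apply/eqP; rewrite -subr_eq0; apply/eqP; apply: cabs_small => e e0.
have /(@cvgcP _ _ (nbhs c)) /(_ e e0) := cphi.
move=> /nbhs_normP[d /= d0 dP].
have [q qd <-] := H d d0; rewrite cabs_distC; apply: ltW.
by apply: (dP q) => /=; rewrite distrC.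
Qed.

(** The integral is constant for radii below [|x|] and for radii above [|x|], and
    it is a continuous function of the radius. *)
Lemma circle_integral_deform F x a b r1 r2 : 0 <= a -> a < r1 -> r1 <= r2 -> r2 < b ->
  (forall u, a < cabs u < b -> u <> x -> derivable F u 1) ->
  (a < cabs x < b -> {for x, continuous F}) ->
  circle_integral r1 F = circle_integral r2 F.
Proof.
move=> a0 ar1 r12 r2b dF cFx.
have cF u : a < cabs u < b -> {for u, continuous F}.
  move=> uab; have [ux|/eqP ux] := eqVneq u x; first by rewrite ux; apply: cFx; rewrite -ux.
  exact/derivable_cont/dF.
have off s1 s2 : a < s1 -> s1 <= s2 -> s2 < b -> ~~ (s1 <= cabs x <= s2) ->
    circle_integral s1 F = circle_integral s2 F.
  move=> as1 s12 s2b xs; apply: circle_integral_const => //.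
    by rewrite (le_trans a0)// ltW.
  move=> u /andP[us1 us2]; apply: dF.
    by rewrite (lt_le_trans as1)// (le_lt_trans us2).
  by move=> ux; move: xs; rewrite -ux us1 us2.
have [xab|xab] := boolP (a < cabs x < b); last first.
  apply: off => //; apply: contra xab => /andP[h1 h2].
  by rewrite (lt_le_trans ar1)// (le_lt_trans h2).
have [ax xb] := andP xab.
have cphi : {for cabs x, continuous (fun r => circle_integral r F)}.
  apply: circle_integral_radius; first exact: le_lt_trans ax.
  have : \forall r \near cabs x, a < r by exact: lt_nbhsr.
  have : \forall r \near cabs x, r < b by exact: lt_nbhsl.
  by apply: filterS2 => r rb ra w wr; apply: cF; rewrite wr ra.
suff H r : a < r < b -> circle_integral (cabs x) F = circle_integral r F.
  rewrite -(H r1) -?(H r2)//; first by rewrite (lt_le_trans ar1).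
  by rewrite ar1 (le_lt_trans r12).
move=> /andP[ar rb]; have [rx|xr|->//] := ltgtP r (cabs x).
  apply: (continuous_limit_value cphi) => d d0.
  pose q := Num.max r (cabs x - d / 2).
  have d2 : 0 < d / 2 by rewrite divr_gt0.
  have qx : q < cabs x by rewrite gt_max rx ltrBlDr ltrDl.
  have rq : r <= q by rewrite le_max lexx.
  have dq : cabs x - d / 2 <= q by rewrite le_max lexx orbT.
  exists q; first by rewrite ltr_norml; apply/andP; split; lra.
  apply/esym/off => //; first exact: lt_trans qx xb.
  by rewrite negb_and -!ltNge qx orbT.
apply: (continuous_limit_value cphi) => d d0.
pose q := Num.min r (cabs x + d / 2).
have d2 : 0 < d / 2 by rewrite divr_gt0.
have qx : cabs x < q by rewrite lt_min xr ltrDl.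
have rq : q <= r by rewrite ge_min lexx.
have dq : q <= cabs x + d / 2 by rewrite ge_min lexx orbT.
exists q; first by rewrite ltr_norml; apply/andP; split; lra.
apply: off => //; first exact: lt_trans qx.
by rewrite negb_and -!ltNge qx.
Qed.

End CircleIntegral.

(** * Rules of differentiation and the difference quotient *)
Section Derivability.
Context {R : realType}.
Implicit Types (F G f g : Cx R -> Cx R) (x y z w u : Cx R).

Lemma derD f g x : derivable f x 1 -> derivable g x 1 ->
  derivable (fun y => f y + g y) x 1.
Proof. by move=> df dg; exact: (derivableD df dg). Qed.

Lemma derB f g x : derivable f x 1 -> derivable g x 1 ->
  derivable (fun y => f y - g y) x 1.
Proof. by move=> df dg; exact: (derivableB df dg). Qed.

Lemma derM f g x : derivable f x 1 -> derivable g x 1 ->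
  derivable (fun y => f y * g y) x 1.
Proof. by move=> df dg; exact: (derivableM df dg). Qed.

Lemma derV f x : f x != 0 -> derivable f x 1 -> derivable (fun y => (f y)^-1) x 1.
Proof. by move=> f0 df; exact: (derivableV f0 df). Qed.

Lemma der_cst z x : derivable (fun _ : Cx R => z) x 1.
Proof. exact: derivable_cst. Qed.

Lemma der_id x : derivable (fun y : Cx R => y) x 1.
Proof. exact: derivable_id. Qed.

Lemma der_comp f g x : derivable g x 1 -> derivable f (g x) 1 ->
  derivable (fun y => f (g y)) x 1.
Proof.
move=> /derivable1_diffP dg /derivable1_diffP df; apply/derivable1_diffP.
exact: (differentiable_comp dg df).
Qed.

Lemma cont_near_eq (T U : topologicalType) (f g : T -> U) (t : T) :
  (\forall s \near t, f s = g s) -> {for t, continuous f} -> {for t, continuous g}.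
Proof.
move=> fg cf; have E : f t = g t := nbhs_singleton fg.
have : g @ t --> f t by apply: cvg_trans cf; apply: near_eq_cvg.
by rewrite E.
Qed.

Lemma near_neq x y : y != x -> \forall u \near y, u != x.
Proof.
move=> yx; apply/nbhscP; exists (cabs (y - x)); first by rewrite cabs_gt0 subr_eq0.
by move=> u; apply: contraTN => /eqP ->; rewrite cabs_distC ltxx.
Qed.

Definition dquot g x u : Cx R :=
  if u == x then derive1 g x else (g u - g x) / (u - x).

Lemma dquot_cont g x : derivable g x 1 -> {for x, continuous (dquot g x)}.
Proof.
move=> /derivable_cdiff dg; apply/continuouscP => e e0.
have e2 : 0 < e / 2 by rewrite divr_gt0.
have [d d0 dP] := dg _ e2; exists d => // w wx.
rewrite /dquot eqxx; have [_|wnx] := eqVneq w x; first by rewrite subrr cabs0.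
have w0 : w - x != 0 by rewrite subr_eq0.
have -> : (g w - g x) / (w - x) - derive1 g x =
    (g w - g x - derive1 g x * (w - x)) / (w - x).
  by rewrite [RHS]mulrBl mulfK.
rewrite cabsM cabsV ltr_pdivrMr ?cabs_gt0//; apply: le_lt_trans (dP w wx) _.
by rewrite ltr_pM2r ?cabs_gt0// ltr_pdivrMr// ltr_pMr// ltr1n.
Qed.

Lemma dquot_derivable g x u : u != x -> derivable g u 1 -> derivable (dquot g x) u 1.
Proof.
move=> ux dg.
apply: (@near_eq_derivable _ _ _ (fun u => (g u - g x) / (u - x))).
  by have := near_neq ux; apply: filterS => w wx; rewrite /dquot (negbTE wx).
have d1 : derivable (fun u => g u - g x) u 1 := derB dg (@der_cst (g x) u).
have d2 : derivable (fun u => u - x) u 1 := derB (@der_id u) (@der_cst x u).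
have d3 : derivable (fun u => (u - x)^-1) u 1 by apply: derV d2; rewrite subr_eq0.
exact: (derM d1 d3).
Qed.

End Derivability.

(** * Cauchy's formula and its consequences *)
Section Cauchy.
Context {R : realType}.
Implicit Types (F G f g : Cx R -> Cx R) (x y z w u : Cx R) (r e M : R).

Lemma pi4_gt0 : 0 < 4 * pi :> R.
Proof. by rewrite mulr_gt0// pi_gt0. Qed.

Lemma two_pi_i_neq0 : two_pi_i != 0 :> Cx R.
Proof.
by rewrite /two_pi_i eq_complex /= negb_and mulf_neq0 ?orbT// gt_eqF// pi_gt0.
Qed.

Lemma cabs_two_pi_i : cabs (two_pi_i : Cx R) = 2 * pi.
Proof.
rewrite /two_pi_i /= expr0n/= add0r sqrtr_sqr ger0_norm//.
by rewrite mulr_ge0// pi_ge0.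
Qed.

Lemma derBx y u : derivable (fun u : Cx R => u - y) u 1.
Proof. by apply: derB; [exact: der_id|exact: der_cst]. Qed.

Lemma cabs_sub_gt0 u x : cabs x < cabs u -> u - x != 0.
Proof. by move=> xu; rewrite subr_eq0; apply: contraTN xu => /eqP ->; rewrite ltxx. Qed.

Lemma der_cauchy_kernel u x : cabs x < cabs u -> derivable (fun u : Cx R => (u - x)^-1) u 1.
Proof. by move=> /cabs_sub_gt0 ux; apply: derV => //; exact: derBx. Qed.

Lemma ccirc_der r F : (forall u, cabs u = r -> derivable F u 1) -> ccirc r F.
Proof. by move=> H u /H; exact: derivable_cont. Qed.

(** The integral of [1 / (u - x) - 1 / u = x / (u (u - x))] does not depend on
    the radius and is [O(1 / Q)] for the radius [Q]. *)
Lemma circle_integral_kernel r x : cabs x < r ->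
  circle_integral r (fun u => (u - x)^-1) = two_pi_i.
Proof.
move=> xr; have r0 : 0 < r := le_lt_trans (cabs_ge0 x) xr.
pose F u : Cx R := x * (u^-1 * (u - x)^-1).
have dF u : r <= cabs u -> derivable F u 1.
  move=> ru; have xu : cabs x < cabs u by exact: lt_le_trans ru.
  apply: derM; first exact: der_cst.
  apply: derM; last exact: der_cauchy_kernel.
  by apply: derV; [rewrite -cabs_gt0 (lt_le_trans r0)|exact: der_id].
have F0 : circle_integral r F = 0.
  apply: cabs_small => e e0.
  (* so that [4 pi |x| / (Q - |x|) <= e] *)
  pose Q := r + cabs x + 4 * pi * cabs x / e.
  have p0 : 0 <= 4 * pi * cabs x / e.
    by rewrite divr_ge0// ?mulr_ge0 ?cabs_ge0 ?pi_ge0// ltW.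
  have rQ : r <= Q by rewrite /Q -addrA lerDl addr_ge0// cabs_ge0.
  have Q0 : 0 < Q by exact: lt_le_trans rQ.
  have Qx : r + 4 * pi * cabs x / e = Q - cabs x by rewrite /Q; ring.
  have Qx0 : 0 < Q - cabs x by rewrite -Qx ltr_wpDr.
  rewrite (circle_integral_const (ltW r0) rQ); last by move=> u /andP[/dF].
  apply: le_trans (circle_integral_bound
    (M := cabs x * (Q^-1 * (Q - cabs x)^-1)) (ltW Q0) _ _) _.
  - by apply: ccirc_der => u uQ; apply: dF; rewrite uQ.
  - move=> u uQ; rewrite /F !cabsM !cabsV uQ ler_wpM2l ?cabs_ge0//.
    rewrite ler_wpM2l ?invr_ge0 ?(ltW Q0)//.
    rewrite lef_pV2 ?posrE// -?uQ ?lerBcabs// cabs_gt0 cabs_sub_gt0// uQ.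
    by rewrite -subr_gt0.
  have -> : 4 * pi * Q * (cabs x * (Q^-1 * (Q - cabs x)^-1)) = (4 * pi * cabs x) / (Q - cabs x).
    have QQ : Q != 0 by rewrite gt_eqF.
    by move: (Q - cabs x)^-1 => k; field.
  rewrite ler_pdivrMr// -Qx.
  have -> : e * (r + 4 * pi * cabs x / e) = e * r + 4 * pi * cabs x.
    by rewrite mulrDr; congr (_ + _); rewrite mulrC divfK// gt_eqF.
  by rewrite lerDr mulr_ge0// ltW.
rewrite -(circle_integral_inv r0) -[RHS]addr0 -F0 -circle_integralD ?ltW//.
- apply: eq_circle_integral (ltW r0) _ => u ur; rewrite /F.
  have u0 : u != 0 by rewrite -cabs_gt0 ur.
  have ux : u - x != 0 by rewrite cabs_sub_gt0// ur.
  by field; rewrite u0 ux.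
- apply: ccirc_der => u ur; apply: derV; first by rewrite -cabs_gt0 ur.
  exact: der_id.
- by apply: ccirc_der => u ur; apply: dF; rewrite ur.
Qed.

Lemma continuous_near_bound g x : {for x, continuous g} ->
  exists2 d : R, 0 < d & forall w, cabs (w - x) < d -> cabs (g w) <= cabs (g x) + 1.
Proof.
move=> /continuouscP /(_ 1 ltr01) [d d0 dP]; exists d => // w /dP wd.
have -> : g w = g x + (g w - g x) by ring.
by apply: le_trans (cabsD _ _) _; rewrite lerD2l ltW.
Qed.

(** The difference quotient [(g u - g x) / (u - x)] is derivable off [0] and [x]
    and continuous at [x], so its integral does not depend on the radius, and it
    tends to zero with the radius.  Mere continuity of [g] at the center allows a
    removable singularity there. *)
Theorem cauchy_formula g eps r x :
  (forall y, 0 < cabs y < eps -> derivable g y 1) -> {for 0, continuous g} ->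
  r < eps -> cabs x < r ->
  circle_integral r (fun u => g u * (u - x)^-1) = two_pi_i * g x.
Proof.
move=> dg cg reps xr; have r0 : 0 < r := le_lt_trans (cabs_ge0 x) xr.
have ck : ccirc r (fun u => (u - x)^-1).
  by apply: ccirc_der => u ur; apply: der_cauchy_kernel; rewrite ur.
have cgr : ccirc r g.
  by apply: ccirc_der => u ur; apply: dg; rewrite ur r0.
have cd : ccirc r (fun u => (g u - g x) * (u - x)^-1).
  by move=> u ur; exact: (contM (contB (cgr u ur) (@cont_cst R _ (g x) u)) (ck u ur)).
suff H : circle_integral r (fun u => (g u - g x) * (u - x)^-1) = 0.
  have -> : circle_integral r (fun u => g u * (u - x)^-1) =
      circle_integral r (fun u => (g u - g x) * (u - x)^-1 + g x * (u - x)^-1).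
    by apply: eq_circle_integral (ltW r0) _ => u _; ring.
  have ckg : ccirc r (fun u => g x * (u - x)^-1).
    by move=> u ur; exact: (contM (@cont_cst R _ (g x) u) (ck u ur)).
  rewrite (circle_integralD (ltW r0) cd ckg) H add0r (circle_integralZ _ (ltW r0) ck).
  by rewrite (circle_integral_kernel xr) mulrC.
have [x0|x0] := eqVneq x 0.
  rewrite x0; apply: cabs_small => e e0.
  have [d d0 dP] := (continuouscP g 0).1 cg (e / (4 * pi)) (divr_gt0 e0 pi4_gt0).
  pose q := Num.min r (d / 2).
  have q0 : 0 < q by rewrite lt_min r0 divr_gt0.
  have qr : q <= r by rewrite ge_min lexx.
  have qd : q < d.
    by rewrite (@le_lt_trans _ _ (d / 2))// ?ge_min ?lexx ?orbT// ltr_pdivrMr// ltr_pMr// ltr1n.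
  have dF u : q <= cabs u <= r -> derivable (fun u => (g u - g 0) * (u - 0)^-1) u 1.
    move=> /andP[qu ur]; have u0 : 0 < cabs u by exact: lt_le_trans qu.
    apply: derM; last by apply: der_cauchy_kernel; rewrite cabs0.
    by apply: derB; [apply: dg; rewrite u0 (le_lt_trans ur)|exact: der_cst].
  rewrite -(circle_integral_const (ltW q0) qr dF).
  apply: le_trans (circle_integral_bound (M := e / (4 * pi) / q) (ltW q0) _ _) _.
  - by apply: ccirc_der => u uq; apply: dF; rewrite uq lexx.
  - move=> u uq; rewrite cabsM cabsV subr0 uq ler_wpM2r ?invr_ge0 ?(ltW q0)//.
    by apply/ltW/dP; rewrite subr0 uq.
  have qn : q != 0 by rewrite gt_eqF.
  have a0 : 4 * pi != 0 :> R by rewrite gt_eqF// pi4_gt0.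
  have -> : 4 * pi * q * (e / (4 * pi) / q) = e * ((4 * pi) / (4 * pi)) * (q / q) by ring.
  by rewrite !divff// !mulr1.
have cx0 : 0 < cabs x by rewrite cabs_gt0.
have -> : circle_integral r (fun u => (g u - g x) * (u - x)^-1) = circle_integral r (dquot g x).
  apply: eq_circle_integral (ltW r0) _ => u ur; rewrite /dquot.
  by case: eqVneq => [ux|//]; move: xr; rewrite -ux ur ltxx.
apply: cabs_small => e e0.
have [d d0 dP] := continuous_near_bound cg.
pose C := (cabs (g 0) + 1 + cabs (g x)) / (cabs x / 2).
have C0 : 0 < C by rewrite divr_gt0 ?divr_gt0// ltr_wpDr ?cabs_ge0// ltr_wpDl// cabs_ge0.
(* [g] is bounded on the circle of radius [q], whose points are at distance at
   least [|x| / 2] from [x], and the resulting bound [4 pi q C] is at most [e]. *)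
pose q := Num.min (Num.min r (d / 2)) (Num.min (cabs x / 2) (e / (4 * pi * C))).
have q0 : 0 < q by rewrite !lt_min r0 !divr_gt0// mulr_gt0// pi4_gt0.
have qr : q <= r by rewrite !ge_min lexx.
have qd : q < d.
  by rewrite (@le_lt_trans _ _ (d / 2))// ?ge_min ?lexx ?orbT// ltr_pdivrMr// ltr_pMr// ltr1n.
have qx : q <= cabs x / 2 by rewrite !ge_min lexx ?orbT.
have qe : q <= e / (4 * pi * C) by rewrite !ge_min lexx ?orbT.
have dq u : 0 < cabs u < eps -> u <> x -> derivable (dquot g x) u 1.
  by move=> /dg du /eqP ux; exact: dquot_derivable.
have cq : {for x, continuous (dquot g x)}.
  by apply/dquot_cont/dg; rewrite cx0 (lt_trans xr).
rewrite -(@circle_integral_deform _ (dquot g x) x 0 eps q r)//.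
apply: le_trans (circle_integral_bound (M := C) (ltW q0) _ _) _.
- apply: ccirc_der => u uq; apply: dq; first by rewrite uq q0 (le_lt_trans qr).
  by move=> ux; move: qx; rewrite -uq ux leNgt ltr_pdivrMr// ltr_pMr ?ltr1n.
- move=> u uq.
  have H : cabs x / 2 <= cabs (u - x).
    rewrite cabs_distC; apply: le_trans (lerBcabs _ _); rewrite uq.
    by move: qx; lra.
  rewrite /dquot; case: eqVneq => [ux|_].
    by move: H; rewrite ux subrr cabs0 leNgt divr_gt0.
  rewrite cabsM cabsV; apply: ler_pM; rewrite ?cabs_ge0 ?invr_ge0 ?cabs_ge0//.
    apply: le_trans (cabsD _ _) _; rewrite cabsN lerD2r.
    by apply: dP; rewrite subr0 uq.
  by rewrite lef_pV2// posrE ?divr_gt0// (lt_le_trans _ H)// divr_gt0.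
have := ler_wpM2l (ltW (mulr_gt0 pi4_gt0 C0)) qe.
rewrite [X in _ <= X]mulrCA divff ?mulr1; last by rewrite gt_eqF// mulr_gt0// pi4_gt0.
by rewrite mulrAC.
Qed.

End Cauchy.

Section JointContinuity.
Context {R : realType} {T : topologicalType}.
Implicit Types (x y z u : Cx R) (w : T) (r e : R).

Lemma near_comp (S U : topologicalType) (f : S -> U) (t : S) (P : set U) :
  {for t, continuous f} -> (\forall u \near f t, P u) -> \forall s \near t, P (f s).
Proof. by move=> cf; exact: cf. Qed.

Lemma near_cabs_lt (S : topologicalType) (f : S -> Cx R) (t : S) r :
  {for t, continuous f} -> cabs (f t) < r -> \forall s \near t, cabs (f s) < r.
Proof.
move=> cf fr.
have cc : {for t, continuous (fun s => cabs (f s))}.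
  by apply: (continuous_comp cf); exact: continuous_cabs.
have : \forall q \near cabs (f t), q < r by exact: lt_nbhsl.
by move/cc.
Qed.

Lemma cauchy_param (g : Cx R -> T -> Cx R) y0 w0 r : cabs y0 < r ->
  (forall u, cabs u = r -> {for (u, w0), continuous (fun p : Cx R * T => g p.1 p.2)}) ->
  (\forall w \near w0, ccirc r (g ^~ w)) ->
  {for (y0, w0), continuous (fun p : Cx R * T =>
     circle_integral r (fun u => g u p.2 * (u - p.1)^-1))}.
Proof.
move=> yr cg ng; have r0 : 0 < r := le_lt_trans (cabs_ge0 _) yr.
apply: (@circle_integral_param _ (Cx R * T)%type r
  (fun p u => g u p.2 * (u - p.1)^-1)); first exact: ltW.
- move=> u ur.
  have cp : {for ((y0, w0), u), continuous (fun q : (Cx R * T) * Cx R => q.1)}.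
    exact: cvg_fst.
  have cy : {for ((y0, w0), u), continuous (fun q : (Cx R * T) * Cx R => q.1.1)}.
    by apply: (continuous_comp cp); exact: cvg_fst.
  have cw : {for ((y0, w0), u), continuous (fun q : (Cx R * T) * Cx R => q.1.2)}.
    by apply: (continuous_comp cp); exact: cvg_snd.
  have cu : {for ((y0, w0), u), continuous (fun q : (Cx R * T) * Cx R => q.2)}.
    exact: cvg_snd.
  have c1 : {for ((y0, w0), u), continuous (fun q : (Cx R * T) * Cx R => g q.2 q.1.2)}.
    apply: (@continuous_comp _ _ _ (fun q : (Cx R * T) * Cx R => (q.2, q.1.2))
      (fun p : Cx R * T => g p.1 p.2)); last exact: cg.
    exact: (cvg_pair cu cw).
  have c2 := contB cu cy.
  apply: (contM c1 (contV _ c2)).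
  by apply: cabs_sub_gt0; rewrite ur.
- have ny : \forall p \near (y0, w0), cabs p.1 < r.
    have cy : {for (y0, w0), continuous (fun q : Cx R * T => q.1)} by exact: cvg_fst.
    exact: near_cabs_lt cy yr.
  have nw : \forall p \near (y0, w0), ccirc r (g ^~ p.2).
    have cw : {for (y0, w0), continuous (fun q : Cx R * T => q.2)} by exact: cvg_snd.
    exact: (near_comp (P := fun w => ccirc r (g ^~ w)) cw ng).
  apply: filterS2 ny nw => p py pw u ur; apply: (contM (pw u ur)).
  by apply: derivable_cont; apply: der_cauchy_kernel; rewrite ur.
Qed.

(** Cauchy's formula expresses the values inside the circle by those on the
    circle.  So joint continuity has to be known on the circle only, and inside
    it a function of [y] may have been extended over a removable singularity
    whose position depends on [w]. *)
Lemma joint_continuity (g : Cx R -> T -> Cx R) y0 w0 r eps :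
  cabs y0 < r -> r < eps ->
  (forall u, cabs u = r -> {for (u, w0), continuous (fun p : Cx R * T => g p.1 p.2)}) ->
  (\forall w \near w0, (forall y, 0 < cabs y < eps -> derivable (g ^~ w) y 1) /\
     {for 0, continuous (g ^~ w)}) ->
  {for (y0, w0), continuous (fun p : Cx R * T => g p.1 p.2)}.
Proof.
move=> yr reps cg ng; have r0 : 0 < r := le_lt_trans (cabs_ge0 _) yr.
have nc : \forall w \near w0, ccirc r (g ^~ w).
  apply: filterS ng => w [dg _]; apply: ccirc_der => u ur; apply: dg.
  by rewrite ur r0.
have H := contM (@cont_cst R _ (two_pi_i^-1) (y0, w0)) (cauchy_param yr cg nc).
apply: cont_near_eq H.
have ny : \forall p \near (y0, w0), cabs p.1 < r.
  have cy : {for (y0, w0), continuous (fun q : Cx R * T => q.1)} by exact: cvg_fst.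
  exact: near_cabs_lt cy yr.
have nw : \forall p \near (y0, w0), (forall y, 0 < cabs y < eps -> derivable (g ^~ p.2) y 1) /\
     {for 0, continuous (g ^~ p.2)}.
  have cw : {for (y0, w0), continuous (fun q : Cx R * T => q.2)} by exact: cvg_snd.
  exact: (near_comp (P := fun w => (forall y, 0 < cabs y < eps -> derivable (g ^~ w) y 1) /\
     {for 0, continuous (g ^~ w)}) cw ng).
apply: filterS2 ny nw => p py [dg cg0].
by rewrite (cauchy_formula dg cg0 reps py) mulrA mulVf ?mul1r// two_pi_i_neq0.
Qed.

End JointContinuity.

Section Consequences.
Context {R : realType}.
Implicit Types (F G f g a : Cx R -> Cx R) (x y z w u s : Cx R) (r e M rho : R).

Lemma der_recip u : u != 0 -> derivable (fun u : Cx R => u^-1) u 1.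
Proof. by move=> u0; apply: derV => //; exact: der_id. Qed.

(** The difference of Cauchy's formulas at [h] and at [0]. *)
Lemma cauchy_increment g eps r h :
  (forall y, 0 < cabs y < eps -> derivable g y 1) -> {for 0, continuous g} ->
  r < eps -> cabs h < r ->
  two_pi_i * (g h - g 0) = h * circle_integral r (fun u => g u * u^-1 * (u - h)^-1).
Proof.
move=> dg cg reps hr; have r0 : 0 < r := le_lt_trans (cabs_ge0 _) hr.
have r00 : cabs (0 : Cx R) < r by rewrite cabs0.
have dgr u : cabs u = r -> derivable g u 1 by move=> ur; apply: dg; rewrite ur r0.
have dk x u : cabs x < r -> cabs u = r -> derivable (fun u => g u * (u - x)^-1) u 1.
  by move=> xr ur; apply: (derM (dgr u ur)); apply: der_cauchy_kernel; rewrite ur.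
have d1 u : cabs u = r -> derivable (fun u => g u * u^-1 * (u - h)^-1) u 1.
  move=> ur; apply: derM; last by apply: der_cauchy_kernel; rewrite ur.
  by apply: (derM (dgr u ur)); apply: der_recip; rewrite -cabs_gt0 ur.
rewrite mulrBr -(cauchy_formula dg cg reps hr) -(cauchy_formula dg cg reps r00).
rewrite -(circle_integralZ h (ltW r0) (ccirc_der d1)).
rewrite -(circle_integralB (ltW r0) (ccirc_der (fun u => dk h u hr))
  (ccirc_der (fun u => dk 0 u r00))).
apply: eq_circle_integral (ltW r0) _ => u ur.
have u0 : u != 0 by rewrite -cabs_gt0 ur.
have uh : u - h != 0 by apply: cabs_sub_gt0; rewrite ur.
by rewrite subr0; field; rewrite u0 uh.
Qed.

(** In particular a function that is continuous at [0] and derivable around [0]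
    is derivable at [0]. *)
Lemma cauchy_derive0 g eps r :
  (forall y, 0 < cabs y < eps -> derivable g y 1) -> {for 0, continuous g} ->
  0 < r < eps ->
  cdiff g 0 (two_pi_i^-1 * circle_integral r (fun u => g u * u^-1 * u^-1)).
Proof.
move=> dg cg /andP[r0 reps].
have r00 : cabs (0 : Cx R) < r by rewrite cabs0.
pose G (u : Cx R) (_ : Cx R) := g u * u^-1.
have cG u : cabs u = r -> {for u, continuous (fun u => g u * u^-1)}.
  move=> ur; apply: derivable_cont; apply: derM; first by apply: dg; rewrite ur r0.
  by apply: der_recip; rewrite -cabs_gt0 ur.
have H : {for ((0 : Cx R), (0 : Cx R)), continuous (fun p : Cx R * Cx R =>
     circle_integral r (fun u => G u p.2 * (u - p.1)^-1))}.
  apply: (@cauchy_param _ _ G); first exact: r00.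
    move=> u ur; apply: (@continuous_comp _ _ _ fst (fun u => g u * u^-1)).
      exact: cvg_fst.
    exact: cG.
  by apply: filterS (near_cball (0 : Cx R) ltr01) => w _; exact: cG.
have H0 : {for (0 : Cx R), continuous (fun h : Cx R =>
     circle_integral r (fun u => g u * u^-1 * (u - h)^-1))}.
  apply: (@continuous_comp _ _ _ (fun h : Cx R => (h, (0 : Cx R)))
    (fun p : Cx R * Cx R => circle_integral r (fun u => G u p.2 * (u - p.1)^-1))) => //.
  exact: (cvg_pair cvg_id (@cont_cst R _ (0 : Cx R) _)).
move=> e e0.
have [d d0 dP] := (continuouscP _ 0).1 H0 (e * (2 * pi))
  (mulr_gt0 e0 (mulr_gt0 (ltr0n _ 2) (pi_gt0 _))).
exists (Num.min d r); first by rewrite lt_min d0.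
move=> w; rewrite subr0 lt_min => /andP[wd wr].
have := dP w; rewrite subr0 => /(_ wd).
have -> : (fun u => g u * u^-1 * (u - 0)^-1) = (fun u => g u * u^-1 * u^-1).
  by apply/funext => u; rewrite subr0.
set A := circle_integral r _; set B := circle_integral r _ => AB.
have E := cauchy_increment dg cg reps wr; rewrite -/A in E.
have -> : g w - g 0 - two_pi_i^-1 * B * w = two_pi_i^-1 * (A - B) * w.
  rewrite -[g w - g 0](mulKf two_pi_i_neq0) E.
  by ring.
rewrite !cabsM cabsV cabs_two_pi_i ler_wpM2r ?cabs_ge0//.
by rewrite ler_pdivrMl ?mulr_gt0 ?pi_gt0// mulrC ltW.
Qed.

Lemma cauchy_lipschitz f M x :
  (forall y, cabs y < 1 -> derivable f y 1) ->
  (forall y, cabs y <= 2^-1 -> cabs (f y) <= M) -> cabs x <= 4^-1 ->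
  cabs (f x - f 0) <= 8 * M * cabs x.
Proof.
move=> df fM x4.
have h2 : 0 < 2^-1 :> R by rewrite invr_gt0.
have x2 : cabs x < 2^-1 by lra.
have df' y : 0 < cabs y < 1 -> derivable f y 1 by move=> /andP[_ /df].
have cf : {for 0, continuous f} by apply/derivable_cont/df; rewrite cabs0.
have h1 : 2^-1 < 1 :> R by lra.
have M0 : 0 <= M by apply: le_trans (cabs_ge0 (f 0)) (fM 0 _); rewrite cabs0 ltW.
have E := cauchy_increment df' cf h1 x2.
have := congr1 (fun z => cabs z) E; rewrite !cabsM cabs_two_pi_i => EE.
have B : cabs (circle_integral 2^-1 (fun u => f u * u^-1 * (u - x)^-1)) <=
    4 * pi * 2^-1 * (M * 2 * 4).
  apply: circle_integral_bound (ltW h2) _ _.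
    apply: ccirc_der => u ur; apply: derM; last by apply: der_cauchy_kernel; rewrite ur.
    apply: derM; first by apply: df; rewrite ur.
    by apply: der_recip; rewrite -cabs_gt0 ur.
  move=> u ur; rewrite !cabsM !cabsV ur invrK.
  apply: ler_pM; rewrite ?mulr_ge0 ?invr_ge0 ?cabs_ge0//.
    by rewrite ler_wpM2r// fM// ur.
  rewrite -[leRHS]invrK lef_pV2 ?posrE ?invr_gt0//.
    by apply: le_trans (lerBcabs _ _); rewrite ur; lra.
  by apply: lt_le_trans (lerBcabs _ _); rewrite ur; lra.
have p0 := pi_gt0 R.
rewrite -(@ler_pM2l _ (2 * pi)) ?mulr_gt0// EE.
apply: le_trans (ler_wpM2l (cabs_ge0 x) B) _.
by rewrite le_eqVlt; apply/orP; left; apply/eqP; field.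
Qed.

(** Differentiation under the integral sign: the difference quotients
    [(g (x0 + h) w - g x0 w) / h] are holomorphic in [h], with a removable
    singularity at [0], hence jointly continuous in [(h, w)] at [h = 0] by
    [joint_continuity]. *)
Lemma derivable_circle_integral (g : Cx R -> Cx R -> Cx R) c rho x0 :
  cabs x0 < 1 -> 0 <= rho < 1 ->
  (forall x w, cabs x < 1 -> cabs w < 1 -> derivable (g ^~ w) x 1) ->
  (forall x w, cabs x < 1 -> cabs w < 1 ->
     {for (x, w), continuous (fun p : Cx R * Cx R => g p.1 p.2)}) ->
  ccirc rho c ->
  derivable (fun x => circle_integral rho (fun w => g x w * c w)) x0 1.
Proof.
move=> x01 /andP[rho0 rho1] dg cg cc.
pose eps := 1 - cabs x0; pose r := eps / 2.
have eps0 : 0 < eps by rewrite subr_gt0.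
have r0 : 0 < r by rewrite divr_gt0.
have reps : r < eps by rewrite ltr_pdivrMr// ltr_pMr// ltr1n.
have sh h : cabs h < eps -> cabs (x0 + h) < 1.
  by move=> he; apply: le_lt_trans (cabsD _ _) _; rewrite -ltrBrDl.
have csh h : {for h, continuous (fun h : Cx R => x0 + h)}.
  exact: (contD (@cont_cst R _ x0 h) cvg_id).
have dsh h : derivable (fun h : Cx R => x0 + h) h 1.
  by apply: derD; [exact: der_cst|exact: der_id].
have sh0 h : h != 0 -> x0 + h != x0.
  by apply: contra => /eqP H; rewrite -[h](addKr x0) H addNr.
pose Q (h w : Cx R) := dquot (g ^~ w) x0 (x0 + h).
have Qj w0 : cabs w0 < 1 ->
    {for ((0 : Cx R), w0), continuous (fun p : Cx R * Cx R => Q p.1 p.2)}.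
  move=> w01; apply: (@joint_continuity _ _ _ _ _ r eps) => //; first by rewrite cabs0.
    move=> u ur.
    have u0 : u != 0 by rewrite -cabs_gt0 ur.
    have cu : {for (u, w0), continuous (fun p : Cx R * Cx R => p.1)} by exact: cvg_fst.
    have cw : {for (u, w0), continuous (fun p : Cx R * Cx R => p.2)} by exact: cvg_snd.
    have cx := contD (@cont_cst R _ x0 (u, w0)) cu.
    have c1 : {for (u, w0), continuous (fun p : Cx R * Cx R => g (x0 + p.1) p.2)}.
      apply: (@continuous_comp _ _ _ (fun p : Cx R * Cx R => (x0 + p.1, p.2))
        (fun p : Cx R * Cx R => g p.1 p.2)); first exact: (cvg_pair cx cw).
      by apply: cg => //; apply: sh; rewrite ur.
    have c2 : {for (u, w0), continuous (fun p : Cx R * Cx R => g x0 p.2)}.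
      apply: (@continuous_comp _ _ _ (fun p : Cx R * Cx R => (x0, p.2))
        (fun p : Cx R * Cx R => g p.1 p.2)); last exact: cg.
      exact: (cvg_pair (@cont_cst R _ x0 (u, w0)) cw).
    have c3 := contM (contB c1 c2) (contV u0 cu).
    apply: cont_near_eq c3.
    have nu : \forall p \near (u, w0), p.1 != 0.
      exact: (near_comp (P := fun h => h != 0) cu (near_neq u0)).
    apply: filterS nu => -[h w] /= h0; rewrite /Q /dquot (negbTE (sh0 _ h0)).
    by congr (_ / _); ring.
  have : \forall w \near w0, cabs w < 1 by exact: (near_cabs_lt (f := id) cvg_id).
  apply: filterS => w w1; split.
    move=> h /andP[h0 he]; apply: (der_comp (dsh h)).
    apply: dquot_derivable; first by apply: sh0; rewrite -cabs_gt0.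
    by apply: dg => //; exact: sh.
  apply: continuous_comp; first exact: csh.
  by rewrite /= addr0; apply: dquot_cont; exact: dg.
pose F (h : Cx R) := circle_integral rho (fun w => Q h w * c w).
have Qc h w : cabs h < eps -> cabs w < 1 -> {for w, continuous (Q h)}.
  move=> he w1; have [->|h0] := eqVneq h 0.
    apply: (@continuous_comp _ _ _ (fun w : Cx R => ((0 : Cx R), w))
        (fun p : Cx R * Cx R => Q p.1 p.2)); last exact: Qj.
    exact: (cvg_pair (@cont_cst R _ (0 : Cx R) w) cvg_id).
  have cgx x : cabs x < 1 -> {for w, continuous (g x)}.
    move=> x1; apply: (@continuous_comp _ _ _ (fun w : Cx R => (x, w))
        (fun p : Cx R * Cx R => g p.1 p.2)); last exact: cg.
    exact: (cvg_pair (@cont_cst R _ x w) cvg_id).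
  have := contM (contB (cgx _ (sh h he)) (cgx _ x01)) (@cont_cst R _ (x0 + h - x0)^-1 w).
  by rewrite /Q /dquot (negbTE (sh0 _ h0)).
have cF : {for 0, continuous F}.
  apply: (@circle_integral_param _ _ rho (fun h w => Q h w * c w)); first exact: rho0.
    move=> w wr.
    have cw : {for ((0 : Cx R), w), continuous (fun p : Cx R * Cx R => p.2)}.
      exact: cvg_snd.
    apply: (contM (Qj w _)); first by rewrite wr.
    by apply: (continuous_comp cw); exact: cc.
  have : \forall h \near (0 : Cx R), cabs (h - 0) < eps by exact: near_cball.
  apply: filterS => h; rewrite subr0 => he w wr.
  by apply: contM; [apply: Qc => //; rewrite wr|exact: cc].
apply: (@cdiff_derivable _ _ _ (F 0)) => e e0.
have [d d0 dP] := (continuouscP _ 0).1 cF e e0.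
exists (Num.min d eps); first by rewrite lt_min d0.
move=> x; rewrite lt_min => /andP[xd xe].
have cgx y : cabs y < 1 -> ccirc rho (fun w => g y w * c w).
  move=> y1 w wr; apply: contM; last exact: cc.
  apply: (@continuous_comp _ _ _ (fun w : Cx R => (y, w))
        (fun p : Cx R * Cx R => g p.1 p.2)); last by apply: cg; rewrite ?wr.
  exact: (cvg_pair (@cont_cst R _ y w) cvg_id).
have x1 : cabs x < 1 by rewrite -(subrK x0 x) addrC sh.
have cQ h : cabs h < eps -> ccirc rho (fun w => Q h w * c w).
  by move=> he w wr; apply: contM; [apply: Qc => //; rewrite wr|exact: cc].
have [->|xx0] := eqVneq x x0; first by rewrite !subrr mulr0 subrr cabs0 mulr0.
rewrite -(circle_integralB rho0 (cgx x x1) (cgx x0 x01)).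
have -> : circle_integral rho (fun w => g x w * c w - g x0 w * c w) = (x - x0) * F (x - x0).
  rewrite /F -(circle_integralZ (x - x0) rho0 (cQ _ xe)).
  apply: eq_circle_integral rho0 _ => w _; rewrite /Q /dquot.
  have -> : x0 + (x - x0) = x by ring.
  rewrite (negbTE xx0); have xx : x - x0 != 0 by rewrite subr_eq0.
  by field.
have -> : (x - x0) * F (x - x0) - F 0 * (x - x0) = (F (x - x0) - F 0) * (x - x0) by ring.
rewrite cabsM; apply: ler_wpM2r; first exact: cabs_ge0.
by apply/ltW/dP; rewrite subr0.
Qed.

End Consequences.

(** * Integrals over the seams *)
Section Seam.
Context {R : realType}.
Implicit Types (f g a : Cx R -> Cx R) (x y z w u s : Cx R) (r e M A rho : R).

(** The coefficient of the pullback of [f(u) du] by [u = s / w]. *)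
Definition seam_pullback s f w : Cx R := f (s / w) * (- s / w ^+ 2).

Lemma lt_seam_radius s : s != 0 -> cabs s < 1 -> cabs s < Num.sqrt (cabs s).
Proof.
move=> s0 s1; have cs0 : 0 < cabs s by rewrite cabs_gt0.
rewrite -[ltLHS]sqr_sqrtr ?cabs_ge0// expr2 gtr_pMr ?sqrtr_gt0//.
by rewrite -[ltRHS]sqrtr1 ltr_sqrt.
Qed.

Lemma cabs_div s w : cabs (s / w) = cabs s / cabs w.
Proof. by rewrite cabsM cabsV. Qed.

Lemma der_seam_pullback s f w :
  (forall u, cabs u < 1 -> derivable f u 1) -> cabs s < cabs w ->
  derivable (seam_pullback s f) w 1.
Proof.
move=> df sw.
have w0 : 0 < cabs w by exact: le_lt_trans (cabs_ge0 _) sw.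
have wn : w != 0 by rewrite -cabs_gt0.
have dw : derivable (fun w : Cx R => w^-1) w 1 := der_recip wn.
have dsw : derivable (fun w : Cx R => s / w) w 1 := derM (@der_cst R s w) dw.
apply: derM.
  apply: (der_comp dsw); apply: df.
  by rewrite cabs_div ltr_pdivrMr// mul1r.
apply: derM; first exact: der_cst.
apply: (@derV R (fun w : Cx R => w ^+ 2)); first by rewrite expf_neq0.
have := derM (@der_id R w) (@der_id R w).
by rewrite (_ : (fun y : Cx R => y * y) = (fun y : Cx R => y ^+ 2))//;
  apply/funext => y; rewrite expr2.
Qed.

(** The pullback is [O(w^-2)] at infinity: its integral over the circle of radius
    [Q], which does not depend on [Q], is [O(1 / Q)]. *)
Lemma seam_pullback_integral0 s f rho :
  (forall u, cabs u < 1 -> derivable f u 1) -> cabs s < rho ->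
  circle_integral rho (seam_pullback s f) = 0.
Proof.
move=> df srho; have rho0 : 0 < rho := le_lt_trans (cabs_ge0 _) srho.
have cf : {for 0, continuous f} by apply/derivable_cont/df; rewrite cabs0.
have [d d0 dP] := continuous_near_bound cf.
set C := cabs (f 0) + 1 in dP.
have C0 : 0 < C by rewrite ltr_wpDl ?cabs_ge0.
apply: cabs_small => e e0.
(* On the circle of radius [Q], [|s / w| < d], and [4 pi C |s| / Q <= e]. *)
pose Q := rho + (cabs s + 1) / d + 4 * pi * C * cabs s / e.
have p0 : 0 <= 4 * pi * C * cabs s / e.
  by rewrite divr_ge0 ?(ltW e0)// mulr_ge0 ?cabs_ge0// mulr_ge0 ?(ltW C0)// ltW// pi4_gt0.
have s1 : 0 < cabs s + 1 by rewrite ltr_wpDl ?cabs_ge0.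
have q0 : 0 < (cabs s + 1) / d by rewrite divr_gt0.
have rQ : rho <= Q by rewrite /Q; lra.
have Q1 : (cabs s + 1) / d <= Q by rewrite /Q; lra.
have Q2 : 4 * pi * C * cabs s / e <= Q by rewrite /Q; lra.
have Q0 : 0 < Q by exact: lt_le_trans rQ.
have dF u : rho <= cabs u <= Q -> derivable (seam_pullback s f) u 1.
  by move=> /andP[ru _]; apply: der_seam_pullback => //; exact: lt_le_trans ru.
rewrite (circle_integral_const (ltW rho0) rQ dF).
apply: le_trans (circle_integral_bound (M := C * (cabs s / Q ^+ 2)) (ltW Q0) _ _) _.
- by apply: ccirc_der => u uQ; apply: dF; rewrite uQ rQ lexx.
- move=> w wQ; rewrite cabsM cabs_div cabsN cabsX wQ ler_wpM2r//.
    by rewrite divr_ge0 ?cabs_ge0// exprn_ge0// ltW.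
  apply: dP; rewrite subr0 cabs_div wQ ltr_pdivrMr// mulrC -ltr_pdivrMr//.
  apply: lt_le_trans Q1; rewrite ltr_pM2r ?invr_gt0//.
  by rewrite ltrDl.
have Qn : Q != 0 by rewrite gt_eqF.
have -> : 4 * pi * Q * (C * (cabs s / Q ^+ 2)) = (4 * pi * C * cabs s) / Q.
  by move: (cabs s) => k; field.
by rewrite ler_pdivrMr//; move: Q2; rewrite ler_pdivrMr// (mulrC e).
Qed.

(** For [|w|] above the radius of the seam, [|s / w|] is below it, so that the
    pullback is holomorphic between the seam and the fixed circle.  For [s = 0]
    both integrals vanish. *)
Lemma seam_deform s a f x rho b :
  (forall u, cabs u < 1 -> derivable f u 1) ->
  (forall w, 0 < cabs w < b -> w <> x -> derivable a w 1) ->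
  (cabs x < b -> {for x, continuous a}) ->
  cabs s < 1 -> Num.sqrt (cabs s) <= rho -> rho < b ->
  circle_integral (Num.sqrt (cabs s)) (fun w => a w * seam_pullback s f w) =
  circle_integral rho (fun w => a w * seam_pullback s f w).
Proof.
move=> df da ca s1 srho rhob.
have [->|s0] := eqVneq s 0.
  have -> : (fun w => a w * seam_pullback 0 f w) = (fun=> 0 : Cx R).
    by apply/funext => w; rewrite /seam_pullback oppr0 !mul0r !mulr0.
  rewrite /circle_integral.
  by transitivity (cintegral 0 (2 * pi) (fun=> 0 : Cx R));
    [|apply/esym]; apply: eq_cintegral => t _; rewrite mul0r.
have cs0 : 0 < cabs s by rewrite cabs_gt0.
have st := lt_seam_radius s0 s1.
apply: (@circle_integral_deform _ _ x (cabs s) b) => //.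
- exact: cabs_ge0.
- move=> u /andP[su ub] ux; apply: derM; last exact: der_seam_pullback.
  by apply: da => //; rewrite ub (lt_trans cs0).
- move=> /andP[sx xb]; apply: contM; first exact: ca.
  by apply: derivable_cont; exact: der_seam_pullback.
Qed.

Lemma ccirc_seam s a f rho :
  (forall u, cabs u < 1 -> derivable f u 1) -> ccirc rho a -> cabs s < rho ->
  ccirc rho (fun w => a w * seam_pullback s f w).
Proof.
move=> df ca srho w wr; apply: contM; first exact: ca.
by apply: derivable_cont; apply: der_seam_pullback => //; rewrite wr.
Qed.

Lemma seam_bound s a f rho A M :
  (forall u, cabs u < 1 -> derivable f u 1) -> ccirc rho a -> 0 < rho ->
  (forall w, cabs w = rho -> cabs (a w) <= A) ->
  (forall u, cabs u <= 2^-1 -> cabs (f u) <= M) -> cabs s / rho <= 4^-1 ->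
  cabs (circle_integral rho (fun w => a w * seam_pullback s f w)) <=
  4 * pi * A * M / rho * cabs s.
Proof.
move=> df ca rho0 aA fM srho.
have sr : cabs s < rho.
  by move: srho; rewrite ler_pdivrMr//; lra.
apply: le_trans (circle_integral_bound
  (M := A * (M * (cabs s / rho ^+ 2))) (ltW rho0) _ _) _.
- exact: ccirc_seam.
- move=> w wr; rewrite !cabsM cabsV cabsN cabsX wr.
  have k0 : 0 <= cabs s / rho ^+ 2 by rewrite divr_ge0 ?cabs_ge0// exprn_ge0// ltW.
  apply: (ler_pM (cabs_ge0 _) (mulr_ge0 (cabs_ge0 _) k0) (aA w wr)).
  apply: (ler_wpM2r k0).
  by apply: fM; rewrite cabs_div wr; lra.
have rn : rho != 0 by rewrite gt_eqF.
by rewrite le_eqVlt; apply/orP; left; apply/eqP; field.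
Qed.

(** Together the two integrands are [a(w) (f(s / w) - f 0) (-s / w^2)], with
    [f(s / w) - f 0 = O(s)] by [cauchy_lipschitz]. *)
Lemma seam_leading s a f rho A M :
  (forall u, cabs u < 1 -> derivable f u 1) -> ccirc rho a -> 0 < rho ->
  (forall w, cabs w = rho -> cabs (a w) <= A) ->
  (forall u, cabs u <= 2^-1 -> cabs (f u) <= M) -> cabs s / rho <= 4^-1 ->
  cabs (circle_integral rho (fun w => a w * seam_pullback s f w) +
     s * f 0 * circle_integral rho (fun w => a w * w^-1 * w^-1)) <=
  32 * pi * A * M / rho ^+ 2 * cabs s ^+ 2.
Proof.
move=> df ca rho0 aA fM srho.
have sr : cabs s < rho by move: srho; rewrite ler_pdivrMr//; lra.
have ci w : cabs w = rho -> {for w, continuous (fun w : Cx R => w^-1)}.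
  move=> wr; have wn : w != 0 by rewrite -cabs_gt0 wr.
  exact: (derivable_cont (der_recip wn)).
have c2 : ccirc rho (fun w => a w * w^-1 * w^-1).
  by move=> w wr; exact: (contM (contM (ca w wr) (ci w wr)) (ci w wr)).
have c1 := ccirc_seam df ca sr.
have c3 : ccirc rho (fun w => s * f 0 * (a w * w^-1 * w^-1)).
  by move=> w wr; exact: (contM (@cont_cst R _ (s * f 0) w) (c2 w wr)).
rewrite -(circle_integralZ _ (ltW rho0) c2) -(circle_integralD (ltW rho0) c1 c3).
apply: le_trans (circle_integral_bound
  (M := A * (8 * M * (cabs s / rho) * (cabs s / rho ^+ 2))) (ltW rho0) _ _) _.
- by move=> w wr; exact: (contD (c1 w wr) (c3 w wr)).
- move=> w wr; have w0 : w != 0 by rewrite -cabs_gt0 wr.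
  have -> : a w * seam_pullback s f w + s * f 0 * (a w * w^-1 * w^-1) =
      a w * ((f (s / w) - f 0) * (- s / w ^+ 2)).
    by rewrite /seam_pullback; field.
  rewrite !cabsM cabsV cabsN cabsX wr.
  have k0 : 0 <= cabs s / rho ^+ 2 by rewrite divr_ge0 ?cabs_ge0// exprn_ge0// ltW.
  apply: (ler_pM (cabs_ge0 _) (mulr_ge0 (cabs_ge0 _) k0) (aA w wr)).
  apply: (ler_wpM2r k0).
  have := @cauchy_lipschitz _ f M (s / w) df fM.
  by rewrite cabs_div wr; exact.
have rn : rho != 0 by rewrite gt_eqF.
by rewrite le_eqVlt; apply/orP; left; apply/eqP; field.
Qed.

End Seam.

(** * Compactness of discs and circles *)
Section Compactness.
Context {R : realType}.

Lemma compact_square (r : R) :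
  compact [set z : Cx R | `|complex.Re z| <= r /\ `|complex.Im z| <= r].
Proof.
pose f (p : R * R) : Cx R := Complex p.1 p.2.
have -> : [set z : Cx R | `|complex.Re z| <= r /\ `|complex.Im z| <= r] =
    f @` (`[- r, r] `*` `[- r, r]).
  apply/seteqP; split=> [z [/= h1 h2]|z [[a b] /= [h1 h2] <-]] /=.
    exists (complex.Re z, complex.Im z); last by case: z {h1 h2}.
    by split => /=; rewrite in_itv /= -ler_norml.
  by move: h1 h2; rewrite !in_itv /= -!ler_norml.
apply: continuous_compact; last by apply: compact_setX; exact: segment_compact.
apply: continuous_subspaceT => p.
have c1 : {for p, continuous (fun p : R * R => p.1)} by exact: cvg_fst.
have c2 : {for p, continuous (fun p : R * R => p.2)} by exact: cvg_snd.
exact: (@cvg_Complex R _ (nbhs p) _ _ _ _ _ c1 c2).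
Qed.

Lemma compact_cdisc (x : Cx R) (r : R) : compact [set z : Cx R | cabs (z - x) <= r].
Proof.
have cx : continuous (fun z : Cx R => cabs (z - x)).
  move=> z; apply: (@continuous_comp _ _ _ (fun z : Cx R => z - x) (fun z => cabs z)).
    exact: (contB cvg_id (@cont_cst R _ x z)).
  exact: continuous_cabs.
apply: (@subclosed_compact _ _ ((fun z => x + z) @`
    [set z : Cx R | `|complex.Re z| <= r /\ `|complex.Im z| <= r])).
- apply: (@preimage_closed _ _ (fun z : Cx R => cabs (z - x)) [set t | t <= r]).
    by move=> z _; exact: cx.
  exact: closed_le.
- apply: continuous_compact; last exact: compact_square.
  apply: continuous_subspaceT => z.
  exact: (contD (@cont_cst R _ x z) cvg_id).
- move=> z /= zr; exists (z - x); last by rewrite addrC subrK.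
  split; [exact: le_trans (Re_le_cabs _) zr|exact: le_trans (Im_le_cabs _) zr].
Qed.

Lemma compact_circle (r : R) : compact [set z : Cx R | cabs z = r].
Proof.
apply: (@subclosed_compact _ _ [set z : Cx R | cabs (z - 0) <= r]).
- apply: (@preimage_closed _ _ (fun z : Cx R => cabs z) [set t | t = r]).
    by move=> z _; exact: continuous_cabs.
  exact: closed_eq.
- exact: compact_cdisc.
- by move=> z /= <-; rewrite subr0.
Qed.

Lemma compact_bound (T : topologicalType) (A : set T) (f : T -> Cx R) :
  compact A -> (forall x, A x -> {for x, continuous f}) ->
  exists M : R, forall x, A x -> cabs (f x) <= M.
Proof.
move=> /compact_near_coveringP cA cf.
have : \forall M \near +oo, A `<=` (fun x => cabs (f x) <= M).
  apply: (cA R (pinfty_nbhs R) (fun M x => cabs (f x) <= M)) => x Ax.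
  have h : cabs (f x) < cabs (f x) + 1 by rewrite ltrDl.
  have fx : {for x, continuous (fun x => cabs (f x))}.
    by apply: (continuous_comp (cf x Ax)); exact: continuous_cabs.
  have h1 : \forall y \near x, cabs (f y) < cabs (f x) + 1.
    by apply: (near_comp (P := fun t => t < cabs (f x) + 1) fx); exact: lt_nbhsl.
  have h2 : \forall M \near +oo, cabs (f x) + 1 <= M.
    by apply: nbhs_pinfty_ge; exact: num_real.
  exists ((fun y : T => cabs (f y) < cabs (f x) + 1 : Prop),
    (fun M : R => cabs (f x) + 1 <= M : Prop)) => //.
  by move=> [y M] /= [h3 h4]; apply: le_trans h4; exact: ltW.
move=> [M [_ HM]]; exists (M + 1) => x Ax; apply: (HM (M + 1)) => //.
by rewrite ltrDl.
Qed.

End Compactness.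

(** * Removing isolated singularities *)
Section Regularize.
Context {R : realType}.
Implicit Types (f h : Cx R -> Cx R) (x y w l : Cx R).

Lemma regularize_cvg f x l : f @ x^' --> l -> regularize f x = l.
Proof. by move=> fl; apply: cvg_lim fl; exact: norm_hausdorff. Qed.

Lemma regularize_eq f h x : {for x, continuous h} ->
  (\forall y \near x^', f y = h y) -> regularize f x = h x.
Proof.
move=> ch fh; apply: regularize_cvg.
have : h @ x^' --> h x by apply: cvg_trans ch; apply: cvg_app; exact: cvg_within.
apply: cvg_trans; apply: near_eq_cvg.
by apply: filterS fh.
Qed.

Lemma regularize_near f h x : (\forall y \near x, derivable h y 1) ->
  (\forall y \near x^', f y = h y) -> \forall y \near x, regularize f y = h y.
Proof.
move=> /nbhscP[e e0 dh] /dnbhscP[d d0 fh].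
apply/nbhscP; exists (Num.min e d); first by rewrite lt_min e0.
move=> y; rewrite lt_min => /andP[ye yd]; apply: regularize_eq.
  by apply: derivable_cont; exact: dh.
have [->|yx] := eqVneq y x; first by apply/dnbhscP; exists d.
apply/dnbhscP; exists (Num.min (cabs (y - x)) (d - cabs (y - x))).
  by rewrite lt_min subr_gt0 yd cabs_gt0 subr_eq0 yx.
move=> w _; rewrite lt_min => /andP[w1 w2]; apply: fh.
  by apply: contraTN w1 => /eqP ->; rewrite cabs_distC ltxx.
have -> : w - x = (w - y) + (y - x) by ring.
by apply: le_lt_trans (cabsD _ _) _; lra.
Qed.

Lemma regularize_derivable f h x : (\forall y \near x, derivable h y 1) ->
  (\forall y \near x^', f y = h y) -> derivable (regularize f) x 1.
Proof.
move=> dh fh; have dhx : derivable h x 1 by exact: nbhs_singleton dh.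
have rh := regularize_near dh fh.
apply: (@near_eq_derivable _ _ _ h) => //.
by apply: filterS rh => y ->.
Qed.

Lemma near_disc (x : Cx R) (r : R) : cabs x < r -> \forall y \near x, cabs y < r.
Proof. by move=> xr; exact: (near_cabs_lt (f := id) cvg_id). Qed.

End Regularize.

(** * The regular part of a kernel along the diagonal *)

(** [d] tells whether the two variables run in the same disc, in which case the
    kernel has a simple pole along the diagonal. *)
Section RegularPart.
Context {R : realType}.
Variables (k : Cx R -> Cx R -> Cx R) (d : bool).
Implicit Types (x y w : Cx R).

Hypothesis kholo : forall y w, cabs y < 1 -> cabs w < 1 -> (d -> y <> w) ->
  [/\ {for (y, w), continuous (fun p : Cx R * Cx R => k p.1 p.2)},
      derivable (k ^~ w) y 1 & derivable (k y) w 1].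
Hypothesis kpole : d -> forall w, cabs w < 1 -> exists h : Cx R -> Cx R,
  (\forall y \near w, derivable h y 1) /\
  (\forall y \near w^', k y w = two_pi_i^-1 / (y - w) + h y).

Let sing y w : Cx R := if d then (two_pi_i * (y - w))^-1 else 0.
Let f w y := k y w - sing y w.
Let reg x w := regularize (f w) x.

Let der_sing_l y w : (d -> y <> w) -> derivable (sing ^~ w) y 1.
Proof.
rewrite /sing; case: d => [/(_ isT) yw|_]; last exact: der_cst.
apply: derV.
  by rewrite mulf_neq0 ?two_pi_i_neq0// subr_eq0; apply/eqP.
by apply: derM; [exact: der_cst|exact: derBx].
Qed.

Let der_sing_r y w : (d -> y <> w) -> derivable (sing y) w 1.
Proof.
rewrite /sing; case: d => [/(_ isT) yw|_]; last exact: der_cst.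
apply: (@derV R (fun w => two_pi_i * (y - w))).
  by rewrite mulf_neq0 ?two_pi_i_neq0// subr_eq0; apply/eqP.
by apply: derM; [exact: der_cst|apply: derB; [exact: der_cst|exact: der_id]].
Qed.

Let cont_sing y w : (d -> y <> w) ->
  {for (y, w), continuous (fun p : Cx R * Cx R => sing p.1 p.2)}.
Proof.
rewrite /sing; case: d => [/(_ isT) yw|_]; last exact: cont_cst.
have c1 : {for (y, w), continuous (fun p : Cx R * Cx R => p.1)} by exact: cvg_fst.
have c2 : {for (y, w), continuous (fun p : Cx R * Cx R => p.2)} by exact: cvg_snd.
have c3 := contM (@cont_cst R _ two_pi_i (y, w)) (contB c1 c2).
apply: (contV _ c3).
by rewrite mulf_neq0 ?two_pi_i_neq0// subr_eq0; apply/eqP.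
Qed.

Let near_off y w : (d -> y <> w) -> \forall x \near y, d -> x <> w.
Proof.
case: d => [/(_ isT)/eqP yw|_]; last by apply: filterS (near_cball y ltr01).
by apply: filterS (near_neq yw) => x /eqP.
Qed.

Lemma reg_part_der_l x w : cabs x < 1 -> cabs w < 1 -> derivable (reg ^~ w) x 1.
Proof.
move=> x1 w1.
have [/andP[dd /eqP ->]|dxw] := boolP (d && (x == w)).
  have [h [dh kh]] := kpole dd w1.
  apply: (regularize_derivable dh).
  by apply: filterS kh => y; rewrite /f /sing dd invfM => ->; ring.
have off : d -> x <> w by move=> dd xw; move: dxw; rewrite dd xw eqxx.
apply: (@regularize_derivable _ _ (f w)).
  apply: filterS2 (near_disc x1) (near_off off) => y y1 yo.
  have [_ dk _] := kholo y1 w1 yo; exact: (derB dk (der_sing_l yo)).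
by apply/dnbhscP; exists 1.
Qed.

Lemma reg_part_off x w : cabs x < 1 -> cabs w < 1 -> (d -> x <> w) ->
  reg x w = k x w - sing x w.
Proof.
move=> x1 w1 off; rewrite -/(f w x).
have H := @regularize_eq R (f w) (f w) x.
apply: H; last by apply/dnbhscP; exists 1.
apply: derivable_cont.
have [_ dk _] := kholo x1 w1 off; exact: (derB dk (der_sing_l off)).
Qed.

(** A circle [|u| = r] with [r > |w|] avoids the diagonal, and
    [joint_continuity] propagates from this circle to its interior. *)
Lemma reg_part_joint x w : cabs x < 1 -> cabs w < 1 ->
  {for (x, w), continuous (fun p : Cx R * Cx R => reg p.1 p.2)}.
Proof.
move=> x1 w1; pose m := Num.max (cabs x) (cabs w).
have m1 : m < 1 by rewrite gt_max x1.
pose r := (m + 1) / 2.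
have mr : m < r by rewrite /r; lra.
have r1 : r < 1 by rewrite /r; lra.
have xm : cabs x <= m by rewrite le_max lexx.
have wm : cabs w <= m by rewrite le_max lexx orbT.
apply: (@joint_continuity _ _ reg x w r 1).
- exact: le_lt_trans mr.
- exact: r1.
- move=> u ur.
  have u1 : cabs u < 1 by rewrite ur.
  have uw : u != w.
    apply/eqP => uw; have : r <= m by rewrite -ur uw.
    by rewrite leNgt mr.
  have off : d -> u <> w by move=> _; apply/eqP.
  have [ck _ _] := kholo u1 w1 off.
  have := contB ck (cont_sing off); apply: cont_near_eq.
  have c1 : {for (u, w), continuous (fun p : Cx R * Cx R => p.1)} by exact: cvg_fst.
  have c2 : {for (u, w), continuous (fun p : Cx R * Cx R => p.2)} by exact: cvg_snd.
  have n1 := near_cabs_lt c1 u1.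
  have n2 := near_cabs_lt c2 w1.
  have n3 : \forall p \near (u, w), p.1 - p.2 != 0.
    apply: (near_comp (P := fun z => z != 0) (contB c1 c2)); apply: near_neq.
    by rewrite subr_eq0.
  near=> p; rewrite reg_part_off//; [by near: p|by near: p|].
  move=> _ /eqP; rewrite -subr_eq0; apply/negP; by near: p.
- apply: filterS (near_disc w1) => w' w'1; split.
    by move=> y /andP[_ y1]; exact: reg_part_der_l.
  by apply: derivable_cont; apply: reg_part_der_l => //; rewrite cabs0.
Unshelve. all: by end_near. Qed.

Lemma reg_part_der_r x w : cabs x < 1 -> cabs w < 1 -> w <> x -> derivable (reg x) w 1.
Proof.
move=> x1 w1 wx.
have off : d -> x <> w by move=> _ /esym.
apply: (@near_eq_derivable _ _ _ (fun w => k x w - sing x w)).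
  have n1 : \forall w' \near w, w' != x by apply: near_neq; apply/eqP.
  apply: filterS2 (near_disc w1) n1 => w' w'1 /eqP w'x.
  by rewrite reg_part_off// => _ /esym.
have [_ _ dk] := kholo x1 w1 off; exact: (derB dk (der_sing_r off)).
Qed.

End RegularPart.

(** * Finite families *)
Section FiniteBounds.
Context {R : realType}.

Lemma finite_bound (I : finType) (P : I -> R -> Prop) :
  (forall i, exists M, P i M) ->
  (forall i M M', P i M -> M <= M' -> P i M') ->
  exists2 M, 0 <= M & forall i, P i M.
Proof.
move=> /boolp.choice[f fP] mono.
exists (\sum_i `|f i|); first by apply: sumr_ge0 => i _; exact: normr_ge0.
move=> i; apply: mono (fP i) _; apply: le_trans (ler_norm _) _.
by rewrite (bigD1 i)//= lerDl sumr_ge0.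
Qed.

Lemma der_sum (I : Type) (l : seq I) (P : pred I) (f : I -> Cx R -> Cx R) x :
  (forall i, P i -> derivable (f i) x 1) ->
  derivable (fun y => \sum_(i <- l | P i) f i y) x 1.
Proof.
move=> df; elim: l => [|i l IH].
  by under eq_fun do rewrite big_nil; exact: der_cst.
under eq_fun do rewrite big_cons.
by have [Pi|//] := boolP (P i); exact: (derD (df i Pi) IH).
Qed.

Lemma cabs_sum_const (I : finType) (P : pred I) (f : I -> Cx R) (M : R) :
  0 <= M -> (forall i, P i -> cabs (f i) <= M) ->
  cabs (\sum_(i | P i) f i) <= #|I|%:R * M.
Proof.
move=> M0 fM; apply: le_trans (cabs_sum _ _ _) _.
apply: (@le_trans _ _ (\sum_(i | P i) M)); first exact: ler_sum.
rewrite sumr_const -[leLHS]mulr_natl ler_wpM2r// ler_nat.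
exact: max_card.
Qed.

Lemma ccirc_seam_pullback (s : Cx R) (f : Cx R -> Cx R) :
  (forall u, cabs u < 1 -> derivable f u 1) -> cabs s < 1 ->
  ccirc (Num.sqrt (cabs s)) (seam_pullback s f).
Proof.
move=> df s1 w ws; have [->|s0] := eqVneq s 0.
  have -> : seam_pullback 0 f = (fun=> 0 : Cx R).
    by apply/funext => u; rewrite /seam_pullback oppr0 !mul0r mulr0.
  exact: cont_cst.
apply/derivable_cont/der_seam_pullback => //.
by rewrite ws; exact: lt_seam_radius.
Qed.

End FiniteBounds.

(** * The differentials xi near the nodes *)
Section Curve.
Context {R : realType} {X : nodal_curve R}.
Variables (A : forall v : nc_vert X, 'I_(nc_genus v) -> loop (nc_comp v))
  (z : forall v : nc_vert X, nc_edge X -> chart (nc_comp v))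
  (q0 : forall v : nc_vert X, nc_comp v)
  (K : forall v : nc_vert X, nc_edge X -> nc_comp v -> differential (nc_comp v))
  (Omega : forall v : nc_vert X, differential (nc_comp v))
  (r : nc_edge X -> Cx R).
Hypothesis coordz : local_coordinates z.
Hypothesis q0_out : forall v e, nc_src e = v -> ~ coord_disc (z v e) (q0 v).
Hypothesis kernelK : forall v e, nc_src e = v ->
  cauchy_kernel_branch (@A v) (q0 v) (coord_disc (z v e)) (@K v e).
Hypothesis stableOmega : stable_differential Omega r.
Implicit Types (v : nc_vert X) (e : nc_edge X) (s : nc_edge X -> Cx R).

Lemma disc_inv v e (y : Cx R) : nc_src e = v -> cabs y < 1 ->
  [/\ chart_dom (z v e) (chart_inv (z v e) y),
      chart_map (z v e) (chart_inv (z v e) y) = y &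
      coord_disc (z v e) (chart_inv (z v e) y)].
Proof.
move=> ve y1; have [_ _ /(_ y y1) [p dp py]] := coordz.1 v e ve.
have E : chart_inv (z v e) y = p by rewrite -py chart_mapK.
by rewrite E; split => //; split => //; rewrite py.
Qed.

Lemma node_disc v e : nc_src e = v -> coord_disc (z v e) (nc_node v e).
Proof.
by move=> ve; have [d n _] := coordz.1 v e ve; split => //; rewrite n cabs0.
Qed.

Lemma disc_inj v e e' p : nc_src e = v -> nc_src e' = v ->
  coord_disc (z v e) p -> coord_disc (z v e') p -> e = e'.
Proof.
move=> ve ve' pe pe'; apply: contrapT => ne.
have := coordz.2 v e e' ve ve' ne; rewrite -subset0 => /(_ p).
by apply.
Qed.

(** The discs of distinct edges at a vertex are disjoint and the base point is outside
    of them, so only the diagonal is singular. *)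
Lemma kernel_node_holo v e e' (y w : Cx R) : nc_src e = v -> nc_src e' = v ->
  cabs y < 1 -> cabs w < 1 -> (e == e' -> y <> w) ->
  [/\ {for (y, w), continuous (fun p : Cx R * Cx R =>
        kernel_at z K e' (z v e) (chart_inv (z v e) p.1) p.2)},
      derivable (fun x => kernel_at z K e' (z v e) (chart_inv (z v e) x) w) y 1 &
      derivable (fun w => kernel_at z K e' (z v e) (chart_inv (z v e) y) w) w 1].
Proof.
move=> ve ve' y1 w1 off.
have [d1 m1 c1] := disc_inv ve y1; have [d2 m2 c2] := disc_inv ve' w1.
have := (kernelK ve').2 (z v e) (z v e') (y, w); apply.
exists (chart_inv (z v e) y), (chart_inv (z v e') w); split => //.
- split.
  + move=> E; have ee : e = e' by apply: (disc_inj ve ve' c1); rewrite E.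
    subst e'; apply: (off (eqxx e)).
    by rewrite -m1 E m2.
  + by move=> E; apply: (q0_out ve); rewrite -E.
  + by move=> E; apply: (q0_out ve'); rewrite -E.
- by rewrite m1 m2.
Qed.

Lemma kernel_node_pole v e e' : nc_src e = v -> nc_src e' = v -> e == e' ->
  forall w : Cx R, cabs w < 1 -> exists h : Cx R -> Cx R,
  (\forall y \near w, derivable h y 1) /\
  (\forall y \near w^', kernel_at z K e' (z v e) (chart_inv (z v e) y) w =
     two_pi_i^-1 / (y - w) + h y).
Proof.
move=> ve ve' /eqP ee w w1; subst e'.
have [d m c] := disc_inv ve w1.
have nq : chart_inv (z v e) w <> q0 v by move=> E; apply: (q0_out ve); rewrite -E.
have [_ sp _ _] := (kernelK ve).1 _ c nq.
have := sp (z v e) d; rewrite m.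
by case=> h [dh hh]; exists h; split.
Qed.

Notation Rk v e e' := (reg_kernel z K v e e').

Lemma reg_kernel_der_l v e e' (x w : Cx R) : nc_src e = v -> nc_src e' = v ->
  cabs x < 1 -> cabs w < 1 -> derivable (Rk v e e' ^~ w) x 1.
Proof.
move=> ve ve' x1 w1.
exact: (reg_part_der_l (fun y w => @kernel_node_holo v e e' y w ve ve')
  (kernel_node_pole ve ve')).
Qed.

Lemma reg_kernel_joint v e e' (x w : Cx R) : nc_src e = v -> nc_src e' = v ->
  cabs x < 1 -> cabs w < 1 ->
  {for (x, w), continuous (fun p : Cx R * Cx R => Rk v e e' p.1 p.2)}.
Proof.
move=> ve ve' x1 w1.
exact: (reg_part_joint (fun y w => @kernel_node_holo v e e' y w ve ve')
  (kernel_node_pole ve ve')).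
Qed.

Lemma reg_kernel_der_r v e e' (x w : Cx R) : nc_src e = v -> nc_src e' = v ->
  cabs x < 1 -> cabs w < 1 -> w <> x -> derivable (Rk v e e' x) w 1.
Proof.
move=> ve ve' x1 w1 wx.
exact: (reg_part_der_r (fun y w => @kernel_node_holo v e e' y w ve ve') x1 w1 wx).
Qed.

Lemma reg_kernel_cont_r v e e' (x w : Cx R) : nc_src e = v -> nc_src e' = v ->
  cabs x < 1 -> cabs w < 1 -> {for w, continuous (Rk v e e' x)}.
Proof.
move=> ve ve' x1 w1.
apply: (@continuous_comp _ _ _ (fun w : Cx R => (x, w))
  (fun p : Cx R * Cx R => Rk v e e' p.1 p.2)); last exact: reg_kernel_joint.
exact: (cvg_pair (@cont_cst R _ x w) cvg_id).
Qed.

Lemma xi0_der s e (x : Cx R) : cabs x < 1 -> derivable (xi_form z K Omega r s 0 e) x 1.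
Proof.
move=> x1; set v := nc_src e; have ve : nc_src e = v by [].
have [holo pole _] := stableOmega.
have [nd nm _] := coordz.1 v e ve.
have [x0|x0] := eqVneq x 0.
  have := pole v e ve (z v e) nd; rewrite nm => -[h [dh hh]].
  rewrite x0; apply: (regularize_derivable dh).
  by apply: filterS hh => y; rewrite subr0 => ->; rewrite addrAC subrr add0r.
have [d m c] := disc_inv ve x1.
(* A node in the disc of [e] is the node of [e], which has coordinate 0. *)
have h : holomorphic_at (Omega v) (chart_inv (z v e) x).
  apply: holo => e' ve' E.
  have ee : e = e' by apply: (disc_inj ve ve' c); rewrite E; exact: node_disc.
  subst e'; move: x0; rewrite -m E nm eqxx//.
have := h (z v e) d; rewrite m => dh.
apply: (@regularize_derivable _ _
  (fun y => coef (Omega v) (z v e) (chart_inv (z v e) y) - r e / y)); last first.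
  by apply/dnbhscP; exists 1.
apply: filterS2 dh (near_neq x0) => y dy y0; apply: (derB dy).
by apply: derM; [exact: der_cst|exact: der_recip].
Qed.

Lemma xi_der k s e (x : Cx R) : (forall e, cabs (s e) < 1) -> cabs x < 1 ->
  derivable (xi_form z K Omega r s k e) x 1.
Proof.
move=> s1; elim: k e x => [|k IH] e x x1; first exact: xi0_der.
rewrite /=; apply: der_sum => e' /eqP ve'.
have rho1 : 0 <= seam_radius s e' < 1.
  by rewrite /seam_radius sqrtr_ge0 /= -[ltRHS]sqrtr1 ltr_sqrt.
apply: (@derivable_circle_integral _ (Rk (nc_src e) e e')
  (pullback s e' (xi_form z K Omega r s k (nc_opp e'))) _ _ x1 rho1).
- by move=> y w y1 w1; exact: reg_kernel_der_l.
- by move=> y w y1 w1; exact: reg_kernel_joint.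
- by apply: ccirc_seam_pullback => // u u1; exact: IH.
Qed.

Lemma plumbing_norm_ge s e : cabs (s e) <= plumbing_norm s.
Proof. by rewrite /plumbing_norm; exact: (le_bigmax _ (fun e => cabs (s e))). Qed.

Lemma plumbing_norm_ge0 s : 0 <= plumbing_norm s.
Proof. exact: bigmax_ge_id. Qed.

Lemma reg_kernel_bound : exists2 M : R, 0 <= M & forall e e', nc_src e' = nc_src e ->
  forall x w, cabs x <= 2^-1 -> cabs w = 2^-1 -> cabs (Rk (nc_src e) e e' x w) <= M.
Proof.
have h1 : 2^-1 < 1 :> R by lra.
have [|i M M'|M M0 MP] := @finite_bound R (nc_edge X * nc_edge X)%type
   (fun i M => nc_src i.2 = nc_src i.1 ->
      forall x w, cabs x <= 2^-1 -> cabs w = 2^-1 ->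
        cabs (Rk (nc_src i.1) i.1 i.2 x w) <= M).
- move=> [e e'] /=.
  have [ee|ne] := pselect (nc_src e' = nc_src e); last by exists 0.
  have cc := compact_setX (@compact_cdisc R 0 2^-1) (@compact_circle R 2^-1).
  have [|M MP] := @compact_bound R _ _
    (fun p : Cx R * Cx R => Rk (nc_src e) e e' p.1 p.2) cc.
    move=> [x w] [/=]; rewrite subr0 => x2 w2.
    by apply: reg_kernel_joint => //; [exact: le_lt_trans x2 h1|rewrite w2].
  by exists M => _ x w x2 w2; apply: (MP (x, w)); split => //=; rewrite subr0.
- by move=> H MM ee x w x2 w2; apply: le_trans MM; exact: H.
- by exists M => // e e'; exact: (MP (e, e')).
Qed.

(** The fixed circle for the integrals near the nodes has radius [1 / 2]: it must
    surround the seams, and [s / w] must lie in the disc of radius [1 / 4] of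
    [cauchy_lipschitz]. *)
Lemma small_seam s e : plumbing_norm s < 16^-1 ->
  [/\ cabs (s e) < 1, Num.sqrt (cabs (s e)) <= 2^-1 & cabs (s e) / 2^-1 <= 4^-1].
Proof.
move=> s16; have := plumbing_norm_ge s e => se.
split; [by lra| |by lra].
have -> : 2^-1 = Num.sqrt (4^-1) :> R.
  have -> : 4^-1 = 2^-1 ^+ 2 :> R by field.
  by rewrite sqrtr_sqr ger0_norm.
by rewrite ler_sqrt//; lra.
Qed.

Lemma xi_step s k e (x : Cx R) : plumbing_norm s < 16^-1 -> cabs x < 1 ->
  xi_form z K Omega r s k.+1 e x =
  \sum_(e' | nc_src e' == nc_src e) circle_integral 2^-1 (fun w =>
     Rk (nc_src e) e e' x w *
     seam_pullback (s e') (xi_form z K Omega r s k (nc_opp e')) w).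
Proof.
move=> s16 x1 /=; apply: eq_bigr => e' /eqP ve'.
have [s1 s2 _] := small_seam e' s16.
have h1 : 2^-1 < 1 :> R by lra.
apply: (@seam_deform _ _ _ _ x 2^-1 1) => //.
- move=> u u1; apply: xi_der => // e2.
  by have [] := small_seam e2 s16.
- by move=> w /andP[_ w1] wx; exact: reg_kernel_der_r.
- by move=> _; exact: reg_kernel_cont_r.
Qed.

(** The pullback contributes one factor [s] at each step. *)
Lemma xi_bound k : exists2 M : R, 0 <= M & forall s, plumbing_norm s < 16^-1 ->
  forall e x, cabs x <= 2^-1 ->
    cabs (xi_form z K Omega r s k e x) <= M * plumbing_norm s ^+ k.
Proof.
have h1 : 2^-1 < 1 :> R by lra.
elim: k => [|k [M M0 IH]].
  have [e|e M M'|M M0 MP] := @finite_bound R (nc_edge X)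
      (fun e M => forall s x, cabs x <= 2^-1 -> cabs (xi_form z K Omega r s 0 e x) <= M).
  - have [|M MP] := @compact_bound R _ _
      (xi_form z K Omega r (fun=> 0) 0 e) (@compact_cdisc R 0 2^-1).
      move=> x /=; rewrite subr0 => x2; apply: derivable_cont.
      apply: (@xi0_der (fun=> 0) e x).
      exact: le_lt_trans x2 h1.
    by exists M => s x x2; apply: (MP x); rewrite /= subr0.
  - by move=> H MM s x x2; apply: le_trans MM; exact: H.
  - by exists M => // s _ e x x2; rewrite expr0 mulr1; exact: MP.
have [C C0 CP] := reg_kernel_bound.
exists (#|nc_edge X|%:R * (4 * pi * C * M / 2^-1)).
  by rewrite mulr_ge0// divr_ge0// mulr_ge0// mulr_ge0// mulr_ge0// pi_ge0.
move=> s s16 e x x2; rewrite xi_step//; last exact: le_lt_trans x2 h1.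
set N := plumbing_norm s.
have N0 : 0 <= N by exact: plumbing_norm_ge0.
rewrite exprS -mulrA; apply: cabs_sum_const.
  by rewrite !mulr_ge0 ?exprn_ge0 ?invr_ge0 ?pi_ge0.
move=> e' /eqP ve'; have [s1 s2 s3] := small_seam e' s16.
have h0 : 0 < 2^-1 :> R by rewrite invr_gt0.
apply: le_trans (@seam_bound _ (s e') (Rk (nc_src e) e e' x)
   (xi_form z K Omega r s k (nc_opp e')) 2^-1 C (M * N ^+ k) _ _ h0 _ _ s3) _.
- by move=> u u1; apply: xi_der => // e2; have [] := small_seam e2 s16.
- move=> w w2; apply: reg_kernel_cont_r => //; first exact: le_lt_trans x2 h1.
  by rewrite w2.
- by move=> w w2; exact: CP.
- by move=> u u2; exact: IH.
have -> : 4 * pi * C * M / 2^-1 * (N * N ^+ k) = 4 * pi * C * (M * N ^+ k) / 2^-1 * N.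
  by ring.
apply: ler_wpM2l; last exact: plumbing_norm_ge.
by rewrite !mulr_ge0 ?exprn_ge0 ?invr_ge0 ?pi_ge0.
Qed.

(** The recursion obeyed by the leading terms of the values of [xi] at the nodes;
    [xi_leading_paths] unfolds it into a sum over paths. *)
Fixpoint xi_leading s k e : Cx R :=
  if k is k'.+1 then
    \sum_(e' | nc_src e' == nc_src e)
      - (s e' * beta_const z K e e' * xi_leading s k' (nc_opp e'))
  else xi_node z K Omega r s e.

(** By [cauchy_derive0]: for [e = e'] the point [w = 0] is on the diagonal, where
    the regular part of the kernel is only known to be continuous. *)
Lemma beta_integral e e' : nc_src e' = nc_src e ->
  circle_integral 2^-1 (fun w => Rk (nc_src e) e e' 0 w * w^-1 * w^-1) =
  beta_const z K e e'.
Proof.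
move=> ve'; rewrite /beta_const /reg_omega.
have c00 : cabs (0 : Cx R) < 1 by rewrite cabs0.
have h : 0 < (2^-1 : R) < 1 by apply/andP; split; lra.
have H := @cauchy_derive0 R (Rk (nc_src e) e e' 0) 1 2^-1.
rewrite (cdiff_derive1 (H _ _ h)) ?mulrA ?mulfV ?mul1r ?two_pi_i_neq0//.
  move=> y /andP[y0 y1]; apply: reg_kernel_der_r => //.
  by apply/eqP; rewrite -cabs_gt0.
exact: reg_kernel_cont_r.
Qed.

(** At each step the error is the sum of the one of [seam_leading], which is
    [O(s^2)] times a value of the previous [xi], and of [s beta] times the
    previous error. *)
Lemma xi_leading_approx k : exists2 M : R, 0 <= M & forall s, plumbing_norm s < 16^-1 ->
  forall e, cabs (xi_form z K Omega r s k e 0 - xi_leading s k e) <=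
    M * plumbing_norm s ^+ k.+1.
Proof.
have h1 : 2^-1 < 1 :> R by lra.
have h0 : 0 < 2^-1 :> R by rewrite invr_gt0.
elim: k => [|k [M M0 IH]].
  by exists 0 => // s _ e; rewrite /= subrr cabs0 mul0r.
have [C C0 CP] := reg_kernel_bound.
have [D D0 DP] := xi_bound k.
have [[i j]|i B B'|B B0 BP] := @finite_bound R (nc_edge X * nc_edge X)%type
   (fun i M => cabs (beta_const z K i.1 i.2) <= M).
- by exists (cabs (beta_const z K i j)).
- exact: le_trans.
have P0 := pi_ge0 R.
have C1 : 0 <= 32 * pi * C * D / 2^-1 ^+ 2 by rewrite !mulr_ge0 ?invr_ge0.
exists (#|nc_edge X|%:R * (32 * pi * C * D / 2^-1 ^+ 2 + B * M)).
  by rewrite mulr_ge0// addr_ge0// mulr_ge0.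
move=> s s16 e; set N := plumbing_norm s.
have N0 : 0 <= N by exact: plumbing_norm_ge0.
have c00 : cabs (0 : Cx R) < 1 by rewrite cabs0.
rewrite xi_step// [xi_leading _ _ _]/= -sumrB -mulrA; apply: cabs_sum_const.
  by rewrite mulr_ge0 ?exprn_ge0// addr_ge0// mulr_ge0.
move=> e' /eqP ve'; have [s1 s2 s3] := small_seam e' s16.
set f := xi_form z K Omega r s k (nc_opp e').
set J := circle_integral _ _; set b := beta_const z K e e'.
set L := xi_leading s k _.
have -> : J - - (s e' * b * L) = (J + s e' * f 0 * b) - s e' * b * (f 0 - L) by ring.
apply: le_trans (cabsD _ _) _; rewrite cabsN mulrDl.
have sN : cabs (s e') <= N by exact: plumbing_norm_ge.
apply: lerD.
  rewrite /b -(beta_integral ve').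
  apply: le_trans (@seam_leading _ (s e') (Rk (nc_src e) e e' 0) f
    2^-1 C (D * N ^+ k) _ _ h0 _ _ s3) _.
  - by move=> u u1; apply: xi_der => // e2; have [] := small_seam e2 s16.
  - by move=> w w2; apply: reg_kernel_cont_r => //; rewrite w2.
  - by move=> w w2; apply: CP => //; rewrite cabs0 ltW.
  - by move=> u u2; exact: DP.
  have -> : 32 * pi * C * D / 2^-1 ^+ 2 * N ^+ k.+2 =
      32 * pi * C * (D * N ^+ k) / 2^-1 ^+ 2 * N ^+ 2 by rewrite !exprS; ring.
  apply: ler_wpM2l; first by rewrite !mulr_ge0 ?exprn_ge0 ?invr_ge0.
  by rewrite ler_pXn2r// nnegrE ?cabs_ge0.
rewrite (cabsM (s e' * b)) (cabsM (s e')).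
have -> : B * M * N ^+ k.+2 = N * B * (M * N ^+ k.+1) by rewrite exprS; ring.
have H1 := ler_pM (cabs_ge0 (s e')) (cabs_ge0 b) sN (BP (e, e')).
have H2 : cabs (f 0 - L) <= M * N ^+ k.+1 by exact: IH.
exact: (ler_pM (mulr_ge0 (cabs_ge0 _) (cabs_ge0 _)) (cabs_ge0 _) H1 H2).
Qed.

End Curve.

(** * A kernel with a fixed pole in the first variable *)

(** The residue [c] at [y0] does not depend on [w]; it is zero when [y0] is not
    the base point. *)
Section RemovablePole.
Context {R : realType}.
Variables (k : Cx R -> Cx R -> Cx R) (y0 c : Cx R) (eps rho : R).
Implicit Types (x y w s : Cx R) (f : Cx R -> Cx R).

Hypothesis kholo : forall y w, y != y0 -> cabs (y - y0) < eps -> cabs w < rho ->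
  [/\ {for (y, w), continuous (fun p : Cx R * Cx R => k p.1 p.2)},
      derivable (k ^~ w) y 1 & derivable (k y) w 1].
Hypothesis kpole : forall w, cabs w < rho -> exists h : Cx R -> Cx R,
  (\forall y \near y0, derivable h y 1) /\
  (\forall y \near y0^', k y w = c / (y - y0) + h y).

(** Subtracting the value at [w = 0] cancels the pole. *)
Definition pole_free y w := regularize (fun y' => k y' w - k y' 0) y.

Lemma near_cball_in y : cabs (y - y0) < eps -> \forall x \near y, cabs (x - y0) < eps.
Proof.
move=> ye; have cy : {for y, continuous (fun y : Cx R => y - y0)}.
  exact: (contB cvg_id (@cont_cst R _ y0 y)).
exact: near_cabs_lt cy ye.
Qed.

Lemma pole_free_off y w : y != y0 -> cabs (y - y0) < eps -> cabs w < rho ->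
  pole_free y w = k y w - k y 0.
Proof.
move=> yn ye w1; have w0 : cabs (0 : Cx R) < rho.
  by rewrite cabs0 (le_lt_trans (cabs_ge0 w)).
have H := @regularize_eq R (fun y' => k y' w - k y' 0) (fun y' => k y' w - k y' 0) y.
apply: H; last by apply/dnbhscP; exists 1.
have [_ d1 _] := kholo yn ye w1; have [_ d2 _] := kholo yn ye w0.
exact: (derivable_cont (derB d1 d2)).
Qed.

Lemma pole_free_der_l y w : cabs (y - y0) < eps -> cabs w < rho ->
  derivable (pole_free ^~ w) y 1.
Proof.
move=> ye w1; have w0 : cabs (0 : Cx R) < rho.
  by rewrite cabs0 (le_lt_trans (cabs_ge0 w)).
have [yy|yn] := eqVneq y y0.
  have [h [dh hk]] := kpole w1; have [h0 [dh0 hk0]] := kpole w0.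
  rewrite yy; apply: (@regularize_derivable _ _ (fun y => h y - h0 y)).
    by apply: filterS2 dh dh0 => u d1 d2; exact: derB.
  by apply: filterS2 hk hk0 => u -> ->; ring.
apply: (@regularize_derivable _ _ (fun y' => k y' w - k y' 0)).
  apply: filterS2 (near_cball_in ye) (near_neq yn) => u ue un.
  have [_ d1 _] := kholo un ue w1; have [_ d2 _] := kholo un ue w0.
  exact: (derB d1 d2).
by apply/dnbhscP; exists 1.
Qed.

Lemma pole_free_joint y w : cabs (y - y0) < eps -> cabs w < rho ->
  {for (y, w), continuous (fun p : Cx R * Cx R => pole_free p.1 p.2)}.
Proof.
move=> ye w1.
pose r := (cabs (y - y0) + eps) / 2.
have yr : cabs (y - y0) < r by rewrite /r; lra.
have re : r < eps by rewrite /r; lra.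
have r0 : 0 < r := le_lt_trans (cabs_ge0 _) yr.
have w0 : cabs (0 : Cx R) < rho by rewrite cabs0 (le_lt_trans (cabs_ge0 w)).
have dsh h : derivable (fun h : Cx R => y0 + h) h 1.
  by apply: derD; [exact: der_cst|exact: der_id].
have H : {for (y - y0, w), continuous (fun p : Cx R * Cx R => pole_free (y0 + p.1) p.2)}.
  apply: (@joint_continuity _ _ (fun h w => pole_free (y0 + h) w) _ _ r eps yr re).
    move=> u ur.
    have un : y0 + u != y0.
      by rewrite -subr_eq0 addrAC subrr add0r -cabs_gt0 ur.
    have ue : cabs (y0 + u - y0) < eps by rewrite addrAC subrr add0r ur.
    have cu : {for (u, w), continuous (fun p : Cx R * Cx R => p.1)} by exact: cvg_fst.
    have cw : {for (u, w), continuous (fun p : Cx R * Cx R => p.2)} by exact: cvg_snd.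
    have cx := contD (@cont_cst R _ y0 (u, w)) cu.
    have c1 : {for (u, w), continuous (fun p : Cx R * Cx R => k (y0 + p.1) p.2)}.
      apply: (@continuous_comp _ _ _ (fun p : Cx R * Cx R => (y0 + p.1, p.2))
        (fun p : Cx R * Cx R => k p.1 p.2)); first exact: (cvg_pair cx cw).
      have [H _ _] := kholo un ue w1; exact: H.
    have c2 : {for (u, w), continuous (fun p : Cx R * Cx R => k (y0 + p.1) 0)}.
      apply: (@continuous_comp _ _ _ (fun p : Cx R * Cx R => (y0 + p.1, (0 : Cx R)))
        (fun p : Cx R * Cx R => k p.1 p.2)).
        exact: (cvg_pair cx (@cont_cst R _ (0 : Cx R) (u, w))).
      have [H _ _] := kholo un ue w0; exact: H.
    have c3 := contB c1 c2; apply: cont_near_eq c3.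
    have n1 := near_comp (P := fun y => cabs (y - y0) < eps) cx (near_cball_in ue).
    have n2 := near_comp (P := fun y => y != y0) cx (near_neq un).
    have n3 := near_cabs_lt cw w1.
    near=> p; rewrite pole_free_off//; [by near: p|by near: p|by near: p].
  apply: filterS (near_disc w1) => w' w'1; split.
    move=> h /andP[_ he]; apply: (der_comp (dsh h)).
    by apply: pole_free_der_l => //; rewrite addrAC subrr add0r.
  apply: derivable_cont; apply: (der_comp (dsh 0)); apply: pole_free_der_l => //.
  by rewrite addr0 subrr cabs0 (lt_trans r0).
have cy : {for (y, w), continuous (fun p : Cx R * Cx R => p.1)} by exact: cvg_fst.
have cw : {for (y, w), continuous (fun p : Cx R * Cx R => p.2)} by exact: cvg_snd.
have cc : {for (y, w), continuous (fun p : Cx R * Cx R => (p.1 - y0, p.2))}.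
  exact: (cvg_pair (contB cy (@cont_cst R _ y0 (y, w))) cw).
have := @continuous_comp _ _ _ (fun p : Cx R * Cx R => (p.1 - y0, p.2)) _ (y, w) cc H.
have -> // : (fun p : Cx R * Cx R => pole_free (y0 + p.1) p.2) \o
    (fun p : Cx R * Cx R => (p.1 - y0, p.2)) = (fun p => pole_free p.1 p.2).
apply/funext => -[a b] /=.
by have -> : y0 + (a - y0) = a by rewrite addrC subrK.
Unshelve. all: by end_near. Qed.

Lemma pole_free_cont_r y w : cabs (y - y0) < eps -> cabs w < rho ->
  {for w, continuous (pole_free y)}.
Proof.
move=> ye w1; apply: (@continuous_comp _ _ _ (fun w : Cx R => (y, w))
  (fun p : Cx R * Cx R => pole_free p.1 p.2)); last exact: pole_free_joint.
exact: (cvg_pair (@cont_cst R _ y w) cvg_id).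
Qed.

Lemma cvg_dnbhs_near (f h : Cx R -> Cx R) y : {for y, continuous h} ->
  (\forall x \near y^', f x = h x) -> f @ y^' --> h y.
Proof.
move=> ch fh.
have : h @ y^' --> h y by apply: cvg_trans ch; apply: cvg_app; exact: cvg_within.
apply: cvg_trans; apply: near_eq_cvg.
by apply: filterS fh.
Qed.

Lemma near_punctured y : cabs (y - y0) < eps ->
  \forall x \near y^', x != y0 /\ cabs (x - y0) < eps.
Proof.
move=> ye; have [d1 d10 H1] := (nbhscP _ _).1 (near_cball_in ye).
have [yy|yn] := eqVneq y y0.
  by apply/dnbhscP; exists d1 => // x xy xd; split; [rewrite -yy|exact: H1].
have [d2 d20 H2] := (nbhscP _ _).1 (near_neq yn).
apply/dnbhscP; exists (Num.min d1 d2); first by rewrite lt_min d10.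
by move=> x _; rewrite lt_min => /andP[/H1 ? /H2 ?].
Qed.

Lemma pole_free_param (g : Cx R -> Cx R) r y : 0 <= r -> r < rho -> ccirc r g ->
  cabs (y - y0) < eps ->
  {for y, continuous (fun y => circle_integral r (fun w => pole_free y w * g w))}.
Proof.
move=> r0 rrho cg ye.
apply: (@circle_integral_param _ _ r (fun y w => pole_free y w * g w)); first exact: r0.
  move=> w wr; have w1 : cabs w < rho by rewrite wr.
  have cw : {for (y, w), continuous (fun p : Cx R * Cx R => p.2)} by exact: cvg_snd.
  have cgw : {for (y, w), continuous (fun p : Cx R * Cx R => g p.2)}.
    by apply: (continuous_comp cw); exact: cg.
  exact: (contM (pole_free_joint ye w1) cgw).
apply: filterS (near_cball_in ye) => x xe w wr.
have w1 : cabs w < rho by rewrite wr.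
exact: (contM (pole_free_cont_r xe w1) (cg w wr)).
Qed.

(** [k x w] and [pole_free x w] differ by [k x 0], which is constant in [w] and
    does not contribute by [seam_pullback_integral0]. *)
Lemma seam_limit f s r y : (forall u, cabs u < 1 -> derivable f u 1) ->
  cabs s < 1 -> Num.sqrt (cabs s) <= r -> 0 < r -> r < rho -> cabs (y - y0) < eps ->
  (fun x => circle_integral (Num.sqrt (cabs s)) (fun w => k x w * seam_pullback s f w))
    @ y^' --> circle_integral r (fun w => pole_free y w * seam_pullback s f w).
Proof.
move=> df s1 sr r0 rrho ye.
have ssr : cabs s < r.
  have [->|s0] := eqVneq s 0; first by rewrite cabs0.
  by apply: lt_le_trans sr; exact: lt_seam_radius.
have cpb : ccirc r (seam_pullback s f).
  by move=> w wr; apply: derivable_cont; apply: der_seam_pullback => //; rewrite wr.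
apply: (@cvg_dnbhs_near _
  (fun y => circle_integral r (fun w => pole_free y w * seam_pullback s f w))).
  by apply: pole_free_param => //; exact: ltW.
apply: filterS (near_punctured ye) => x [xn xe].
have dk w : cabs w < rho -> derivable (k x) w 1.
  by move=> w1; have [] := kholo xn xe w1.
have w0 : cabs (0 : Cx R) < rho by rewrite cabs0 (lt_trans r0).
rewrite (@seam_deform _ s (k x) f 0 r rho)//; last 2 first.
- by move=> w /andP[_ w1] _; exact: dk.
- by move=> _; apply: derivable_cont; exact: dk.
have cp : ccirc r (fun w => pole_free x w * seam_pullback s f w).
  move=> w wr; have w1 : cabs w < rho by rewrite wr.
  exact: (contM (pole_free_cont_r xe w1) (cpb w wr)).
have c0 : ccirc r (fun w => k x 0 * seam_pullback s f w).
  by move=> w wr; exact: (contM (@cont_cst R _ (k x 0) w) (cpb w wr)).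
have -> : circle_integral r (fun w => k x w * seam_pullback s f w) =
    circle_integral r (fun w =>
      pole_free x w * seam_pullback s f w + k x 0 * seam_pullback s f w).
  apply: eq_circle_integral (ltW r0) _ => w wr.
  by rewrite pole_free_off ?wr//; ring.
rewrite (circle_integralD (ltW r0) cp c0) (circle_integralZ _ (ltW r0) cpb).
by rewrite (seam_pullback_integral0 df ssr) mulr0 addr0.
Qed.

Lemma omega_limit r y : 0 < r -> r < rho -> cabs (y - y0) < eps ->
  (fun x => two_pi_i * derive1 (k x) 0) @ y^' -->
  circle_integral r (fun w => pole_free y w * w^-1 * w^-1).
Proof.
move=> r0 rrho ye.
have ci w : cabs w = r -> {for w, continuous (fun w : Cx R => w^-1)}.
  move=> wr; have wn : w != 0 by rewrite -cabs_gt0 wr.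
  exact: (derivable_cont (der_recip wn)).
have cg : ccirc r (fun w => w^-1 * w^-1).
  by move=> w wr; exact: (contM (ci w wr) (ci w wr)).
have w0 : cabs (0 : Cx R) < rho by rewrite cabs0 (lt_trans r0).
have E x : circle_integral r (fun w => pole_free x w * w^-1 * w^-1) =
    circle_integral r (fun w => pole_free x w * (w^-1 * w^-1)).
  by apply: eq_circle_integral (ltW r0) _ => w _; rewrite mulrA.
rewrite E.
apply: (@cvg_dnbhs_near _
  (fun y => circle_integral r (fun w => pole_free y w * (w^-1 * w^-1)))).
  by apply: pole_free_param => //; exact: ltW.
apply: filterS (near_punctured ye) => x [xn xe].
have dk w : cabs w < rho -> derivable (k x) w 1.
  by move=> w1; have [] := kholo xn xe w1.
have off w : cabs w < rho -> pole_free x w = k x w - k x 0.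
  by move=> w1; exact: pole_free_off.
have dP w : cabs w < rho -> derivable (pole_free x) w 1.
  move=> w1; apply: (@near_eq_derivable _ _ _ (fun w => k x w - k x 0)).
    by apply: filterS (near_disc w1) => w' w'1; rewrite off.
  exact: (derB (dk w w1) (@der_cst R (k x 0) w)).
rewrite -E.
have dP' w : 0 < cabs w < rho -> derivable (pole_free x) w 1 by move=> /andP[_ /dP].
have rr : 0 < r < rho by rewrite r0.
have H := cauchy_derive0 dP' (derivable_cont (dP _ w0)) rr.
have -> : derive1 (k x) 0 = derive1 (pole_free x) 0.
  apply: cdiff_derive1; have /derivable_cdiff D := dP _ w0.
  move=> e e0; have [d d0 P] := D e e0; exists (Num.min d rho).
    by rewrite lt_min d0 (lt_trans r0).
  move=> w; rewrite subr0 lt_min => /andP[wd wr].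
  have := P w; rewrite subr0 => /(_ wd); rewrite !off//.
  by rewrite subrr subr0.
by rewrite (cdiff_derive1 H) mulrA mulfV ?mul1r// two_pi_i_neq0.
Qed.

End RemovablePole.

(** * Limits on Riemann surfaces, read in charts *)
Section Surface.
Context {R : realType} {X : riemannSurface R}.
Implicit Types (phi : chart X) (x y p : X).

Lemma separate x y : x <> y -> exists U V : set X,
  [/\ nbhs x U, nbhs y V & forall q, U q -> V q -> False].
Proof.
move=> xy; apply: contrapT => H; apply: xy; apply: (@rs_hausdorff R X).
move=> U V Ux Vy; apply: contrapT => UV; apply: H; exists U, V; split => // q Uq Vq.
by apply: UV; exists q.
Qed.

Lemma chart_ball phi p : chart_dom phi p -> exists2 e : R, 0 < e &
  forall y : Cx R, cabs (y - chart_map phi p) < e ->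
    chart_dom phi (chart_inv phi y) /\ chart_map phi (chart_inv phi y) = y.
Proof.
move=> dp; have : nbhs (chart_map phi p) (chart_map phi @` chart_dom phi).
  by apply: open_nbhs_nbhs; split; [exact: chart_img_open|exists p].
move=> /nbhscP[e e0 H]; exists e => // y /H[q dq <-].
by rewrite chart_mapK.
Qed.

Lemma near_chart_dom phi p : chart_dom phi p -> \forall x \near p, chart_dom phi x.
Proof. by move=> dp; apply: open_nbhs_nbhs; split => //; exact: chart_dom_open. Qed.

Lemma near_chart_map phi p (e : R) : chart_dom phi p -> 0 < e ->
  \forall x \near p, cabs (chart_map phi x - chart_map phi p) < e.
Proof.
move=> dp e0; have := chart_map_cont dp => cp.
exact: (near_comp (P := fun y : Cx R => cabs (y - chart_map phi p) < e) cp (near_cball _ e0)).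
Qed.

Lemma near_chart_inv phi p (U : set X) : chart_dom phi p -> nbhs p U ->
  exists2 e : R, 0 < e & forall y : Cx R, cabs (y - chart_map phi p) < e -> U (chart_inv phi y).
Proof.
move=> dp Up; have cp := chart_inv_cont dp.
have : nbhs (chart_inv phi (chart_map phi p)) U by rewrite chart_mapK.
by move=> /cp /nbhscP.
Qed.

(** There are no isolated points, so that limits are unique. *)
Lemma surface_dnbhs_proper x : ProperFilter x^'.
Proof.
apply: Build_ProperFilter_ex => P Px.
have dx := rs_atlas_cover x; set phi := chart_at x.
have [e1 e10 H1] := @chart_ball phi x dx.
have [e2 e20 H2] := @near_chart_inv phi x _ dx Px.
pose e := Num.min e1 e2; have e0 : 0 < e by rewrite lt_min e10.
pose y : Cx R := chart_map phi x + ((e / 2)%:C)%C.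
have ye : cabs (y - chart_map phi x) = e / 2.
  by rewrite addrAC subrr add0r cabs_real gtr0_norm// divr_gt0.
have e2e : e / 2 < e by rewrite ltr_pdivrMr// ltr_pMr// ltr1n.
have ye1 : cabs (y - chart_map phi x) < e1.
  by rewrite ye (lt_le_trans e2e)// ge_min lexx.
have ye2 : cabs (y - chart_map phi x) < e2.
  by rewrite ye (lt_le_trans e2e)// ge_min lexx orbT.
exists (chart_inv phi y); apply: (H2 y ye2).
apply/eqP => E; have [_ m] := H1 y ye1.
have : cabs (y - chart_map phi x) = 0 by rewrite -m E subrr cabs0.
by rewrite ye => /eqP; rewrite gt_eqF// divr_gt0.
Qed.

Lemma chart_dnbhs_cvg phi x (T : X -> Cx R) (l : Cx R) : chart_dom phi x ->
  (fun y : Cx R => T (chart_inv phi y)) @ (chart_map phi x)^' --> l -> T @ x^' --> l.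
Proof.
move=> dx H; apply/(@cvgcP _ _ (x^')) => e e0.
have /(@cvgcP _ _ ((chart_map phi x)^')) /(_ e e0) /dnbhscP [d d0 dP] := H.
rewrite /dnbhs /within /=.
apply: filterS2 (near_chart_dom dx) (near_chart_map dx d0) => y dy yd yx.
have := dP (chart_map phi y) _ yd; rewrite chart_mapK//; apply.
by apply: contra yx => /eqP E; rewrite -(chart_mapK dy) E chart_mapK.
Qed.

Lemma regularize_surface (T : X -> Cx R) x l : T @ x^' --> l -> regularize T x = l.
Proof.
move=> Tl; have := surface_dnbhs_proper x => PF.
by apply: cvg_lim Tl; exact: norm_hausdorff.
Qed.

End Surface.

(** * The contribution of one edge to eta *)
Section Edges.
Context {R : realType} {X : nodal_curve R}.
Variables (A : forall v : nc_vert X, 'I_(nc_genus v) -> loop (nc_comp v))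
  (z : forall v : nc_vert X, nc_edge X -> chart (nc_comp v))
  (q0 : forall v : nc_vert X, nc_comp v)
  (K : forall v : nc_vert X, nc_edge X -> nc_comp v -> differential (nc_comp v)).
Hypothesis coordz : local_coordinates z.
Hypothesis q0_out : forall v e, nc_src e = v -> ~ coord_disc (z v e) (q0 v).
Hypothesis kernelK : forall v e, nc_src e = v ->
  cauchy_kernel_branch (@A v) (q0 v) (coord_disc (z v e)) (@K v e).

(** What is needed of the edge [e] at the point [x].  The single number [L] is a
    bound of [omega_v(x, q_e)], the inverse of the bound on [s_e] and the
    constant in the error term: so finitely many edges, and later the points of
    a compact set, only require [L] to be large. *)
Definition edge_good v (phi : chart (nc_comp v)) e (L : R) (x : nc_comp v) : Prop :=
  [/\ cabs (omega_node z K e phi x) <= L,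
      forall t : Cx R, cabs t < L^-1 ->
        ~ (chart_dom (z v e) x /\ cabs (chart_map (z v e) x) < Num.sqrt (cabs t)) &
      forall (t : Cx R) (f : Cx R -> Cx R) (M : R), cabs t < L^-1 ->
        (forall u, cabs u < 1 -> derivable f u 1) ->
        (forall u, cabs u <= 2^-1 -> cabs (f u) <= M) ->
        exists2 V : Cx R,
          (fun y => circle_integral (Num.sqrt (cabs t))
             (fun w => kernel_at z K e phi y w * seam_pullback t f w)) @ x^' --> V &
          cabs (V + t * f 0 * omega_node z K e phi x) <= L * M * cabs t ^+ 2].

Lemma edge_goodW v (phi : chart (nc_comp v)) e L L' x : 0 < L -> L <= L' ->
  edge_good phi e L x -> edge_good phi e L' x.
Proof.
move=> L0 LL [h1 h2 h3]; have L'0 : 0 < L' by exact: lt_le_trans LL.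
have LV : L'^-1 <= L^-1 by rewrite lef_pV2.
split; first exact: le_trans LL.
  by move=> t tL; apply: h2; exact: lt_le_trans LV.
move=> t f M tL df fM; have [|V cV bV] := h3 t f M _ df fM; first exact: lt_le_trans LV.
exists V => //; apply: le_trans bV _.
have M0 : 0 <= M by apply: le_trans (cabs_ge0 (f 0)) (fM 0 _); rewrite cabs0 invr_ge0.
by rewrite -!mulrA; apply: ler_wpM2r => //; rewrite mulr_ge0// exprn_ge0// cabs_ge0.
Qed.

(** The node and the base point are kept away from [p] by disjoint neighborhoods,
    unless [p] is the base point, where the kernel has a pole; both cases fall
    under [seam_limit] and [omega_limit], over a circle of radius [q] around the
    node on which [seam_leading] applies. *)
Lemma edge_local v (phi : chart (nc_comp v)) (p : nc_comp v) e : nc_src e = v ->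
  chart_dom phi p -> p <> nc_node v e ->
  exists2 L : R, 0 < L & \forall x \near p, edge_good phi e L x.
Proof.
move=> ve dp pn; set y0 := chart_map phi p.
have [nd nm _] := coordz.1 v e ve.
have [U [V [Up Vn UV]]] := separate pn.
have [e1 e10 ball1] := chart_ball dp.
have [e2 e20 ball2] := near_chart_inv dp Up.
have [r1 r10 ball3] := near_chart_inv nd Vn.
have {}ball3 w : cabs w < r1 -> V (chart_inv (z v e) w).
  by move=> wr; apply: ball3; rewrite nm subr0.
(* Near [p], only [p] itself can be the base point. *)
have [e3 e30 ball4] : exists2 e3 : R, 0 < e3 & forall y, y != y0 ->
    cabs (y - y0) < e3 -> chart_inv phi y <> q0 v.
  have [pq|pq] := pselect (p = q0 v).
    exists e1 => // y /eqP yy ye E; apply: yy.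
    by have [_ <-] := ball1 y ye; rewrite E -pq.
  have [U' [V' [Up' Vq UV']]] := separate pq.
  have [e3 e30 H] := near_chart_inv dp Up'.
  exists e3 => // y _ /H Uy E; apply: (UV' _ Uy); rewrite E.
  exact: nbhs_singleton.
pose eps := Num.min e1 (Num.min e2 e3); pose rho := Num.min r1 1.
have eps0 : 0 < eps by rewrite !lt_min e10 e20.
have rho0 : 0 < rho by rewrite lt_min r10 ltr01.
have E1 : eps <= e1 by rewrite ge_min lexx.
have E2 : eps <= e2 by rewrite !ge_min lexx orbT.
have E3 : eps <= e3 by rewrite !ge_min lexx !orbT.
have P1 : rho <= r1 by rewrite ge_min lexx.
have P2 : rho <= 1 by rewrite ge_min lexx orbT.
pose k (y w : Cx R) := kernel_at z K e phi (chart_inv phi y) w.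
have kholo y w : y != y0 -> cabs (y - y0) < eps -> cabs w < rho ->
  [/\ {for (y, w), continuous (fun p : Cx R * Cx R => k p.1 p.2)},
      derivable (k ^~ w) y 1 & derivable (k y) w 1].
  move=> yy ye w1.
  have [dy my] := ball1 y (lt_le_trans ye E1).
  have [dw mw cw] := disc_inv coordz ve (lt_le_trans w1 P2).
  have := (kernelK ve).2 phi (z v e) (y, w); apply.
  exists (chart_inv phi y), (chart_inv (z v e) w); split => //.
  - split.
    + move=> E; apply: (UV (chart_inv phi y)); first exact: ball2 (lt_le_trans ye E2).
      by rewrite E; exact: ball3 (lt_le_trans w1 P1).
    + exact: ball4 (lt_le_trans ye E3).
    + by move=> E; apply: (q0_out ve); rewrite -E.
  - by rewrite my mw.
have [c kpole] : exists c : Cx R, forall w, cabs w < rho -> exists h : Cx R -> Cx R,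
    (\forall y \near y0, derivable h y 1) /\
    (\forall y \near y0^', k y w = c / (y - y0) + h y).
  have wq w : cabs w < rho -> coord_disc (z v e) (chart_inv (z v e) w) /\
      chart_inv (z v e) w <> q0 v.
    move=> w1; have [dw mw cw] := disc_inv coordz ve (lt_le_trans w1 P2).
    by split => // E; apply: (q0_out ve); rewrite -E.
  have [pq|pq] := pselect (p = q0 v).
    exists (- two_pi_i^-1) => w w1; have [cw nq] := wq w w1.
    have [_ _ sp _] := (kernelK ve).1 _ cw nq.
    have := sp phi; rewrite -pq => /(_ dp) [h [dh hh]].
    by exists h; split.
  exists 0 => w w1; have [cw nq] := wq w w1.
  have [ho _ _ _] := (kernelK ve).1 _ cw nq.
  exists (fun y => k y w); split; last first.
    by apply/dnbhscP; exists 1 => // y _ _; rewrite mul0r add0r.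
  apply: (ho p) => //; move=> E; apply: (UV p); first exact: nbhs_singleton.
  by rewrite E; apply: ball3; exact: lt_le_trans P1.
pose q := rho / 2.
have q00 : 0 < q by rewrite divr_gt0.
have qrho : q < rho by rewrite ltr_pdivrMr// ltr_pMr// ltr1n.
have qn : q != 0 by rewrite gt_eqF.
have e2e : eps / 2 < eps by rewrite ltr_pdivrMr// ltr_pMr// ltr1n.
pose D := pole_free k.
have cc := compact_setX (@compact_cdisc R y0 (eps / 2)) (@compact_circle R q).
have [|B0 B0P] := @compact_bound R _ _ (fun p : Cx R * Cx R => D p.1 p.2) cc.
  move=> [y w] [/= y2 w2]; apply: (pole_free_joint kholo kpole).
    exact: le_lt_trans e2e.
  by rewrite w2.
pose B := `|B0|.
have B00 : 0 <= B by exact: normr_ge0.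
have BP y w : cabs (y - y0) < eps / 2 -> cabs w = q -> cabs (D y w) <= B.
  move=> ye wq; apply: le_trans (ler_norm _); apply: (B0P (y, w)).
  by split => //=; exact: ltW.
pose W y := circle_integral q (fun w => D y w * w^-1 * w^-1).
have ci w : cabs w = q -> {for w, continuous (fun w : Cx R => w^-1)}.
  move=> wr; have wn : w != 0 by rewrite -cabs_gt0 wr.
  exact: (derivable_cont (der_recip wn)).
have cD y : cabs (y - y0) < eps -> ccirc q (D y).
  move=> ye w wq; apply: (pole_free_cont_r kholo kpole ye).
  by rewrite wq.
have p0 := pi_gt0 R.
pose L1 := 4 * pi * q * (B * q^-1 * q^-1); pose L2 := 32 * pi * B / q ^+ 2.
have qi : 0 <= q^-1 by rewrite invr_ge0 ltW.
have L10 : 0 <= L1.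
  apply: mulr_ge0; first by apply: mulr_ge0; [apply: mulr_ge0 => //|]; exact: ltW.
  by apply: mulr_ge0 => //; exact: mulr_ge0.
have L20 : 0 <= L2 by rewrite !mulr_ge0 ?invr_ge0 ?exprn_ge0 ?(ltW q00) ?(ltW p0).
have q20 : 0 < (q ^+ 2)^-1 by rewrite invr_gt0 exprn_gt0.
have q40 : 0 < (q / 4)^-1 by rewrite invr_gt0 divr_gt0.
(* [L1] bounds [omega_v(x, q_e)] and [L2] is the constant of [seam_leading]; the
   other terms make [|s| < L^-1] imply that [|s| < 1], that the seam has radius
   at most [q], and that [|s| / q <= 1 / 4]. *)
pose L := L1 + L2 + 1 + (q ^+ 2)^-1 + (q / 4)^-1.
have L0 : 0 < L by rewrite /L; lra.
have LL1 : L1 <= L by rewrite /L; lra.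
have LL2 : L2 <= L by rewrite /L; lra.
have small t : cabs t < L^-1 -> [/\ cabs t < 1, Num.sqrt (cabs t) <= q & cabs t / q <= 4^-1].
  move=> tL; have inv x : 0 < x -> x <= L -> cabs t < x^-1.
    by move=> x0 xL; apply: lt_le_trans tL _; rewrite lef_pV2.
  split.
  - by rewrite -invr1; apply: inv => //; rewrite /L; lra.
  - rewrite -[leRHS](ger0_norm (ltW q00)) -sqrtr_sqr; apply: ler_wsqrtr; apply: ltW.
    by rewrite -[ltRHS]invrK; apply: inv => //; rewrite /L; lra.
  - rewrite ler_pdivrMr// mulrC; apply: ltW.
    by rewrite -[ltRHS]invrK; apply: inv => //; rewrite /L; lra.
exists L => //.
have e20' : 0 < eps / 2 by rewrite divr_gt0.
apply: filterS2 (filterI (near_chart_dom dp) Up) (near_chart_map dp e20') => x [dx Ux] xe.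
set y := chart_map phi x in xe *.
have ye : cabs (y - y0) < eps by exact: lt_trans e2e.
have om : omega_node z K e phi x = W y.
  apply: regularize_surface; apply: (chart_dnbhs_cvg dx).
  exact: (omega_limit kholo kpole q00 qrho ye).
have cW : ccirc q (fun w => D y w * w^-1 * w^-1).
  by move=> w wq; exact: (contM (contM (cD y ye w wq) (ci w wq)) (ci w wq)).
split.
- rewrite om; apply: le_trans LL1.
  apply: (circle_integral_bound (ltW q00) cW) => w wq.
  rewrite !cabsM !cabsV wq.
  by do 2 apply: ler_wpM2r => //; exact: BP.
- move=> t /small[_ tq _] [dzx zx]; apply: (UV x Ux).
  rewrite -(chart_mapK dzx); apply: ball3.
  apply: lt_le_trans zx _; apply: le_trans tq _; exact: le_trans (ltW qrho) P1.
- move=> t f M tL df fM; have [t1 t2 t3] := small t tL.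
  exists (circle_integral q (fun w => D y w * seam_pullback t f w)).
    apply: (chart_dnbhs_cvg dx).
    exact: (seam_limit kholo kpole df t1 t2 q00 qrho ye).
  rewrite om; apply: le_trans (seam_leading df (cD y ye) q00 _ fM t3) _.
    by move=> w wq; exact: BP.
  have M0 : 0 <= M by apply: le_trans (cabs_ge0 (f 0)) (fM 0 _); rewrite cabs0 invr_ge0.
  have -> : 32 * pi * B * M / q ^+ 2 * cabs t ^+ 2 = L2 * M * cabs t ^+ 2 by rewrite /L2; ring.
  have t20 : 0 <= cabs t ^+ 2 by rewrite exprn_ge0// cabs_ge0.
  exact: (ler_wpM2r t20 (ler_wpM2r M0 LL2)).
Qed.

End Edges.

(** * Sums over paths *)
Section Paths.
Context {R : realType} {X : nodal_curve R}.
Variables (z : forall v : nc_vert X, nc_edge X -> chart (nc_comp v))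
  (K : forall v : nc_vert X, nc_edge X -> nc_comp v -> differential (nc_comp v))
  (Omega : forall v : nc_vert X, differential (nc_comp v))
  (r : nc_edge X -> Cx R).

Lemma sum_tuple_cons (I : finType) k (P : pred (seq I)) (F : seq I -> Cx R) :
  \sum_(l : k.+1.-tuple I | P l) F l =
  \sum_(e : I) \sum_(l : k.-tuple I | P (e :: l)) F (e :: l).
Proof.
rewrite pair_big_dep /=.
rewrite (reindex (fun p : I * k.-tuple I => cons_tuple p.1 p.2)) //=.
exists (fun l : k.+1.-tuple I => (thead l, behead_tuple l)) => [[e l] _|l _] /=.
  by congr (_, _); apply: val_inj.
by apply: val_inj => /=; case/tupleP: l => e l.
Qed.

Definition turn (e e' : nc_edge X) := nc_src e' == nc_src (nc_opp e).

(** Paths are extended at their beginning: the recursion for [xi] at the far end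
    of [e] peels off the edge that follows [e]. *)
Lemma xi_leading_paths s k e :
  xi_leading z K Omega r s k (nc_opp e) =
  (-1) ^+ k * \sum_(l : k.-tuple (nc_edge X) | path turn e l)
     (path_s s l * path_beta z K (e :: l) * xi_node z K Omega r s (nc_opp (last e l))).
Proof.
elim: k e => [|k IH] e.
  rewrite expr0 mul1r (big_pred1 [tuple]) /=; last first.
    by move=> l; apply/esym; rewrite (tuple0 l); exact/eqP.
  by rewrite /path_s /path_beta /= !big_nil !mul1r.
rewrite (@sum_tuple_cons _ k (fun l => path turn e l)
  (fun l => path_s s l * path_beta z K (e :: l) * xi_node z K Omega r s (nc_opp (last e l)))) /=.
rewrite big_mkcond big_distrr /=; apply: eq_bigr => e' _.
rewrite /turn; case: ifP => [_|_]; last by rewrite big_pred0 ?mulr0.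
rewrite IH exprS mulN1r mulNr; congr (- _).
rewrite mulrCA; congr (_ * _); rewrite big_distrr /=; apply: eq_bigr => l _.
by rewrite /path_s /path_beta /= !big_cons /=; ring.
Qed.

Lemma eta_leading_edges s k v (phi : chart (nc_comp v)) (p : nc_comp v) :
  eta_leading z K Omega r s k.+1 phi p =
  \sum_(e | nc_src e == v)
    - (s e * omega_node z K e phi p * xi_leading z K Omega r s k (nc_opp e)).
Proof.
rewrite /eta_leading.
rewrite (@sum_tuple_cons _ k
  (fun l => if l is e :: l' then (nc_src e == v) && path turn e l' else true)
  (fun l => if l is e1 :: l' then path_s s l * omega_node z K e1 phi p *
     path_beta z K l * xi_node z K Omega r s (nc_opp (last e1 l')) else 0)) /=.
rewrite big_distrr /= [RHS]big_mkcond /=; apply: eq_bigr => e _.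
case: (nc_src e == v) => /=; last by rewrite big_pred0 ?mulr0.
rewrite xi_leading_paths exprS mulN1r mulNr; congr (- _).
rewrite mulrCA; congr (_ * _); rewrite big_distrr /=; apply: eq_bigr => l _.
by rewrite /path_s big_cons; ring.
Qed.

End Paths.

Lemma cvg_bigsum {R : realType} (T : Type) (F : set_system T) (FF : Filter F)
    (I : Type) (l : seq I) (P : pred I) (f : I -> T -> Cx R) (a : I -> Cx R) :
  (forall i, P i -> f i @ F --> a i) ->
  (fun x => \sum_(i <- l | P i) f i x) @ F --> \sum_(i <- l | P i) a i.
Proof.
move=> fa; elim: l => [|i l IH].
  by under eq_fun do rewrite big_nil; rewrite big_nil; exact: cvg_cst.
under eq_fun do rewrite big_cons; rewrite big_cons.
by have [Pi|//] := boolP (P i); exact: (cvgD (fa i Pi) IH).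
Qed.

(** * The expansion of eta *)
Section Expansion.
Context {R : realType} {X : nodal_curve R}.
Variables (A : forall v : nc_vert X, 'I_(nc_genus v) -> loop (nc_comp v))
  (z : forall v : nc_vert X, nc_edge X -> chart (nc_comp v))
  (q0 : forall v : nc_vert X, nc_comp v)
  (K : forall v : nc_vert X, nc_edge X -> nc_comp v -> differential (nc_comp v))
  (Omega : forall v : nc_vert X, differential (nc_comp v))
  (r : nc_edge X -> Cx R).
Hypothesis coordz : local_coordinates z.
Hypothesis q0_out : forall v e, nc_src e = v -> ~ coord_disc (z v e) (q0 v).
Hypothesis kernelK : forall v e, nc_src e = v ->
  cauchy_kernel_branch (@A v) (q0 v) (coord_disc (z v e)) (@K v e).
Hypothesis stableOmega : stable_differential Omega r.

(** A neighborhood of [x] lies in [Chat], so the limit within the interior of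
    [Chat] is an ordinary punctured limit. *)
Lemma eta_form_cvg s k v (phi : chart (nc_comp v)) (x : nc_comp v) (V : nc_edge X -> Cx R) :
  nbhs x (Chat z s v) ->
  (forall e, nc_src e = v -> (fun y => circle_integral (Num.sqrt (cabs (s e)))
     (fun w => kernel_at z K e phi y w *
        seam_pullback (s e) (xi_form z K Omega r s k (nc_opp e)) w)) @ x^' --> V e) ->
  eta_form z K Omega r s k.+1 phi x = \sum_(e | nc_src e == v) V e.
Proof.
move=> cx cV.
have PF := surface_dnbhs_proper x.
have PW : ProperFilter (within (interior (Chat z s v)) x^').
  apply: Build_ProperFilter_ex => P WP.
  have IC : x^' (interior (Chat z s v)).
    rewrite /dnbhs /within /=.
    by apply: filterS (nbhs_interior cx) => y yC _; exact: yC.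
  have : x^' P by apply: filterS2 IC WP => y yC; apply.
  by move/filter_ex.
apply: cvg_lim; first exact: norm_hausdorff.
have H : (fun y => \sum_(e | nc_src e == v) circle_integral (Num.sqrt (cabs (s e)))
     (fun w => kernel_at z K e phi y w *
        seam_pullback (s e) (xi_form z K Omega r s k (nc_opp e)) w)) @ x^' -->
   \sum_(e | nc_src e == v) V e.
  by apply: cvg_bigsum => e /eqP; exact: cV.
apply: cvg_trans H; apply: cvg_app; exact: cvg_within.
Qed.

Lemma eta_near k v (phi : chart (nc_comp v)) (p : nc_comp v) : chart_dom phi p ->
  (forall e, nc_src e = v -> p <> nc_node v e) ->
  exists2 L : R, 0 < L & \forall x \near p, forall s, plumbing_norm s < L^-1 ->
    cabs (eta_form z K Omega r s k.+1 phi x - eta_leading z K Omega r s k.+1 phi x)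
      <= L * plumbing_norm s ^+ k.+2.
Proof.
move=> dp pn.
have [e|e L L'|L L0 LP] := @finite_bound R (nc_edge X) (fun e L => 0 < L /\
    (nc_src e = v -> \forall x \near p, edge_good z K phi e L x)).
- have [ve|ve] := pselect (nc_src e = v); last by exists 1.
  have [L L0 LP] := edge_local coordz q0_out kernelK ve dp (pn e ve).
  by exists L.
- move=> [L0 LP] LL; split; first exact: lt_le_trans LL.
  by move=> ve; apply: filterS (LP ve) => x; exact: edge_goodW.
have [C C0 CP] := xi_bound coordz q0_out kernelK stableOmega k.
have [D D0 DP] := xi_leading_approx coordz q0_out kernelK stableOmega k.
(* [L * C] comes from [edge_good] and [xi_bound]; [L * D] from replacing the
   value of [xi] at the node by its leading term. *)
pose Q := Num.max (Num.max L 16) (#|nc_edge X|%:R * (L * C + L * D)).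
have Q16 : 16 <= Q by rewrite !le_max lexx orbT.
have QL : L <= Q by rewrite !le_max lexx.
have QE : #|nc_edge X|%:R * (L * C + L * D) <= Q by rewrite le_max lexx orbT.
have Q0 : 0 < Q by exact: lt_le_trans Q16.
exists Q => //.
have good : \forall x \near p, forall e, nc_src e = v -> edge_good z K phi e L x.
  apply: filter_forall => e; have [ve|ve] := pselect (nc_src e = v).
    by apply: filterS ((LP e).2 ve) => x.
  by apply: filterE => x.
apply: filterS (nbhs_interior good) => x xg s sQ.
set N := plumbing_norm s in sQ *.
have N0 : 0 <= N := plumbing_norm_ge0 s.
have s16 : plumbing_norm s < 16^-1.
  by apply: lt_le_trans sQ _; rewrite lef_pV2// posrE.
have sL e : nc_src e = v -> cabs (s e) < L^-1.
  move=> ve; apply: le_lt_trans (plumbing_norm_ge s e) _.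
  by apply: lt_le_trans sQ _; rewrite lef_pV2// posrE; exact: (LP e).1.
have xx := nbhs_singleton xg.
have Cx : nbhs x (Chat z s v).
  apply: filterS xg => y yg e ve; have [_ h _] := yg e ve.
  exact: (h (s e) (sL e ve)).
have df e : forall u, cabs u < 1 -> derivable (xi_form z K Omega r s k e) u 1.
  move=> u u1; apply: (xi_der coordz q0_out kernelK stableOmega) => // e2.
  by have [] := small_seam e2 s16.
have Vex e : exists V, nc_src e = v ->
  (fun y => circle_integral (Num.sqrt (cabs (s e)))
     (fun w => kernel_at z K e phi y w *
        seam_pullback (s e) (xi_form z K Omega r s k (nc_opp e)) w)) @ x^' --> V /\
  cabs (V + s e * xi_form z K Omega r s k (nc_opp e) 0 * omega_node z K e phi x)
    <= L * (C * N ^+ k) * cabs (s e) ^+ 2.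
  have [ve|ve] := pselect (nc_src e = v); last by exists 0.
  have [_ _ h] := xx e ve.
  have [|V cV bV] := h (s e) _ (C * N ^+ k) (sL e ve) (df (nc_opp e)).
    by move=> u u2; exact: CP.
  by exists V.
have [V VP] := boolp.choice Vex.
rewrite (eta_form_cvg Cx (fun e ve => (VP e ve).1)) eta_leading_edges -sumrB.
apply: (@le_trans _ _ (#|nc_edge X|%:R * (L * C + L * D) * N ^+ k.+2)); last first.
  by apply: ler_wpM2r => //; exact: exprn_ge0.
rewrite -mulrA; apply: cabs_sum_const.
  by rewrite mulr_ge0 ?exprn_ge0// addr_ge0// mulr_ge0.
move=> e /eqP ve; have [_ b1] := VP e ve; have [b2 _ _] := xx e ve.
set f0 := xi_form z K Omega r s k (nc_opp e) 0 in b1 *.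
set om := omega_node z K e phi x in b1 b2 *.
have b3 : cabs (f0 - xi_leading z K Omega r s k (nc_opp e)) <= D * N ^+ k.+1 by exact: DP.
set x0 := xi_leading _ _ _ _ _ _ _ in b3 *.
have -> : V e - - (s e * om * x0) = (V e + s e * f0 * om) - s e * om * (f0 - x0) by ring.
have sN : cabs (s e) <= N := plumbing_norm_ge s e.
apply: le_trans (cabsD _ _) _; rewrite cabsN mulrDl; apply: lerD.
  apply: le_trans b1 _.
  have -> : L * C * N ^+ k.+2 = L * (C * N ^+ k) * N ^+ 2 by rewrite !exprS; ring.
  apply: ler_wpM2l; first by rewrite !mulr_ge0 ?exprn_ge0.
  by rewrite ler_pXn2r// nnegrE ?cabs_ge0.
rewrite (cabsM (s e * om)) (cabsM (s e)).
have -> : L * D * N ^+ k.+2 = N * L * (D * N ^+ k.+1) by rewrite exprS; ring.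
have H1 := ler_pM (cabs_ge0 (s e)) (cabs_ge0 om) sN b2.
exact: (ler_pM (mulr_ge0 (cabs_ge0 _) (cabs_ge0 _)) (cabs_ge0 _) H1 b3).
Qed.

End Expansion.

Theorem proposition3p4 (R : realType) (X : nodal_curve R) (g : nat)
  (stableX : stable X) (genusX : arithmetic_genus X = g%:Z)
  (A : forall v : nc_vert X, 'I_(nc_genus v) -> loop (nc_comp v))
  (lagrangianA : forall v, lagrangian_basis (A v))
  (z : forall v : nc_vert X, nc_edge X -> chart (nc_comp v))
  (coordz : local_coordinates z)
  (q0 : forall v : nc_vert X, nc_comp v)
  (q0_out : forall v e, nc_src e = v -> ~ coord_disc (z v e) (q0 v))
  (K : forall v : nc_vert X, nc_edge X ->
       nc_comp v -> differential (nc_comp v))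
  (kernelK : forall v e, nc_src e = v ->
     cauchy_kernel_branch (A v) (q0 v) (coord_disc (z v e)) (K v e))
  (Omega : forall v : nc_vert X, differential (nc_comp v))
  (r : nc_edge X -> Cx R)
  (stableOmega : stable_differential Omega r)
  (v : nc_vert X) (k : nat) (k_gt0 : (0 < k)%N)
  (phi : chart (nc_comp v)) (B : set (nc_comp v)) :
  compact B -> B `<=` chart_dom phi ->
  (forall e, nc_src e = v -> ~ B (nc_node v e)) ->
  exists M delta : R, 0 < delta /\
    forall s : nc_edge X -> Cx R,
      (forall e, s (nc_opp e) = s e) -> plumbing_norm s < delta ->
      forall p, B p -> Chat z s v p ->
        cabs (eta_form z K Omega r s k phi p - eta_leading z K Omega r s k phi p)
        <= M * plumbing_norm s ^+ k.+1.
Proof.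
move=> /compact_near_coveringP cB Bphi Bnode.
case: k k_gt0 => // k _.
have : \forall M \near +oo, B `<=` (fun p => forall s, plumbing_norm s < M^-1 ->
    cabs (eta_form z K Omega r s k.+1 phi p - eta_leading z K Omega r s k.+1 phi p)
      <= M * plumbing_norm s ^+ k.+2).
  apply: (cB R (pinfty_nbhs R)) => p Bp.
  have pn e : nc_src e = v -> p <> nc_node v e.
    by move=> ve pe; apply: (Bnode e ve); rewrite -pe.
  have [L L0 LP] := eta_near coordz q0_out kernelK stableOmega k (Bphi p Bp) pn.
  have nL : \forall M \near +oo, L <= M by apply: nbhs_pinfty_ge; exact: num_real.
  pose G : set (nc_comp v) := fun x => forall s, plumbing_norm s < L^-1 ->
    cabs (eta_form z K Omega r s k.+1 phi x - eta_leading z K Omega r s k.+1 phi x)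
      <= L * plumbing_norm s ^+ k.+2.
  exists (G, fun M : R => L <= M : Prop); first by split; [exact: LP|exact: nL].
  move=> [x M] [/= xP LM] s sM.
  apply: le_trans (xP s _) _.
    by apply: lt_le_trans sM _; rewrite lef_pV2 ?posrE// (lt_le_trans L0).
  by apply: ler_wpM2r => //; rewrite exprn_ge0// plumbing_norm_ge0.
(* One number serves as the constant and as the inverse of [delta]. *)
move=> [M0 [_ HM]]; pose M := Num.max 1 (M0 + 1).
have M1 : 1 <= M by rewrite le_max lexx.
have MM : M0 < M by rewrite lt_max ltrDl ltr01 orbT.
exists M, M^-1; split; first by rewrite invr_gt0 (lt_le_trans ltr01).
by move=> s _ sM p Bp _; exact: (HM M MM p Bp s sM).
Qed.
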